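(* For every $k \geq 4$ and $n\geq k+2$, $$0 \leq f_k(n) - F(k,n) \leq \frac{k(k-1)}{8}-1.$$ In particular, $\phi_k = \frac{k}{2} - \frac{1}{k-1}$.
   Context: Graphs are finite and simple. A graph $G$ is $k$-critical if it is not $(k-1)$-colorable (in the sense of proper vertex colorings), but every proper subgraph of $G$ is $(k-1)$-colorable. $f_k(n)$ denotes the minimum number of edges in a $k$-critical graph with $n$ vertices (for $k \ge 4$, such graphs exist for $n=k$ and for every $n\geq k+2$). Define $F(k,n)=\left\lceil \frac{(k+1)(k-2)n-k(k-3)}{2(k-1)}\right\rceil$ and $\phi_k=\lim_{n\to\infty}\frac{f_k(n)}{n}$ (this limit exists). *)

(* Defs.v *)
From HB Require Import structures.
From mathcomp Require Import all_boot all_order all_algebra.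
From mathcomp Require Import all_classical all_reals all_analysis.
Set Implicit Arguments.
Unset Strict Implicit.
Unset Printing Implicit Defensive.
Import Order.TTheory GRing.Theory Num.Theory.
Import numFieldNormedType.Exports.
Local Open Scope ring_scope.
Local Open Scope classical_set_scope.

(* MathComp-Analysis world. *)

(* A finite simple graph whose vertices are taken in an ambient finite type T;
   the vertex set need not be all of T, so that a subgraph of a graph over T is
   again a graph over T. *)
Record graph (T : finType) := Graph {
  vertices : {set T};
  edges : {set {set T}};
  edgesP : forall e, e \in edges -> e \subset vertices /\ #|e| = 2%N }.

Definition colorable (T : finType) (r : nat) (G : graph T) : Prop :=
  exists c : T -> nat,
    (forall x, x \in vertices G -> (c x < r)%N) /\
    (forall x y, [set x; y]%SET \in edges G -> c x <> c y).

Definition proper_subgraph (T : finType) (H G : graph T) : Prop :=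
  [/\ vertices H \subset vertices G, edges H \subset edges G &
      ~ (vertices H = vertices G /\ edges H = edges G)].

Definition critical (T : finType) (k : nat) (G : graph T) : Prop :=
  ~ colorable k.-1 G /\
  forall H : graph T, proper_subgraph H G -> colorable k.-1 H.

Definition critical_size (k n m : nat) : Prop :=
  exists (T : finType) (G : graph T),
    [/\ critical k G, #|vertices G| = n & #|edges G| = m].

(* The minimum number of edges of a k-critical graph with n vertices, and 0 if
   there is no such graph. As F k n > 0 for k >= 4 and n >= k + 2, a bound
   F k n <= f k n for such k and n entails that the minimum is attained. *)
Definition f (k n : nat) : nat :=
  if pselect (exists m, `[< critical_size k n m >]) is left ex_size
  then ex_minn ex_size else 0%N.

Definition F (k n : nat) : int :=
  Num.ceil (((k%:R + 1) * (k%:R - 2) * n%:R - k%:R * (k%:R - 3))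
            / (2 * (k%:R - 1)) : rat).

Definition edge_density (R : realType) (k : nat) : R ^nat :=
  fun n => (f k n)%:R / n%:R.

Definition phi (R : realType) (k : nat) : R :=
  lim (edge_density R k n @[n --> \oo]).

(* Main.v *)
(* Write [r = k - 1], and let the potential of a vertex set [R] be
   [rho R = (r - 1) (r + 2) |R| - 2 r e(R)]. The lower bound is the Kostochka-Yancey theorem: a
   graph that is not [r]-colourable, but all of whose proper induced subgraphs are, has potential at
   most [(r + 1) (r - 2)]. In a minimal counterexample, colour a proper vertex set [R] and collapse
   its colour classes to a clique. The new graph contains a smaller critical graph, to which the
   theorem applies, and this forces the potential of [R] to be large unless [R] is an [r]-clique. So
   an edge can be added inside a proper vertex set without spoiling its colourability, and a vertex
   of small degree cannot be replaced by a twin of an adjacent vertex of degree [r]; this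
   determines how the vertices of degree [r] are arranged. A list colouring argument with kernels
   of digraphs bounds the number of edges between vertices of degrees [r] and [r + 1], and
   discharging then shows that the average degree is at least [(r - 1) (r + 2) / r], which
   contradicts the choice of the counterexample.

   For the upper bound it suffices to find vertex-critical graphs, since an edge-critical subgraph
   of one of them has the same vertices. A Hajos join with a complete graph on [k] vertices adds
   [k - 1] vertices and preserves the difference between the number of edges and the bound, so only
   [k + 2 <= n <= 2 k] is left. For [n = k + p < 2 k] take the join of a complete graph and a Hajos
   join of two complete graphs on [p + 1] vertices. *)
Require Import Defs.
From HB Require Import structures.
From mathcomp Require Import all_boot all_order all_algebra all_fingroup.
From mathcomp Require Import zify ring lra.
Set Implicit Arguments.
Unset Strict Implicit.
Unset Printing Implicit Defensive.
Import Order.TTheory GRing.Theory Num.Theory.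

(** * Edge counts, colourings and potentials *)

Local Open Scope nat_scope.

Lemma leq_card_setT (T : finType) (A : {set T}) : #|A| <= #|T|.
Proof. exact: max_card. Qed.

Lemma ltn_card_setT (T : finType) (A : {set T}) : A != setT -> #|A| < #|T|.
Proof. by rewrite -properT => /proper_card; rewrite cardsT. Qed.

Section EdgeCounts.
Variables (T : finType) (e : rel T).

(* [eb A A] counts each edge inside [A] twice. *)
Definition eb (A B : {set T}) : nat := \sum_(x in A) \sum_(y in B) e x y.
Definition nb (x : T) : {set T} := [set y | e x y].
Definition clo (x : T) : {set T} := x |: nb x.

Lemma in_nb x y : (y \in nb x) = e x y.
Proof. by rewrite inE. Qed.

Lemma sum_eE x (B : {set T}) : \sum_(y in B) e x y = #|nb x :&: B|.
Proof.
rewrite -sum1_card big_mkcond [RHS]big_mkcond /=; apply: eq_bigr => y _.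
by rewrite !inE; case: (y \in B); case: (e x y).
Qed.

Lemma eb1l x B : eb [set x] B = #|nb x :&: B|.
Proof. by rewrite /eb big_set1 sum_eE. Qed.

Lemma eb_sum A B : eb A B = \sum_(x in A) #|nb x :&: B|.
Proof. by apply: eq_bigr => x _; rewrite sum_eE. Qed.

Lemma eb_card A B :
  eb A B = #|[set p | [&& p.1 \in A, p.2 \in B & e p.1 p.2]]|.
Proof.
rewrite -sum1_card /eb pair_big /= big_mkcond [RHS]big_mkcond.
apply: eq_bigr => -[x y] _; rewrite !inE /=.
by case: (x \in A); case: (y \in B); case: (e x y).
Qed.

Lemma eb_splitl (C A B : {set T}) : eb A B = eb (A :&: C) B + eb (A :\: C) B.
Proof. by rewrite /eb (big_setID C). Qed.

Lemma eb_splitr (C A B : {set T}) : eb A B = eb A (B :&: C) + eb A (B :\: C).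
Proof. by rewrite /eb -big_split; apply: eq_bigr => x _; rewrite (big_setID C). Qed.

Lemma eb_Ul (A A' B : {set T}) :
  [disjoint A & A'] -> eb (A :|: A') B = eb A B + eb A' B.
Proof.
move=> dAA; rewrite (eb_splitl A) setUK; congr (_ + eb _ _).
by rewrite setDUl setDv set0U; apply/setDidPl; rewrite disjoint_sym.
Qed.

Lemma eb_Ur (A B B' : {set T}) :
  [disjoint B & B'] -> eb A (B :|: B') = eb A B + eb A B'.
Proof.
move=> dAA; rewrite (eb_splitr B) setUK; congr (_ + eb _ _).
by rewrite setDUl setDv set0U; apply/setDidPl; rewrite disjoint_sym.
Qed.

Lemma eb0l B : eb set0 B = 0.
Proof. by rewrite /eb big_set0. Qed.

Hypothesis sym_e : symmetric e.

Lemma ebC A B : eb A B = eb B A.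
Proof.
rewrite /eb exchange_big; apply: eq_bigr => y _; apply: eq_bigr => x _.
by rewrite sym_e.
Qed.

Lemma eb_UU (A B : {set T}) : [disjoint A & B] ->
  eb (A :|: B) (A :|: B) = eb A A + eb B B + 2 * eb A B.
Proof.
by move=> dAB; rewrite eb_Ul // !eb_Ur // (ebC B A); lia.
Qed.

Hypothesis irr_e : irreflexive e.

Lemma nb_irr x : x \notin nb x.
Proof. by rewrite inE irr_e. Qed.

Lemma eb_self1 x : eb [set x] [set x] = 0.
Proof.
rewrite eb1l; apply/eqP; rewrite cards_eq0; apply/eqP/setP => y; rewrite !inE.
by case: eqP => [->|]; rewrite ?irr_e ?andbF.
Qed.

Lemma eb_U1 x (A : {set T}) : x \notin A ->
  eb (x |: A) (x |: A) = eb A A + 2 * #|nb x :&: A|.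
Proof.
move=> xA; rewrite eb_UU ?eb_self1 ?eb1l ?add0n //.
by rewrite disjoints1.
Qed.

Lemma eb_D1 x (A : {set T}) : x \in A ->
  eb A A = eb (A :\ x) (A :\ x) + 2 * #|nb x :&: A|.
Proof.
move=> xA; rewrite -{1 2}(setD1K xA) eb_U1 ?setD11 //; congr (_ + 2 * #|pred_of_set _|).
apply/setP => y; rewrite !inE; case: eqP => [->|] //=.
by rewrite irr_e.
Qed.

Lemma card_clo x : #|clo x| = #|nb x|.+1.
Proof. by rewrite cardsU1 nb_irr. Qed.

Lemma in_clo_sym x y : (x \in clo y) = (y \in clo x).
Proof. by rewrite !inE eq_sym sym_e. Qed.

Lemma eb_le_card (A : {set T}) : eb A A + #|A| <= #|A| ^ 2.
Proof.
rewrite eb_sum -sum1_card -big_split /= sum1_card expnS expn1 -sum_nat_const.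
apply: leq_sum => x xA.
rewrite addn1; apply: proper_card; apply/properP; split; first exact: subsetIr.
by exists x => //; rewrite !inE irr_e.
Qed.

End EdgeCounts.

Definition twin_rel (T : finType) (e : rel T) : rel T := fun x y => clo e x == clo e y.
Definition cluster (T : finType) (e : rel T) (x : T) : {set T} := nb (twin_rel e) x.

Section Colorings.
Variables (r : nat) (T : finType).
Implicit Types (e : rel T) (R S W : {set T}) (c : T -> 'I_r).

Definition proper_on e R c : Prop :=
  forall x y, x \in R -> y \in R -> e x y -> c x <> c y.

Definition colorable_on e R : bool :=
  [exists c : {ffun T -> 'I_r},
    [forall x in R, forall y in R, e x y ==> (c x != c y)]].

Lemma colorable_onP e R : reflect (exists c, proper_on e R c) (colorable_on e R).
Proof.
apply: (iffP existsP) => [[c /forall_inP H]|[c H]].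
  exists c => x y xR yR exy; apply/eqP.
  by move/forall_inP: (H x xR) => /(_ y yR) /implyP /(_ exy).
exists (finfun c); apply/forall_inP => x xR; apply/forall_inP => y yR.
by apply/implyP => exy; rewrite !ffunE; apply/eqP; apply: H.
Qed.

Lemma proper_onS e R S c : S \subset R -> proper_on e R c -> proper_on e S c.
Proof. by move=> /subsetP sSR H x y /sSR xR /sSR yR; apply: H. Qed.

Lemma colorable_onS e R S : S \subset R -> colorable_on e R -> colorable_on e S.
Proof. by move=> sSR /colorable_onP[c Hc]; apply/colorable_onP; exists c; apply: proper_onS Hc. Qed.

Lemma free_color (N : {set T}) c : #|N| < r ->
  exists a : 'I_r, forall y, y \in N -> c y <> a.
Proof.
move=> Nr; have: 0 < #|~: (c @: N)|.
  have := cardsC (c @: N); rewrite card_ord.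
  by have := leq_imset_card c N; lia.
case/card_gt0P => a; rewrite inE => aN; exists a => y yN cy; case/negP: aN.
by rewrite -cy imset_f.
Qed.

Lemma proper_extend e R c x a : symmetric e -> irreflexive e ->
  proper_on e (R :\ x) c -> (forall y, y \in R -> e x y -> c y <> a) ->
  proper_on e R (fun z => if z == x then a else c z).
Proof.
move=> sym_e irr_e Hc Ha y z yR zR eyz.
case: eqP => [yx|/eqP yx]; case: eqP => [zx|/eqP zx].
- by move: eyz; rewrite yx zx irr_e.
- by move=> az; apply: (Ha z) => //; rewrite -yx.
- by apply: (Ha y) => //; rewrite sym_e -zx.
- by apply: Hc; rewrite ?inE ?yx ?zx.
Qed.

Definition vcrit e W := minset (fun S => ~~ colorable_on e S) W.

Lemma vcritP e W : reflect (~~ colorable_on e W /\ forall S, S \proper W -> colorable_on e S) (vcrit e W).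
Proof.
apply: (iffP minsetP) => [[nW Hm]|[nW Hm]]; split=> //.
  move=> S /properP[sSW [x xW xS]]; apply: contraT => nS.
  by have SW := Hm S nS sSW; rewrite SW xW in xS.
move=> S nS sSW; apply/eqP; rewrite eqEproper sSW /=.
by apply: contra nS => /Hm.
Qed.

Lemma vcrit_exists e S : ~~ colorable_on e S -> exists2 W, vcrit e W & W \subset S.
Proof. by move=> nS; have [W mW sW] := @minset_exists _ (fun S => ~~ colorable_on e S) S nS; exists W. Qed.

Lemma vcrit_deg e W x : symmetric e -> irreflexive e ->
  vcrit e W -> x \in W -> r <= #|nb e x :&: W|.
Proof.
move=> sym_e irr_e /vcritP[nW Hm] xW; rewrite leqNgt; apply/negP => dx.
have /Hm/colorable_onP[c Hc] : W :\ x \proper W by rewrite properD1.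
have [a Ha] := free_color c dx.
case/negP: nW; apply/colorable_onP; exists (fun z => if z == x then a else c z).
by apply: proper_extend => // y yW exy; apply: Ha; rewrite !inE exy yW.
Qed.

Lemma vcrit_neq0 e W : 0 < r -> vcrit e W -> W != set0.
Proof.
move=> r0 /vcritP[nW _]; apply: contraNneq nW => ->; apply/colorable_onP.
by exists (fun=> Ordinal r0) => x y; rewrite inE.
Qed.

Lemma vcrit_card e W : symmetric e -> irreflexive e -> 0 < r ->
  vcrit e W -> r < #|W|.
Proof.
move=> sym_e irr_e r0 cW; have /set0Pn[x xW] := vcrit_neq0 r0 cW.
apply: leq_ltn_trans (vcrit_deg sym_e irr_e cW xW) _.
apply: proper_card; apply/properP; split; first exact: subsetIr.
by exists x => //; rewrite !inE irr_e.
Qed.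

End Colorings.

Local Open Scope ring_scope.

Definition rho (r : nat) (T : finType) (e : rel T) (R : {set T}) : int :=
  (r%:Z * r%:Z + r%:Z - 2) * #|R|%:Z - r%:Z * (eb e R R)%:Z.

Definition rho_clique (r i : nat) : int :=
  i%:Z * (r%:Z * r%:Z + 2 * r%:Z - 2 - r%:Z * i%:Z).

Lemma rho_cliqueE r i :
  rho_clique r i - 2 * r%:Z * (r%:Z - 1) = (r%:Z - i%:Z) * (r%:Z * (i%:Z - 2) + 2).
Proof. by rewrite /rho_clique; lia. Qed.

Lemma rho_clique_ge r i : (3 <= r)%N -> (2 <= i)%N -> (i <= r)%N ->
  2 * r%:Z * (r%:Z - 1) <= rho_clique r i.
Proof. move=> r3 i2 ir; have E := rho_cliqueE r i.
suff: 0 <= (r%:Z - i%:Z) * (r%:Z * (i%:Z - 2) + 2) by lia.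
apply: mulr_ge0; first lia.
have: 0 <= r%:Z * (i%:Z - 2) by apply: mulr_ge0; lia.
lia. Qed.

Lemma rho_ge_clique r (T : finType) (e : rel T) (R : {set T}) : irreflexive e ->
  rho_clique r #|R| <= rho r e R.
Proof.
move=> irr_e; have := leq_mul (leqnn r) (eb_le_card irr_e R).
by rewrite /rho /rho_clique; lia.
Qed.

Definition clique (T : finType) (e : rel T) (C : {set T}) : Prop :=
  forall x y, x \in C -> y \in C -> x != y -> e x y.

Lemma clique_eb (T : finType) (e : rel T) (C : {set T}) : irreflexive e ->
  clique e C -> (eb e C C + #|C| = #|C| ^ 2)%N.
Proof.
move=> irr_e cC; rewrite eb_sum -sum1_card -big_split /= sum1_card expnS expn1.
rewrite -sum_nat_const; apply: eq_bigr => x xC.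
rewrite addn1 (cardsD1 x C) xC; congr _.+1; congr #|pred_of_set _|.
apply/setP => y; rewrite !inE; case: eqP => [->|/eqP yx]; first by rewrite irr_e.
by case yC: (y \in C); rewrite ?andbF //= cC // eq_sym.
Qed.

Lemma eb_clique (T : finType) (e : rel T) (C : {set T}) : irreflexive e ->
  (#|C| ^ 2 <= eb e C C + #|C|)%N -> clique e C.
Proof.
move=> irr_e H x y xC yC xy; apply/negPn/negP => nxy.
suff: (eb e C C + #|C| < #|C| ^ 2)%N by lia.
rewrite eb_sum -sum1_card -big_split /= sum1_card expnS expn1 -sum_nat_const.
rewrite (bigD1 x) //= [ltnRHS](bigD1 x) //= -addSn; apply: leq_add.
  rewrite addn1; suff: (#|x |: (y |: (nb e x :&: C))| <= #|C|)%N.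
    by rewrite !cardsU1 !inE irr_e (negPf xy) (negPf nxy).
  apply: subset_leq_card; apply/subsetP => z.
  by rewrite !inE => /or3P[/eqP->|/eqP->|/andP[]].
apply: leq_sum => z /andP[zC _].
rewrite addn1; apply: proper_card; apply/properP; split; first exact: subsetIr.
by exists z => //; rewrite !inE irr_e.
Qed.

Local Open Scope nat_scope.

Section Transfer.
Variables (r : nat) (T1 T2 : finType) (e1 : rel T1) (e2 : rel T2).

Lemma colorable_on_hom (h : T1 -> T2) (R1 : {set T1}) (R2 : {set T2}) :
  (forall x, x \in R1 -> h x \in R2) ->
  (forall x y, x \in R1 -> y \in R1 -> e1 x y -> e2 (h x) (h y)) ->
  colorable_on r e2 R2 -> colorable_on r e1 R1.
Proof.
move=> hR he /colorable_onP[c Hc]; apply/colorable_onP; exists (c \o h) => x y xR yR exy.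
by apply: Hc; [apply: hR | apply: hR | apply: he].
Qed.

Variable f : T1 -> T2.
Hypotheses (f_inj : injective f) (f_e : forall x y, e2 (f x) (f y) = e1 x y).

Lemma eb_imset (A B : {set T1}) : eb e2 (f @: A) (f @: B) = eb e1 A B.
Proof.
rewrite /eb big_imset /=; last by move=> x y _ _; apply: f_inj.
apply: eq_bigr => x _; rewrite big_imset /=; last by move=> ? ? _ _; apply: f_inj.
by apply: eq_bigr => y _; rewrite f_e.
Qed.

Lemma rho_imset (A : {set T1}) : rho r e2 (f @: A) = rho r e1 A.
Proof. by rewrite /rho eb_imset card_imset. Qed.

Lemma colorable_on_imset (A : {set T1}) : 0 < r -> colorable_on r e2 (f @: A) = colorable_on r e1 A.
Proof.
move=> r0; apply/idP/idP.
  by apply: (colorable_on_hom (h := f)) => [x xA|x y _ _]; rewrite ?imset_f ?f_e.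
case/colorable_onP=> c Hc; apply/colorable_onP.
pose g y := if [pick x | f x == y] is Some x then c x else Ordinal r0.
have gf x : g (f x) = c x.
  rewrite /g; case: pickP => [z /eqP/f_inj->//|/(_ x)]; by rewrite eqxx.
exists g => _ _ /imsetP[x xA ->] /imsetP[y yA ->]; rewrite f_e !gf; exact: Hc.
Qed.

Lemma vcrit_imset (A : {set T1}) : 0 < r -> vcrit r e2 (f @: A) -> vcrit r e1 A.
Proof.
move=> r0 /vcritP[nA Hm]; apply/vcritP; rewrite -colorable_on_imset //; split=> // S SA.
by rewrite -colorable_on_imset //; apply: Hm; apply: imset_proper => // x y _ _; apply: f_inj.
Qed.

End Transfer.

Local Open Scope ring_scope.

Definition ky_bound (r : nat) : int := r%:Z * r%:Z - r%:Z - 2.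

Definition ky_holds (r : nat) (T : finType) (e : rel T) : Prop :=
  symmetric e -> irreflexive e -> vcrit r e [set: T] ->
  rho r e [set: T] <= ky_bound r.

Lemma ky_holds_sub (r : nat) (T : finType) (e : rel T) (W : {set T}) :
  (0 < r)%N -> symmetric e -> irreflexive e -> vcrit r e W ->
  (forall (T' : finType) (e' : rel T'), #|T'| = #|W| -> ky_holds r e') ->
  rho r e W <= ky_bound r.
Proof.
move=> r0 sym_e irr_e cW H.
pose T' : finType := {x : T | x \in W}; pose e' : rel T' := relpre val e.
have WE : W = val @: [set: T'].
  apply/setP => x; apply/idP/imsetP => [xW|[y _ ->]]; last exact: valP.
  by exists (exist _ x xW).
have h := H T' e' (card_sig _).
have vi : injective (val : T' -> T) := val_inj.
have ve (x y : T') : e (val x) (val y) = e' x y by [].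
rewrite {1}WE (rho_imset r vi ve); apply: h.
- by move=> x y; apply: sym_e.
- by move=> x; apply: irr_e.
- by apply: (vcrit_imset vi ve) => //; rewrite -WE.
Qed.

Section Collapse.
Variables (r : nat) (T : finType) (e : rel T).
Hypotheses (sym_e : symmetric e) (irr_e : irreflexive e).
Variables (R : {set T}) (c : T -> 'I_r).

(* The colour classes of [c] on [R] become the vertices of an [r]-clique. *)
Definition collapse : rel ('I_r + T) := fun z t =>
  match z, t with
  | inl i, inl j => i != j
  | inl i, inr v => [exists u in R, (c u == i) && e u v]
  | inr v, inl i => [exists u in R, (c u == i) && e u v]
  | inr u, inr v => e u v
  end.

Definition collapse_set : {set 'I_r + T} :=
  [set z | if z is inr v then v \notin R else true].

Lemma collapse_sym : symmetric collapse.
Proof. by move=> [i|u] [j|v] //=; rewrite 1?eq_sym. Qed.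

Lemma collapse_irr : irreflexive collapse.
Proof. by move=> [i|u] /=; rewrite ?eqxx ?irr_e. Qed.

Lemma collapse_ncol : proper_on e R c -> ~~ colorable_on r e [set: T] ->
  ~~ colorable_on r collapse collapse_set.
Proof.
move=> Hc; apply: contra => /colorable_onP[d Hd]; apply/colorable_onP.
exists (fun x => if x \in R then d (inl (c x)) else d (inr x)) => x y _ _ exy.
case: ifP => xR; case: ifP => yR; apply: Hd; rewrite ?inE ?xR ?yR //=.
- by apply/eqP; apply: Hc.
- by apply/existsP; exists x; rewrite xR eqxx.
- by apply/existsP; exists y; rewrite yR eqxx sym_e.
Qed.

Lemma card_collapse_set : #|collapse_set| = (r + (#|T| - #|R|))%N.
Proof.
have -> : collapse_set = inl @: [set: 'I_r] :|: inr @: (~: R).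
  apply/setP => -[i|v]; rewrite !inE; symmetry.
    by apply/orP; left; apply: imset_f.
  rewrite (mem_imset _ _ (@inr_inj _ _)) inE; case: imsetP => // -[? _ //].
rewrite cardsU (_ : _ :&: _ = set0) ?cards0 ?subn0.
  rewrite !card_imset; [|exact: inr_inj|exact: inl_inj].
  by rewrite cardsT card_ord cardsCs setCK.
by apply/setP => z; rewrite !inE; apply/andP => -[/imsetP[? _ ->] /imsetP[? _]].
Qed.

Lemma collapse_eb (J : {set 'I_r}) (D : {set T}) :
  (eb collapse (inl @: J) (inr @: D) <= eb e [set u in R | c u \in J] D)%N.
Proof.
rewrite (ebC collapse_sym) (ebC sym_e) !eb_sum.
rewrite big_imset /=; last by move=> x y _ _ [].
apply: leq_sum => v vD.
have <- : #|[set j in J | collapse (inr v) (inl j)]| =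
    #|nb collapse (inr v) :&: inl @: J|.
  rewrite -(card_imset _ (@inl_inj 'I_r T)); apply: eq_card => z.
  apply/imsetP/setIP => [[j + ->]|[zv /imsetP[j jJ zj]]].
    rewrite inE => /andP[jJ H]; rewrite in_nb; split=> //; exact: imset_f.
  by exists j => //; rewrite inE jJ; move: zv; rewrite zj in_nb.
apply: leq_trans (leq_imset_card c _); apply/subset_leq_card/subsetP => j.
rewrite inE => /andP[jJ] /= /exists_inP[u uR /andP[/eqP cu euv]].
by apply/imsetP; exists u; rewrite // !inE sym_e euv uR cu jJ.
Qed.

Lemma collapse_clique (J : {set 'I_r}) :
  (eb collapse (inl @: J) (inl @: J) + #|J| = #|J| ^ 2)%N.
Proof.
rewrite -(card_imset _ (@inl_inj 'I_r T)); apply: clique_eb; first exact: collapse_irr.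
move=> _ _ /imsetP[i _ ->] /imsetP[j _ ->] /=; by apply: contra => /eqP->.
Qed.

Lemma collapse_extend : (r < #|R|)%N -> (0 < r)%N -> R != setT ->
  proper_on e R c -> vcrit r e [set: T] ->
  (forall W, vcrit r collapse W -> (#|W| < #|T|)%N ->
     rho r collapse W <= ky_bound r) ->
  exists (J : {set 'I_r}) (D : {set T}),
    [/\ J != set0, D != set0, [disjoint R & D],
        rho r e (R :|: D) + rho_clique r #|J| +
          2 * r%:Z * (eb e [set u in R | c u \notin J] D)%:Z
          <= ky_bound r + rho r e R &
        forall j u0, J = [set j] -> u0 \in R ->
          exists u, [/\ u \in R, u != u0, c u = j & exists2 v, v \in D & e u v]].
Proof.
move=> rR r0 RT Hc /vcritP[nT Tm] H.
have propercol (S : {set T}) : S != setT -> colorable_on r e S.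
  by move=> ST; apply: Tm; rewrite properT.
have [W cW WS] := vcrit_exists (collapse_ncol Hc nT).
have {}H : rho r collapse W <= ky_bound r.
  apply: H => //; apply: leq_ltn_trans (subset_leq_card WS) _.
  by rewrite card_collapse_set; have := leq_card_setT R; move: rR; clear; lia.
have /vcritP[nW Wm] := cW.
pose J := [set j | inl j \in W]; pose D := [set v | inr v \in W].
have WE : W = inl @: J :|: inr @: D.
  apply/setP => -[i|v]; rewrite !inE.
    rewrite (mem_imset _ _ (@inl_inj _ _)) inE; case: imsetP => [[? _ //]|_].
    by rewrite orbF.
  by rewrite (mem_imset _ _ (@inr_inj _ _)) inE; case: imsetP => // -[? _ //].
have dis : [disjoint inl @: J & (inr @: D : {set 'I_r + T})].
  rewrite -setI_eq0; apply/eqP/setP => z; rewrite !inE.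
  by apply/andP => -[/imsetP[? _ ->] /imsetP[? _]].
have RD : [disjoint R & D].
  rewrite -setI_eq0; apply/eqP/setP => z; rewrite !inE; apply/andP => -[zR].
  by move/(subsetP WS); rewrite inE zR.
have R2 (u0 : T) : u0 \in R -> D :|: [set u0] != setT.
  move=> u0R; apply/eqP => DT; suff: (#|R| <= 1)%N by move: rR r0; clear; lia.
  rewrite -(cards1 u0); apply/subset_leq_card/subsetP => u uR.
  have: u \in D :|: [set u0] by rewrite DT inE.
  by rewrite in_setU (disjointFr RD uR).
have Jin j : (j \in J) = (inl j \in W) by rewrite inE.
have Din v : (v \in D) = (inr v \in W) by rewrite inE.
clearbody J D.
have [u0 u0R] : exists u0, u0 \in R by apply/card_gt0P; lia.
have DT : D != setT.
  by apply: contraNneq (R2 _ u0R) => ->; rewrite setTU.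
have eb'D : eb collapse (inr @: D) (inr @: D) = eb e D D.
  by apply: eb_imset => //; exact: inr_inj.
exists J, D; split=> //.
- apply: contraNneq nW => J0.
  apply: (colorable_on_hom (h := fun z => if z is inr v then v else u0)) (propercol _ DT).
    move=> [j|v]; last by rewrite Din.
    by move=> jW; have := in_set0 j; rewrite -J0 Jin jW.
  move=> [i|v] [j|w] //= iW jW; first by have := in_set0 i; rewrite -J0 Jin iW.
    by have := in_set0 i; rewrite -J0 Jin iW.
  by have := in_set0 j; rewrite -J0 Jin jW.
- apply: contraNneq nW => D0.
  apply/colorable_onP; exists (fun z => if z is inl i then i else c u0).
  move=> [i|v] [j|w] //= iW jW; first by move/eqP.
  + by have := in_set0 w; rewrite -D0 Din jW.
  + by have := in_set0 v; rewrite -D0 Din iW.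
  + by have := in_set0 v; rewrite -D0 Din iW.
- have E1 := eb_UU sym_e RD.
  have E2 : eb e R D = (eb e [set u in R | c u \in J] D
                        + eb e [set u in R | c u \notin J] D)%N.
    rewrite -eb_Ul; last first.
      rewrite -setI_eq0; apply/eqP/setP => z; rewrite !inE; by case: (z \in R) => //=; case: (c z \in J).
    congr eb; apply/setP => z; rewrite !inE.
    by case: (z \in R) => //=; case: (c z \in J).
  have E3 := eb_UU collapse_sym dis.
  have E4 : #|W| = (#|J| + #|D|)%N.
    rewrite WE cardsU (_ : _ :&: _ = set0) ?cards0 ?subn0; last by apply/eqP; rewrite setI_eq0.
    by rewrite !card_imset; [|exact: inr_inj|exact: inl_inj].
  have E5 : #|R :|: D| = (#|R| + #|D|)%N.
    by rewrite cardsU (_ : _ :&: _ = set0) ?cards0 ?subn0 //; apply/eqP; rewrite setI_eq0.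
  have E6 := collapse_clique J; have E7 := collapse_eb J D.
  have E8 : eb collapse W W = (eb collapse (inl @: J) (inl @: J) + eb e D D
      + 2 * eb collapse (inl @: J) (inr @: D))%N.
    by rewrite {1 2}WE E3 eb'D.
  move: H; rewrite /rho /rho_clique E1 E2 E4 E5 E8.
  have E9 : (r * eb collapse (inl @: J) (inr @: D) <= r * eb e [set u in R | c u \in J] D)%N.
    by rewrite leq_mul2l E7 orbT.
  have E10 : (r * eb collapse (inl @: J) (inl @: J) + r * #|J| = r * (#|J| * #|J|))%N.
    by rewrite -mulnDr E6 mulnn.
  move: E9 E10; clear; rewrite /ky_bound.
  set a := eb _ _ _; set b := eb _ _ _; set d := eb _ _ _; set f := eb _ _ _; set g := eb _ _ _.
  set h := eb _ _ _; set j := #|J|; set m := #|D|; set l := #|R|.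
  clearbody a b d f g h j m l; clear => H1 H2 H3; nia.
- move=> j u1 JE u1R.
  suff /existsP[u /and4P[uR uu /eqP cu /exists_inP[v vD euv]]] : 
      [exists u, [&& u \in R, u != u1, c u == j & [exists v in D, e u v]]].
    by exists u; split=> //; exists v.
  apply: contraNT nW; rewrite negb_exists => /forallP Hn.
  apply: (colorable_on_hom (h := fun z => if z is inr v then v else u1)) (propercol _ (R2 u1 u1R)).
    by move=> [i|v] zW; rewrite !inE ?Din ?eqxx ?orbT ?zW.
  have only u v : v \in D -> u \in R -> c u = j -> e u v -> u = u1.
    move=> vD uR cu euv; apply/eqP; apply: contraNT (Hn u) => uu.
    by rewrite uR uu cu eqxx /=; apply/exists_inP; exists v.
  have inJ i : inl i \in W -> i = j.
    by move=> iW; apply/eqP; rewrite -in_set1 -JE Jin.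
  move=> [i|v] [k|w] //= /[dup] zW + /[dup] tW.
  + by move=> /inJ-> /inJ->; rewrite eqxx.
  + move=> /inJ-> wW /exists_inP[u uR /andP[/eqP cu euv]].
    by rewrite -(only u w) // Din.
  + move=> vW /inJ-> /exists_inP[u uR /andP[/eqP cu euv]].
    by rewrite sym_e -(only u v) // Din.
Qed.

End Collapse.

Local Open Scope nat_scope.

Section Spread.
Variable T : finType.
Implicit Types (s : seq T) (w : T -> nat).

Definition copies w s := flatten [seq nseq (w u) u | u <- s].

Lemma count_copies w s (a : pred T) : count a (copies w s) = \sum_(u <- s | a u) w u.
Proof.
elim: s => [|u s IH]; first by rewrite big_nil.
by rewrite /copies /= count_cat count_nseq big_cons IH; case: (a u); rewrite ?mul1n.
Qed.

Lemma size_copies w s : size (copies w s) = \sum_(u <- s) w u.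
Proof. by rewrite -count_predT count_copies. Qed.

Lemma mem_copies w s u : u \in copies w s -> u \in s.
Proof. by case/flattenP => _ /mapP[v vs ->]; rewrite mem_nseq => /andP[_ /eqP->]. Qed.

Lemma copies_close w s x0 p q : uniq s -> p < q -> q < size (copies w s) ->
  nth x0 (copies w s) p = nth x0 (copies w s) q -> q - p < w (nth x0 (copies w s) p).
Proof.
elim: s p q => [|u s IH] p q; first by case: q.
have -> : copies w (u :: s) = nseq (w u) u ++ copies w s by [].
rewrite /= => /andP[us Us] pq; rewrite size_cat size_nseq => qs.
rewrite !nth_cat !size_nseq !nth_nseq; case: (ltnP p) => pw; case: (ltnP q) => qw.
- by move=> _; lia.
- move=> E; case/negP: us; rewrite {1}E; apply: (@mem_copies w); apply: mem_nth.
  by rewrite ltn_subLR.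
- by move=> _; lia.
- move=> E; have pq' : p - w u < q - w u by lia.
  have qs' : q - w u < size (copies w s) by lia.
  by have := IH _ _ Us pq' qs' E; lia.
Qed.

Lemma count_zip_ge (a : pred T) s t : size s = size t ->
  (forall p, p \in zip s t -> a p.1 || a p.2) -> size s <= count a s + count a t.
Proof.
elim: s t => [|x s IH] [|y t] //= [st] H.
have := IH t st (fun p pst => H p (mem_behead (s := _ :: _) pst)).
have := H (x, y); rewrite inE eqxx => /(_ isT) /=.
by case: (a x); case: (a y) => //=; lia.
Qed.

(* If some vertex has weight at least [i], then [hs] is a star at it. Otherwise list every vertex as
   often as its weight says, and join the entries at distance [i]. *)
Lemma spread_pairs (R : {set T}) w i : 2 * i <= \sum_(u in R) w u ->
  exists hs : seq (T * T),
    [/\ size hs <= i,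
        forall p, p \in hs -> [/\ p.1 != p.2, p.1 \in R & p.2 \in R] &
        forall M : {set T}, M \subset R -> 2 <= #|M| ->
          (forall u, u \in M -> 0 < w u) ->
          (forall p, p \in hs -> ~~ ((p.1 \in M) && (p.2 \in M))) ->
          i <= \sum_(u in R :\: M) w u].
Proof.
move=> wR; case: (boolP [exists u in R, i <= w u]) => [/exists_inP[u uR wu]|].
  pose S := take i (enum [set v in R :\ u | 0 < w v]).
  exists [seq (u, v) | v <- S]; split.
  - by rewrite size_map size_take; case: ltnP.
  - move=> _ /mapP[v /mem_take + ->] /=; rewrite mem_enum !inE => /andP[/andP[vu vR] _].
    by rewrite eq_sym.
  - move=> M sM M2 wM Hp; case: (boolP (u \in M)) => uM; last first.
      by apply: leq_trans wu _; rewrite (bigD1 u) ?inE ?uM ?uR //= leq_addr.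
    have SM v : v \in S -> v \notin M.
      by move=> vS; have := Hp (u, v) (map_f _ vS); rewrite /= uM.
    have [v vM vu] : exists2 v, v \in M & v != u.
      have /card_gt0P[v] : 0 < #|M :\ u| by move: M2; rewrite (cardsD1 u) uM.
      by rewrite !inE => /andP[vu vM]; exists v.
    have vE : v \in enum [set v in R :\ u | 0 < w v].
      by rewrite mem_enum !inE vu (subsetP sM) //= wM.
    have Si : size S = i.
      rewrite size_take; case: ltnP => // le; have := SM v.
      by rewrite /S take_oversize // vE vM => /(_ isT).
    rewrite -Si -(card_uniqP (take_uniq _ (enum_uniq _))) -cardsE -sum1_card.
    rewrite [leqRHS](big_setID [set v in S]) /= (_ : _ :&: _ = [set v in S]).
      apply: leq_trans (leq_addr _ _); apply: leq_sum => x; rewrite inE => /mem_take.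
      by rewrite mem_enum !inE => /andP[].
    apply/setP => x; rewrite !inE; case xS: (x \in S); rewrite ?andbF // SM //.
    by move/mem_take: xS; rewrite mem_enum !inE => /andP[/andP[_ ->]].
rewrite negb_exists_in => /forall_inP wi.
case: i => [|i] in wR wi *; first by exists [::]; split.
pose l := copies w (enum R).
have sl : 2 * i.+1 <= size l by rewrite size_copies big_enum.
have [x0 x0R] : exists x0, x0 \in R.
  apply/card_gt0P; rewrite lt0n; apply/eqP => R0; move: wR.
  by rewrite (cards0_eq R0) big_set0.
pose s := take i.+1 l; pose t := take i.+1 (drop i.+1 l).
have ss : size s = i.+1 by rewrite size_take; case: ltnP; lia.
have st : size t = i.+1 by rewrite size_take size_drop; case: ltnP; lia.
exists (zip s t); split.
- by rewrite size_zip ss st minnn.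
- move=> p pst; have sR : {subset l <= R} by move=> x /mem_copies; rewrite mem_enum.
  have [/mem_take ps /mem_take/mem_drop pt] : p.1 \in s /\ p.2 \in t.
    case: p pst => x y pst.
    by have := map_f fst pst; have := map_f snd pst;
      rewrite -/(unzip1 _) -/(unzip2 _) unzip1_zip ?unzip2_zip ?ss ?st.
  split; [|exact: sR|exact: sR].
  have /(nthP (x0, x0))[j] := pst; rewrite size_zip ss st minnn => jlt <-.
  rewrite nth_zip ?ss //= nth_take // nth_take // nth_drop; apply/eqP => E.
  have jl : i.+1 + j < size l by lia.
  have jj : j < i.+1 + j by lia.
  have := copies_close (enum_uniq _) jj jl E.
  have lR : nth x0 l j \in R by apply: sR; apply: mem_nth; apply: leq_ltn_trans jl; exact: leq_addl.
  have := wi _ lR; rewrite -/l -ltnNge addnK => h1 h2.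
  by have := ltn_trans h2 h1; rewrite ltnn.
- move=> M sM M2 wM Hp.
  have := @count_zip_ge [predC M] s t; rewrite ss st => /(_ erefl) H.
  apply: leq_trans (H _) _; first by move=> p /Hp; rewrite negb_and.
  have -> : \sum_(u in R :\: M) w u = count [predC M] l.
    by rewrite count_copies big_enum_cond; apply: eq_bigl => u; rewrite !inE andbC.
  have -> : count [predC M] l = count [predC M] s + count [predC M] (drop i.+1 l).
    by rewrite -count_cat cat_take_drop.
  rewrite leq_add2l -[X in _ <= count _ X](cat_take_drop i.+1) count_cat; exact: leq_addr.
Qed.

End Spread.

Section AddEdges.
Variables (T : finType) (e : rel T) (hs : seq (T * T)).

Definition add_edges : rel T := fun x y => [|| e x y, (x, y) \in hs | (y, x) \in hs].

Lemma add_edges_sym : symmetric e -> symmetric add_edges.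
Proof. by move=> sym_e x y; rewrite /add_edges sym_e; congr orb; rewrite orbC. Qed.

Lemma add_edges_irr : irreflexive e -> (forall p, p \in hs -> p.1 != p.2) ->
  irreflexive add_edges.
Proof.
move=> irr_e H x; rewrite /add_edges irr_e /= orbb; apply/negP => /H /=.
by rewrite eqxx.
Qed.

Lemma add_edges_eb (W : {set T}) : eb add_edges W W <= eb e W W + 2 * size hs.
Proof.
have one (q : T * T) : \sum_(x in W) \sum_(y in W) ((x, y) == q) <= 1.
  rewrite pair_big /=; apply: (@leq_trans (\sum_(p | p == q) 1)); last by rewrite big_pred1_eq.
  rewrite big_mkcond [leqRHS]big_mkcond; apply: leq_sum => -[x y] _ /=.
  by case: ifP; case: eqP.
have cnt : \sum_(x in W) \sum_(y in W) ((x, y) \in hs) <= size hs.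
  elim: hs => [|q s IH]; first by rewrite big1 // => x _; rewrite big1.
  rewrite /= -add1n; apply: leq_trans (leq_add (one q) IH); rewrite -big_split /=.
  apply: leq_sum => x _; rewrite -big_split; apply: leq_sum => y _ /=.
  by rewrite inE; case: (_ == q); case: (_ \in s).
have cnt' : \sum_(x in W) \sum_(y in W) ((y, x) \in hs) <= size hs.
  by rewrite exchange_big.
rewrite mul2n -addnn; apply: leq_trans (leq_add (leqnn _) (leq_add cnt cnt')).
rewrite -big_split -big_split /=; apply: leq_sum => x _.
rewrite -!big_split /=; apply: leq_sum => y _; rewrite /add_edges.
by case: (e x y); case: (_ \in hs); case: (_ \in hs).
Qed.

End AddEdges.

(* An edge of the cut is bad for just one of the [r] cyclic shifts of the colours of [R]. *)
Lemma cut_ge (r : nat) (T : finType) (e : rel T) (R : {set T}) :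
  vcrit r e setT -> symmetric e -> R != set0 -> R != setT -> r <= eb e R (~: R).
Proof.
case: r => // r /vcritP[nT Tm] sym_e R0 RT.
have [/colorable_onP[c1 H1] /colorable_onP[c2 H2]] : colorable_on r.+1 e R /\ colorable_on r.+1 e (~: R).
  split; apply: Tm; rewrite properT //.
  by apply: contraNneq R0 => RC; rewrite -(setCK R) RC setCT.
rewrite leqNgt; apply/negP => lt.
pose E := [set p : T * T | [&& p.1 \in R, p.2 \in ~: R & e p.1 p.2]].
have /card_gt0P[s] : 0 < #|~: [set c2 p.2 - c1 p.1 | p in E]%R|.
  rewrite cardsCs setCK card_ord subn_gt0; apply: leq_ltn_trans (leq_imset_card _ _) _.
  by rewrite -eb_card.
rewrite inE => /imsetP sE; case/negP: nT; apply/colorable_onP.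
have cross x y : x \in R -> y \notin R -> e x y -> (c1 x + s)%R <> c2 y.
  move=> xR yR exy E0; case: sE; exists (x, y); first by rewrite !inE xR yR.
  by rewrite /= -E0 addrC addKr.
exists (fun x => if x \in R then c1 x + s else c2 x)%R => x y _ _ exy.
case: ifP => xR; case: ifP => yR.
- by move/addIr; apply: H1.
- by apply: cross; rewrite ?yR.
- by move/esym; apply: cross; rewrite ?xR // sym_e.
- by apply: H2; rewrite // inE ?xR ?yR.
Qed.

(** * Potentials of proper subsets of a minimal counterexample *)

Local Open Scope ring_scope.

Lemma rho_argmin (r : nat) (T : finType) (e : rel T) (P : pred {set T}) (R : {set T}) :
  P R -> exists2 R0, P R0 & forall S, P S -> rho r e R0 <= rho r e S.
Proof. by move=> PR; case: (arg_minP (rho r e) PR) => R0 PR0 H; exists R0. Qed.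

(* A counterexample with [#|T|] minimal, then with the fewest edges, then with
   the most pairs of twins. *)
Record ky_counter (r : nat) (T : finType) (e : rel T) : Prop := KyCounter {
  kc_r3 : (3 <= r)%N;
  kc_sym : symmetric e;
  kc_irr : irreflexive e;
  kc_crit : vcrit r e [set: T];
  kc_big : ky_bound r < rho r e [set: T];
  kc_smaller : forall (T' : finType) (e' : rel T'), (#|T'| < #|T|)%N -> ky_holds r e';
  kc_tie : forall e' : rel T,
    (eb e' setT setT < eb e setT setT)%N \/
    eb e' setT setT = eb e setT setT /\
      (eb (twin_rel e) setT setT < eb (twin_rel e') setT setT)%N ->
    ky_holds r e' }.

Section Potentials.
Variables (r : nat) (T : finType) (e : rel T).
Hypothesis G : ky_counter r e.
Let r3 := kc_r3 G.
Let sym_e := kc_sym G.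
Let irr_e := kc_irr G.
Let crit_e := kc_crit G.
Let big_e := kc_big G.
Let smaller_ky := kc_smaller G.
Implicit Types (R W : {set T}).

Lemma r_gt0 : (0 < r)%N. Proof. by move: r3; lia. Qed.

Lemma vcrit_rho (T' : finType) (e' : rel T') (W : {set T'}) :
  symmetric e' -> irreflexive e' -> vcrit r e' W -> (#|W| < #|T|)%N ->
  rho r e' W <= ky_bound r.
Proof.
move=> sym irr cW Wn; apply: ky_holds_sub => //; first exact: r_gt0.
by move=> T2 e2 E2; apply: smaller_ky; rewrite E2.
Qed.

Lemma proper_col R : R != setT -> colorable_on r e R.
Proof. by have /vcritP[_ H] := crit_e; rewrite -properT; apply: H. Qed.

Lemma rho_small R : (2 <= #|R|)%N -> (#|R| <= r)%N -> 2 * r%:Z * (r%:Z - 1) <= rho r e R.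
Proof.
move=> R2 Rr; apply: le_trans (rho_ge_clique r R irr_e).
exact: rho_clique_ge.
Qed.

Lemma small_clique R : (2 <= #|R|)%N -> (#|R| <= r)%N ->
  rho r e R <= 2 * r%:Z * (r%:Z - 1) -> #|R| = r /\ clique e R.
Proof.
move=> R2 Rr H; have H1 := rho_ge_clique r R irr_e.
have Er : #|R| = r.
  apply/eqP; rewrite eqn_leq Rr leqNgt; apply/negP => lt.
  have := rho_cliqueE r #|R|.
  have : 0 < (r%:Z - #|R|%:Z) * (r%:Z * (#|R|%:Z - 2) + 2).
    apply: mulr_gt0; first lia.
    have: 0 <= r%:Z * (#|R|%:Z - 2) by apply: mulr_ge0; lia.
    lia.
  lia.
split=> //; apply: eb_clique => //.
suff: (r * (#|R| * #|R|) <= r * (eb e R R + #|R|))%N.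
  by rewrite leq_mul2l -mulnn; case/orP => // /eqP; move: r3; lia.
move: H; rewrite /rho Er; lia.
Qed.

Lemma collapse_ext R c : (r < #|R|)%N -> R != setT -> proper_on e R c ->
  exists (J : {set 'I_r}) (D : {set T}),
    [/\ J != set0, D != set0, [disjoint R & D],
        rho r e (R :|: D) + rho_clique r #|J| +
          2 * r%:Z * (eb e [set u in R | c u \notin J] D)%:Z
          <= ky_bound r + rho r e R &
        forall j u0, J = [set j] -> u0 \in R ->
          exists u, [/\ u \in R, u != u0, c u = j & exists2 v, v \in D & e u v]].
Proof.
move=> Rr RT Hc; apply: collapse_extend => //; first exact: r_gt0.
move=> W; apply: vcrit_rho; [exact: collapse_sym | exact: collapse_irr].
Qed.

Lemma proper_setU_disj R (D : {set T}) : D != set0 -> [disjoint R & D] -> (#|R| < #|R :|: D|)%N.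
Proof.
move=> D0 RD; rewrite cardsU (_ : R :&: D = set0) ?cards0 ?subn0; last first.
  by apply/eqP; rewrite setI_eq0.
by move: D0; rewrite -card_gt0; lia.
Qed.

Lemma rho_clique_ge1 j : (0 < j)%N -> (j <= r)%N -> r%:Z * r%:Z + r%:Z - 2 <= rho_clique r j.
Proof.
case: j => // -[|j] _ jr; first by rewrite /rho_clique; lia.
apply: le_trans (rho_clique_ge r3 _ jr) => //; have: 3%:Z * r%:Z <= r%:Z * r%:Z.
  by apply: ler_wpM2r; lia.
lia.
Qed.

Lemma card_colors (J : {set 'I_r}) : (#|J| <= r)%N.
Proof. by have := leq_card_setT J; rewrite card_ord. Qed.

Lemma rho_gt R : (2 <= #|R|)%N -> R != setT -> r%:Z * r%:Z + r%:Z - 2 < rho r e R.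
Proof.
move=> R2 RT; case: (leqP #|R| r) => Rr.
  have := rho_small R2 Rr; have: 3%:Z * r%:Z <= r%:Z * r%:Z by apply: ler_wpM2r; lia.
  lia.
pose P (S : {set T}) := (r < #|S|)%N && (S != [set: T]).
have [|R0 /andP[R0r R0T] Rmin] := @rho_argmin r T e P R; first by rewrite /P Rr.
apply: lt_le_trans (Rmin R _); last by rewrite /P Rr.
rewrite ltNge; apply/negP => le; have /colorable_onP[c Hc] := proper_col R0T.
have [J [D [J0 D0 RD H _]]] := collapse_ext R0r R0T Hc.
have := rho_clique_ge1 _ (card_colors J); rewrite card_gt0 => /(_ J0) HJ.
have Hl : 0 <= 2 * r%:Z * (eb e [set u in R0 | c u \notin J] D)%:Z by rewrite mulr_ge0.
have lt := proper_setU_disj D0 RD.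
have [DT|DT] := eqVneq (R0 :|: D) setT.
  by move: H big_e; rewrite DT /ky_bound; lia.
have := Rmin (R0 :|: D); rewrite /P DT (ltn_trans R0r lt) => /(_ isT).
by move: H; rewrite /ky_bound; lia.
Qed.

Lemma color_with_edges R (hs : seq (T * T)) : R != setT ->
  (forall p, p \in hs -> p.1 != p.2) ->
  (forall W, W \subset R -> (r < #|W|)%N ->
     ky_bound r + 2 * r%:Z * (size hs)%:Z < rho r e W) ->
  exists2 c : T -> 'I_r, proper_on e R c &
    forall p, p \in hs -> p.1 \in R -> p.2 \in R -> c p.1 <> c p.2.
Proof.
move=> RT Hhs H.
have sym' := add_edges_sym hs sym_e; have irr' := add_edges_irr irr_e Hhs.
have [/colorable_onP[c Hc]|nc] := boolP (colorable_on r (add_edges e hs) R).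
  exists c => [x y xR yR exy|[x y] xyhs /= xR yR]; apply: Hc => //.
    by rewrite /add_edges exy.
  by rewrite /add_edges xyhs orbT.
have [W cW WR] := vcrit_exists nc.
have Wr := vcrit_card sym' irr' r_gt0 cW.
have Wn : (#|W| < #|T|)%N.
  by apply: leq_ltn_trans (subset_leq_card WR) (ltn_card_setT RT).
have := vcrit_rho sym' irr' cW Wn; have := H W WR Wr.
have := leq_mul (leqnn r) (add_edges_eb e hs W).
rewrite /rho; set a := eb _ _ _; set b := eb _ _ _; lia.
Qed.

Lemma color_with_edge R x y : R != setT -> x != y -> x \in R -> y \in R ->
  exists2 c : T -> 'I_r, proper_on e R c & c x <> c y.
Proof.
move=> RT xy xR yR; have [|W WR Wr|c Hc Hp] := @color_with_edges R [:: (x, y)] RT.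
- by move=> p; rewrite inE => /eqP->.
- have := @rho_gt W; rewrite (leq_trans _ Wr) //; last by move: r3; lia.
  have WT : W != setT.
    by apply: contraNneq RT => WT; rewrite -subTset -WT.
  by move=> /(_ isT WT); rewrite /ky_bound /=; lia.
- by exists c => //; apply: (Hp (x, y)); rewrite ?inE.
Qed.

(* The edges added to [R0] before it is coloured ensure that no colour class sees almost all edges
   that leave [R0]; so if only one colour class meets the critical graph found after collapsing,
   then this graph misses many edges. *)
Lemma rho_le_clique R : (2 <= #|R|)%N -> R != setT ->
  rho r e R <= 2 * r%:Z * (r%:Z - 1) -> #|R| = r /\ clique e R.
Proof.
move=> R2 RT; case: (leqP #|R| r) => Rr; first exact: small_clique.
move=> HR; exfalso.
pose P (S : {set T}) := (r < #|S|)%N && (S != [set: T]).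
have [|R0 /andP[R0r R0T] Rmin] := @rho_argmin r T e P R; first by rewrite /P Rr.
have {HR} HR : rho r e R0 <= 2 * r%:Z * (r%:Z - 1).
  by apply: le_trans (Rmin R _) HR; rewrite /P Rr.
have gt : r%:Z * r%:Z + r%:Z - 2 < rho r e R0.
  by apply: rho_gt => //; apply: leq_trans R0r; move: r3; lia.
have [i [i0 i_lt i_ge]] : exists i : nat, [/\ (0 < i)%N,
    2 * r%:Z * (i%:Z - 1) < rho r e R0 - (r%:Z * r%:Z + r%:Z - 2) &
    rho r e R0 - (r%:Z * r%:Z + r%:Z - 2) <= 2 * r%:Z * i%:Z].
  pose d := absz (rho r e R0 - (r%:Z * r%:Z + r%:Z - 2))%R.
  have dE : d%:Z = rho r e R0 - (r%:Z * r%:Z + r%:Z - 2) by rewrite /d; lia.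
  have d0 : (0 < d)%N by lia.
  exists ((d.-1 %/ (2 * r)).+1); rewrite -dE; split=> //.
    have := leq_trunc_div d.-1 (2 * r); set q := (_ %/ _)%N => H; lia.
  have := ltn_ceil d.-1 (_ : 0 < 2 * r)%N; set q := (_ %/ _)%N.
  move=> /(_ ltac:(move: r3; lia)) H; lia.
have i2 : (2 * i + 1 <= r)%N.
  rewrite leqNgt; apply/negP => lt; have: r%:Z * (r%:Z - 2) <= r%:Z * (2 * (i%:Z - 1)).
    by apply: ler_wpM2l; lia.
  lia.
have R00 : R0 != set0 by rewrite -card_gt0; lia.
have cut := cut_ge crit_e sym_e R00 R0T.
pose w u := #|nb e u :&: ~: R0|.
have sumw : eb e R0 (~: R0) = (\sum_(u in R0) w u)%N by exact: eb_sum.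
have [|hs [hs_sz hs_ne hs_M]] := @spread_pairs T R0 w i.
  by rewrite -sumw; move: cut i2; lia.
have [|W WR Wr|c Hc chs] := @color_with_edges R0 hs R0T.
- by move=> p /hs_ne[].
- have : rho r e R0 <= rho r e W.
    apply: Rmin; rewrite /P Wr /=.
    by apply: contraNneq R0T => WT; rewrite -subTset -WT.
  have: r%:Z * (size hs)%:Z <= r%:Z * i%:Z by apply: ler_wpM2l; lia.
  rewrite /ky_bound; move: i_lt; lia.
have [J [D [J0 D0 RD H HJ1]]] := collapse_ext R0r R0T Hc.
have Hl : 0 <= 2 * r%:Z * (eb e [set u in R0 | c u \notin J] D)%:Z by rewrite mulr_ge0.
have Jr := card_colors J; have J1 : (0 < #|J|)%N by rewrite card_gt0.
have lt := proper_setU_disj D0 RD.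
have [DT|DT] := eqVneq (R0 :|: D) setT; last first.
  have := Rmin (R0 :|: D); rewrite /P DT (ltn_trans R0r lt) => /(_ isT).
  by have := rho_clique_ge1 J1 Jr; move: H; rewrite /ky_bound; lia.
have [J2|J2] := leqP 2 #|J|.
  by have := rho_clique_ge r3 J2 Jr; move: H big_e; rewrite DT; lia.
have /cards1P[j Jj] : #|J| == 1%N by rewrite eqn_leq J1 -ltnS J2.
have DE : D = ~: R0.
  apply/setP => z; rewrite inE; case zR: (z \in R0); first by rewrite (disjointFr RD zR).
  by have := in_setT z; rewrite -DT inE zR.
pose M := [set u in R0 | (c u == j) && (0 < w u)%N].
have MR : M \subset R0 by apply/subsetP => u; rewrite inE => /andP[].
have inM u : u \in R0 -> c u = j -> (exists2 v, v \in D & e u v) -> u \in M.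
  move=> uR cu [v vD euv]; rewrite inE uR cu eqxx /=; apply/card_gt0P; exists v.
  by rewrite inE -DE vD in_nb euv.
have M2 : (2 <= #|M|)%N.
  have /set0Pn[u0 u0R] := R00.
  have [u1 [u1R _ cu1 Hu1]] := HJ1 j u0 Jj u0R.
  have [u2 [u2R u21 cu2 Hu2]] := HJ1 j u1 Jj u1R.
  apply: (@leq_trans #|[set u1; u2]|); first by rewrite cards2 eq_sym u21.
  by apply/subset_leq_card/subsetP => z; rewrite !inE => /orP[/eqP->|/eqP->];
    have := inM _ u1R cu1 Hu1; have := inM _ u2R cu2 Hu2; rewrite !inE.
have lost : (i <= eb e [set u in R0 | c u \notin J] D)%N.
  apply: leq_trans (hs_M M MR M2 _ _) _.
  - by move=> u; rewrite inE => /and3P[].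
  - move=> p php; apply/negP => /andP[]; rewrite !inE => /and3P[p1 /eqP c1 _] /and3P[p2 /eqP c2 _].
    by apply: (chs p php p1 p2); rewrite c1 c2.
  rewrite eb_sum DE; apply: (@leq_trans (\sum_(u in R0 :\: M) if c u == j then 0 else w u)%N).
    apply: leq_sum => u; rewrite !inE => /andP[+ uR]; rewrite uR /=.
    by case: eqP => //= _; rewrite -leqNgt.
  rewrite big_mkcond [leqRHS]big_mkcond; apply: leq_sum => u _.
  rewrite !inE Jj inE; case: (u \in R0); rewrite ?andbF //=.
  by case: eqP => //= _; case: ifP.
have: r%:Z * i%:Z <= r%:Z * (eb e [set u in R0 | c u \notin J] D)%:Z.
  by apply: ler_wpM2l; lia.
have := rho_clique_ge1 J1 Jr; move: H big_e; rewrite DT /ky_bound.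
move: i_ge; lia.
Qed.

End Potentials.

(** * Vertices of minimum degree *)

Section LowVertices.
Variables (r : nat) (T : finType) (e : rel T).
Hypothesis G : ky_counter r e.
Let r3 := kc_r3 G.
Let sym_e := kc_sym G.
Let irr_e := kc_irr G.
Let crit_e := kc_crit G.
Let big_e := kc_big G.
Implicit Types (C W : {set T}) (x y z v : T).

Lemma ncol_full : ~~ colorable_on r e [set: T].
Proof. by have /vcritP[] := crit_e. Qed.

Lemma deg_ge x : (r <= #|nb e x|)%N.
Proof. by have := vcrit_deg sym_e irr_e crit_e (in_setT x); rewrite setIT. Qed.

Lemma card_gt : (r.+1 < #|T|)%N.
Proof.
have rT : (r < #|T|)%N by have := vcrit_card sym_e irr_e (r_gt0 G) crit_e; rewrite cardsT.
rewrite ltn_neqAle rT andbT; apply/eqP => E.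
have : (r * (#|T| * r) <= r * eb e setT setT)%N.
  rewrite leq_mul2l eb_sum -cardsT -sum_nat_const; apply/orP; right.
  by apply: leq_sum => x _; rewrite setIT deg_ge.
by move: big_e; rewrite /ky_bound /rho cardsT -E; lia.
Qed.

Lemma set_neqT (R : {set T}) : (#|R| <= r.+1)%N -> R != setT.
Proof. by move=> R1; apply: contraTneq R1 => ->; rewrite cardsT -ltnNge card_gt. Qed.

Lemma clique_nb C y : clique e C -> #|C| = r -> y \notin C ->
  (2 * #|nb e y :&: C| <= r)%N.
Proof.
move=> cC Cr yC; have := clique_eb irr_e cC; rewrite Cr => ebC.
have cy : #|y |: C| = r.+1 by rewrite cardsU1 yC Cr.
have := @rho_le_clique _ _ _ G (y |: C); rewrite cy set_neqT ?cy //.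
move=> /(_ ltac:(move: r3; lia) isT) H.
rewrite leqNgt; apply/negP => lt; suff: rho r e (y |: C) <= 2 * r%:Z * (r%:Z - 1).
  by case/H; lia.
rewrite /rho cy (eb_U1 sym_e irr_e yC).
have : (r * r.+1 <= r * (2 * #|nb e y :&: C|))%N by rewrite leq_mul2l lt orbT.
have : (r * (eb e C C + r) = r * r ^ 2)%N by rewrite ebC.
rewrite expnS expn1; set a := eb _ _ _; set b := #|_ :&: _|.
have : 3%:Z * r%:Z <= r%:Z * r%:Z by apply: ler_wpM2r; lia.
lia.
Qed.

Lemma clique_outer C x : clique e C -> #|C| = r -> x \in C -> #|nb e x| = r ->
  exists2 y, y \notin C & clo e x = y |: C.
Proof.
move=> cC Cr xC dx; have sub : C \subset clo e x.
  by apply/subsetP => z zC; rewrite !inE; case: eqP => //= /eqP zx; rewrite cC // eq_sym.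
have /cards1P[y Ey] : #|clo e x :\: C| == 1%N.
  by rewrite cardsD (setIidPr sub) card_clo // dx Cr subSnn.
exists y; first by have := set11 y; rewrite -Ey inE => /andP[].
by rewrite -(setID (clo e x) C) (setIidPr sub) Ey setUC.
Qed.

(* If the outer neighbours [y], [y'] of [x], [x'] differ, colour [y] and [y'] differently;
   then two colours are left for [x] and [x'], and each of them avoids at most one. *)
Lemma clique_low_twins C x x' : clique e C -> #|C| = r -> x \in C -> x' \in C ->
  #|nb e x| = r -> #|nb e x'| = r -> clo e x = clo e x'.
Proof.
move=> cC Cr xC xC' dx dx'; have [y yC Ey] := clique_outer cC Cr xC dx.
have [y' yC' Ey'] := clique_outer cC Cr xC' dx'.
have [xx|xx] := eqVneq x x'; first by rewrite xx.
have [yy|yy] := eqVneq y y'; first by rewrite Ey Ey' yy.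
exfalso; pose R := ~: [set x; x'].
have inR z : z \in C = false -> z \in R.
  by move=> zC; rewrite !inE; apply/negP => /orP[]/eqP E; move: zC; rewrite E ?xC ?xC'.
have RT : R != setT.
  by apply/eqP => RT; have := in_setT x; rewrite -RT !inE eqxx.
have [c Hc cyy] := color_with_edge G RT yy (inR _ (negPf yC)) (inR _ (negPf yC')).
pose N := C :\ x :\ x'.
have cN : (#|N| + 2 = r)%N.
  by rewrite -Cr (cardsD1 x C) xC (cardsD1 x' (C :\ x)) !inE eq_sym xx xC' -/N; lia.
have [a [b [aN bN ab ay by']]] : exists a b : 'I_r,
    [/\ a \notin c @: N, b \notin c @: N, a <> b, a <> c y & b <> c y'].
  have /card_gt1P[a0 [b0]] : (1 < #|~: (c @: N)|)%N.
    rewrite cardsCs setCK card_ord; have := leq_imset_card c N.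
    by rewrite ltn_subRL; lia.
  rewrite !inE => -[aN bN /eqP ab].
  have [a0y|/eqP a0y] := eqVneq a0 (c y); last have [b0y|/eqP b0y] := eqVneq b0 (c y').
  - by exists b0, a0; split=> // [/esym||]; congruence.
  - by exists b0, a0; split=> // [/esym||]; congruence.
  - by exists a0, b0.
case/negP: ncol_full; apply/colorable_onP; eexists.
apply: (@proper_extend _ _ _ _ (fun z => if z == x' then b else c z) x a) => //.
  apply: (@proper_extend _ _ _ _ c x' b) => //.
    by apply: proper_onS Hc; apply/subsetP => z; rewrite !inE negb_or => /and3P[-> -> _].
  move=> z; rewrite !inE andbT => zx exz czb.
  have : z \in clo e x' by rewrite !inE exz orbT.
  rewrite Ey' !inE => /orP[/eqP zy|zC]; first by apply: by'; rewrite -czb zy.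
  case/negP: bN; rewrite -czb; apply: imset_f; rewrite !inE zx zC !andbT.
  by apply: contraTneq exz => ->; rewrite irr_e.
move=> z _ exz; case: eqP => [_ /esym //|/eqP zx' cza].
have : z \in clo e x by rewrite !inE exz orbT.
rewrite Ey !inE => /orP[/eqP zy|zC]; first by apply: ay; rewrite -cza zy.
case/negP: aN; rewrite -cza; apply: imset_f; rewrite !inE zx' zC !andbT /=.
by apply: contraTneq exz => ->; rewrite irr_e.
Qed.

Lemma in_cluster x z : (z \in cluster e x) = (clo e x == clo e z).
Proof. by rewrite in_nb. Qed.

Section Replace.
Variables (x v : T).
Hypotheses (dx : #|nb e x| = r) (exv : e x v) (xv : clo e x <> clo e v).

(* [v] is replaced by a new twin of [x]. *)
Definition twin_instead : rel T := fun a b =>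
  if a == v then b \in clo e x :\ v else if b == v then a \in clo e x :\ v else e a b.

Lemma twin_sym : symmetric twin_instead.
Proof.
move=> a b; rewrite /twin_instead.
by have [Ea|av] := eqVneq a v; have [Eb|bv] := eqVneq b v; rewrite ?Ea ?Eb // sym_e.
Qed.

Lemma twin_irr : irreflexive twin_instead.
Proof. by move=> a; rewrite /twin_instead; case: eqP => [->|_]; rewrite ?irr_e // !inE eqxx. Qed.

Lemma twinE a b : a != v -> b != v -> twin_instead a b = e a b.
Proof. by rewrite /twin_instead => /negPf-> /negPf->. Qed.

Lemma nb_twin : nb twin_instead v = clo e x :\ v.
Proof. by apply/setP => z; rewrite in_nb /twin_instead eqxx. Qed.

Lemma card_nb_twin : #|nb twin_instead v| = r.
Proof.
by apply/eqP; rewrite nb_twin -eqSS -dx -(card_clo irr_e) (cardsD1 v (clo e x)) !inE exv orbT.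
Qed.

Lemma eb_twin_away (A B : {set T}) : v \notin A -> v \notin B ->
  eb twin_instead A B = eb e A B.
Proof.
move=> vA vB; apply: eq_bigr => a aA; apply: eq_bigr => b bB.
by rewrite twinE //; [apply: contra vA => /eqP <-|apply: contra vB => /eqP <-].
Qed.

Lemma eb_twin : (eb twin_instead setT setT + 2 * #|nb e v| = eb e setT setT + 2 * r)%N.
Proof.
rewrite (eb_D1 sym_e irr_e (in_setT v)) (eb_D1 twin_sym twin_irr (in_setT v)).
by rewrite !setIT card_nb_twin eb_twin_away ?setD11 //; lia.
Qed.

Lemma twin_ncol : (#|nb e v| < r + #|cluster e x|)%N ->
  ~~ colorable_on r twin_instead setT.
Proof.
move=> dv; apply/negP => /colorable_onP[c Hc]; case/negP: ncol_full.
have vT z : clo e x = clo e z -> e v z.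
  by move=> xz; have := in_clo_sym sym_e v z; rewrite -xz !inE exv orbT; case: eqP xv => [<-|].
have TN : cluster e x \subset nb e v.
  by apply/subsetP => z; rewrite in_cluster in_nb => /eqP /vT.
have [g Hg] : exists g : 'I_r, forall y, y \in nb e v :\: cluster e x -> c y <> g.
  apply: free_color; rewrite cardsD (setIidPr TN); have := subset_leq_card TN.
  by move: dv; lia.
have cv y : y \in clo e x :\ v -> c v <> c y.
  by move=> yx; apply: Hc => //; rewrite /twin_instead eqxx.
have [/exists_inP[z zT /eqP cz]|ng] := boolP [exists z in cluster e x, c z == g].
  have zx : clo e x = clo e z by apply/eqP; rewrite -in_cluster.
  have zv : z != v by apply/eqP => zv; apply: xv; rewrite zx zv.
  have zxv : z \in clo e x :\ v by rewrite !in_setD1 zv zx setU11.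
  apply/colorable_onP; eexists; apply: (@proper_extend _ _ _ _ (fun y => if y == v then g else c y) z (c v)) => //.
    apply: (@proper_extend _ _ _ _ c v g) => //.
      move=> a b; rewrite !inE !andbT => /andP[av _] /andP[bv _] eab.
      by apply: Hc; rewrite ?twinE.
    move=> y; rewrite !inE andbT => yz evy.
    have [yT|yT] := boolP (y \in cluster e x); last by apply: Hg; rewrite in_setD yT in_nb.
    rewrite -cz; apply: Hc => //; rewrite twinE //; last first.
      by apply: contraTneq evy => ->; rewrite irr_e.
    move: yT; rewrite in_cluster zx => /eqP zy.
    have : z \in clo e y by rewrite -zy setU11.
    by rewrite !inE eq_sym (negPf yz).
  move=> y _ ezy; case: eqP => [_ /esym|/eqP yv]; first by rewrite -cz; exact: cv.
  by move=> /esym; apply: cv; rewrite in_setD1 yv zx !inE ezy orbT.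
apply/colorable_onP; eexists; apply: (@proper_extend _ _ _ _ c v g) => //.
  move=> a b; rewrite !inE !andbT => av bv eab.
  by apply: Hc; rewrite ?twinE.
move=> y _ evy; have [yT|yT] := boolP (y \in cluster e x); last first.
  by apply: Hg; rewrite in_setD yT in_nb.
by move=> cyg; case/negP: ng; apply/exists_inP; exists y => //; apply/eqP.
Qed.

Lemma clo_twin_away z : z != v ->
  clo twin_instead z = (clo e z :\ v) :|: (if z \in clo e x then [set v] else set0).
Proof.
move=> zv; apply/setP => y; rewrite !inE /twin_instead (negPf zv).
have [->|yv] := eqVneq y v.
  rewrite eq_sym (negPf zv) /= !inE zv /=.
  by case: ifP; rewrite !inE ?eqxx.
by rewrite /=; case: ifP; rewrite !inE ?(negPf yv) ?orbF.
Qed.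

Lemma clo_twin : clo twin_instead v = clo e x.
Proof. by rewrite /clo nb_twin setD1K // !inE exv orbT. Qed.

Lemma twins_twin : (#|cluster e v| <= #|cluster e x|)%N ->
  (eb (twin_rel e) setT setT < eb (twin_rel twin_instead) setT setT)%N.
Proof.
move=> tvx.
have split_v (R : rel T) : symmetric R ->
    eb R setT setT = (eb R [set~ v] [set~ v] + 2 * #|nb R v :\ v| + R v v)%N.
  move=> sR; have -> : [set: T] = [set v] :|: [set~ v] by rewrite setUCr.
  rewrite eb_UU //; last by rewrite disjoints1 !inE eqxx.
  rewrite eb1l eb1l -setDE.
  have -> : #|nb R v :&: [set v]| = R v v.
    by case h: (R v v); [rewrite (setIidPr _) ?cards1 // sub1set inE|
      apply/eqP; rewrite cards_eq0 setI_eq0 disjoint_sym disjoints1 inE h].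
  lia.
have st (e1 : rel T) : symmetric (twin_rel e1) by move=> a b; exact: eq_sym.
have rt (e1 : rel T) a : twin_rel e1 a a by exact: eqxx.
rewrite !split_v // !rt.
have H1 : (eb (twin_rel e) [set~ v] [set~ v] <=
           eb (twin_rel twin_instead) [set~ v] [set~ v])%N.
  apply: leq_sum => a; rewrite !inE => av; apply: leq_sum => b; rewrite !inE => bv.
  rewrite /twin_rel !clo_twin_away //; case: eqP => // Eab.
  have -> : (a \in clo e x) = (b \in clo e x).
    by rewrite (in_clo_sym sym_e) Eab (in_clo_sym sym_e).
  by rewrite Eab eqxx.
have H2 : (#|nb (twin_rel e) v :\ v| < #|cluster e v|)%N.
  by rewrite [ltnRHS](cardsD1 v) in_cluster eqxx.
have H3 : (#|cluster e x| <= #|nb (twin_rel twin_instead) v :\ v|)%N.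
  apply/subset_leq_card/subsetP => z; rewrite in_cluster => /eqP zx.
  have zv : z != v by apply/eqP => zv; apply: xv; rewrite zx zv.
  rewrite in_setD1 zv in_nb /twin_rel clo_twin clo_twin_away // zx !inE eqxx /=.
  by rewrite setUC setD1K ?eqxx // -zx !inE exv orbT.
by move: H1 H2 H3 tvx; lia.
Qed.

Lemma low_replace : (#|nb e v| < r + #|cluster e x|)%N ->
  (#|nb e v| = r -> #|cluster e v| <= #|cluster e x|)%N ->
  clique e (clo e x :\ v).
Proof.
move=> dv tv; have [W cW _] := vcrit_exists (twin_ncol dv).
have E := eb_twin; have dvr := deg_ge v.
have [WT|WT] := eqVneq W setT.
  have : rho r twin_instead setT <= ky_bound r.
    apply: (kc_tie G) twin_sym twin_irr _; last by rewrite -WT.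
    case: (ltngtP #|nb e v| r) => [lt|gt|eq].
    - by have := leq_ltn_trans dvr lt; rewrite ltnn.
    - by left; move: E gt; lia.
    right; split; first by move: E eq; lia.
    by apply: twins_twin; apply: tv.
  have : (r * eb twin_instead setT setT <= r * eb e setT setT)%N.
    by rewrite leq_mul2l; apply/orP; right; lia.
  by move: big_e; rewrite /rho; lia.
have Wn := ltn_card_setT WT.
have Wrho := vcrit_rho G twin_sym twin_irr cW Wn.
have vW : v \in W.
  apply: contraT => vW; case/vcritP: cW => /negP nW _; case: nW.
  have /colorable_onP[c Hc] := proper_col G WT; apply/colorable_onP; exists c => a b aW bW; rewrite twinE.
  - exact: Hc.
  - by apply: contra vW => /eqP <-.
  - by apply: contra vW => /eqP <-.
have NW : nb twin_instead v \subset W.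
  have := vcrit_deg twin_sym twin_irr cW vW; rewrite -{1}card_nb_twin => le.
  by apply/setIidPl/eqP; rewrite eqEcard subsetIl.
have EW := eb_D1 twin_sym twin_irr vW.
have := cardsD1 v W; rewrite vW => cWv.
have NWv : nb twin_instead v \subset W :\ v.
  by rewrite subsetD1 NW nb_irr //; exact: twin_irr.
have [|||cr cl] := @rho_le_clique _ _ _ G (W :\ v).
- by have := subset_leq_card NWv; rewrite card_nb_twin; move: r3; lia.
- by apply/eqP => WvT; have := in_setT v; rewrite -WvT setD11.
- move: Wrho; rewrite /rho EW cWv (setIidPl NW) card_nb_twin eb_twin_away ?setD11 // /ky_bound.
  by set a := eb _ _ _; set b := #|_ :\ v|; clear; lia.
suff -> : clo e x :\ v = W :\ v by [].
by rewrite -nb_twin; apply/eqP; rewrite eqEcard NWv cr card_nb_twin /=.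
Qed.

End Replace.
End LowVertices.

(** * Edges between an independent set and another set *)

Section Orientation.
Variable T : finType.
Implicit Types (S : {set T}) (s : seq (T * T)) (dem : T -> int).

Definition touching s S : nat := count (fun p => (p.1 \in S) || (p.2 \in S)) s.

Lemma sum_setUI dem S1 S2 :
  \sum_(v in S1 :|: S2) dem v + \sum_(v in S1 :&: S2) dem v =
  \sum_(v in S1) dem v + \sum_(v in S2) dem v.
Proof.
rewrite [\sum_(v in _ :|: _) _]big_mkcond [\sum_(v in _ :&: _) _]big_mkcond.
rewrite [\sum_(v in S1) _]big_mkcond [\sum_(v in S2) _]big_mkcond -!big_split /=.
apply: eq_bigr => v _; rewrite !inE.
by case: (v \in S1); case: (v \in S2); rewrite ?addr0 ?add0r.
Qed.

Lemma sum_dem_sub dem S x :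
  \sum_(v in S) (dem v - (v == x)%:Z) = \sum_(v in S) dem v - (x \in S)%:Z.
Proof.
rewrite sumrB; congr (_ - _); have [xS|xS] := boolP (x \in S).
  rewrite (bigD1 x) //= eqxx big1 ?addr0 // => v /andP[_ /negPf->//].
by rewrite big1 // => v vS; case: eqP => // vx; rewrite -vx vS in xS.
Qed.

(* Uncrossing: if neither end of an edge can take it, then there are tight sets [S1], [S2]
   separating its ends, and submodularity fails on them. *)
Lemma orientation s dem :
  (forall S, \sum_(v in S) dem v <= (touching s S)%:Z) ->
  exists s1 s2, perm_eq s (s1 ++ s2) /\
    forall v, dem v <= (count (fun p => p.1 == v) s1 + count (fun p => p.2 == v) s2)%:Z.
Proof.
elim: s dem => [|[a b] s IH] dem H.
  by exists [::], [::]; split=> // v; have := H [set v]; rewrite big_set1.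
pose takes x := forall S, \sum_(v in S) (dem v - (v == x)%:Z) <= (touching s S)%:Z.
have bad x y : (x = a /\ y = b) \/ (x = b /\ y = a) -> ~ takes x ->
    exists S, [/\ y \in S, x \notin S & \sum_(v in S) dem v = (touching s S)%:Z + 1].
  move=> xy nx; have [/existsP[S /and3P[h1 h2 /eqP h3]]|hn] := boolP [exists S : {set T},
      [&& y \in S, x \notin S & \sum_(v in S) dem v == (touching s S)%:Z + 1]].
    by exists S.
  exfalso; apply: nx => S; have := H S; rewrite sum_dem_sub /touching /=.
  have := existsPn hn S; rewrite !negb_and negbK -/(touching s S).
  set d := \sum_(v in S) dem v; set m := touching s S.
  by case: xy => -[-> ->]; case: (a \in S); case: (b \in S) => //=;
    rewrite ?add1n ?add0n; lia.
have [tk|tk] : takes a \/ takes b.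
  have [tka|tka] : takes a \/ ~ takes a.
    have [/forallP h|/forallPn[S hS]] := boolP [forall S : {set T},
      \sum_(v in S) (dem v - (v == a)%:Z) <= (touching s S)%:Z]; first by left.
    by right => h; rewrite h in hS.
  - by left.
  have [tkb|tkb] : takes b \/ ~ takes b.
    have [/forallP h|/forallPn[S hS]] := boolP [forall S : {set T},
      \sum_(v in S) (dem v - (v == b)%:Z) <= (touching s S)%:Z]; first by left.
    by right => h; rewrite h in hS.
  - by right.
  exfalso; have [S1 [bS1 aS1 E1]] := bad a b (or_introl (conj erefl erefl)) tka.
  have [S2 [aS2 bS2 E2]] := bad b a (or_intror (conj erefl erefl)) tkb.
  have := sum_setUI dem S1 S2; have := H (S1 :|: S2); have := H (S1 :&: S2).
  rewrite /touching /= !inE (negPf aS1) (negPf bS2) bS1 aS2 /= E1 E2 -!/(touching s _).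
  have : (touching s (S1 :|: S2) + touching s (S1 :&: S2) <= touching s S1 + touching s S2)%N.
    rewrite /touching; elim: (s) => //= -[x y] s' /=; rewrite !inE.
    by case: (x \in S1); case: (x \in S2); case: (y \in S1); case: (y \in S2) => /=; lia.
  by move: (\sum_(v in _ :|: _) _) (\sum_(v in _ :&: _) _) => X Y; lia.
- have [s1 [s2 [ps Hs]]] := IH _ tk; exists ((a, b) :: s1), s2; split.
    by rewrite /= perm_cons.
  by move=> v; have := Hs v; rewrite /= [v == a]eq_sym; case: (a == v); lia.
- have [s1 [s2 [ps Hs]]] := IH _ tk; exists s1, ((a, b) :: s2); split.
    by rewrite perm_sym perm_catC perm_sym /= perm_cons perm_sym perm_catC perm_sym.
  by move=> v; have := Hs v; rewrite /= [v == b]eq_sym; case: (b == v); lia.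
Qed.

End Orientation.

Section Kernels.
Variables (r : nat) (T : finType) (e : rel T).
Hypotheses (r0 : (0 < r)%N) (sym_e : symmetric e) (irr_e : irreflexive e).

Definition kernel (d : rel T) (S K : {set T}) : Prop :=
  [/\ K \subset S, forall x y, x \in K -> y \in K -> ~~ e x y &
      forall x, x \in S -> x \notin K -> exists2 y, y \in K & d x y].

Lemma kernel_list_color (d : rel T) (S : {set T}) (L : T -> {set 'I_r}) :
  (forall S' : {set T}, S' \subset S -> exists K, kernel d S' K) ->
  (forall v, v \in S -> (#|nb d v :&: S| < #|L v|)%N) ->
  exists2 c : T -> 'I_r, proper_on e S c & forall v, v \in S -> c v \in L v.
Proof.
have [n] := ubnP #|S|; elim: n => // n IH in S L * => Sn kp HL.
have [S0|/set0Pn[v0 v0S]] := eqVneq S set0.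
  by exists (fun=> Ordinal r0) => [x y|v]; rewrite S0 inE.
have /card_gt0P[a aL] : (0 < #|L v0|)%N by apply: leq_ltn_trans (HL v0 v0S).
pose Sa := [set v in S | a \in L v].
have [|K [KSa indK absK]] := kp Sa; first by apply/subsetP => v; rewrite inE => /andP[].
have KS v : v \in K -> (v \in S) && (a \in L v) by move/(subsetP KSa); rewrite inE.
have [k0 k0K] : exists k0, k0 \in K.
  have [v0K|v0K] := boolP (v0 \in K); first by exists v0.
  by have [|y yK _] := absK v0 _ v0K; [rewrite inE v0S aL | exists y].
have SK : S :\: K \subset S by exact: subsetDl.
have [||v vSK|c Hc cL] := IH (S :\: K) (fun v => L v :\ a).
- rewrite -ltnS; apply: leq_trans Sn; rewrite ltnS; apply: proper_card; apply/properP; split=> //.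
  by exists k0; [have /andP[] := KS _ k0K | rewrite inE k0K].
- by move=> S' S'S; apply: kp; apply: subset_trans SK.
- move: vSK; rewrite inE => /andP[vK vS].
  have [aLv|aLv] := boolP (a \in L v); last first.
    have -> : L v :\ a = L v by apply/setDidPl; rewrite disjoint_sym disjoints1.
    by apply: leq_ltn_trans (HL v vS); apply: subset_leq_card; apply: setIS.
  have [|y yK dvy] := absK v _ vK; first by rewrite inE vS.
  have := HL v vS; rewrite (cardsD1 a (L v)) aLv add1n ltnS => h; apply: leq_trans h.
  apply: proper_card; apply/properP; split; first exact: setIS.
  exists y; first by rewrite inE in_nb dvy; have /andP[] := KS _ yK.
  by rewrite !inE yK /= andbF.
exists (fun v => if v \in K then a else c v).
  move=> x y xS yS exy; case: ifP => xK; case: ifP => yK.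
  - by have := indK _ _ xK yK; rewrite exy.
  - move=> E; have := cL y; rewrite inE yK => /(_ yS).
    by rewrite !inE -E eqxx.
  - move=> E; have := cL x; rewrite inE xK => /(_ xS).
    by rewrite !inE E eqxx.
  - by apply: Hc; rewrite // inE ?xK ?yK.
move=> v vS; case: ifP => vK; first by have /andP[] := KS _ vK.
by have := cL v; rewrite inE vK => /(_ vS); rewrite inE => /andP[].
Qed.

(* [(a, b) \in O] means that the edge [ab] is directed from [a] to [b];
   edges inside [B] are directed both ways. *)
Definition arcs (A : {set T}) (O : {set T * T}) : rel T := fun x y =>
  e x y && (if x \in A then (x, y) \in O else (y \in A) ==> ((y, x) \notin O)).

(* A vertex of [S] outside [A] without outneighbours in [S :&: A] can be put in the kernel; if there
   is none, then [S :&: A] is a kernel. *)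
Lemma arcs_kernel (A B S : {set T}) O : (forall x y, x \in A -> y \in A -> ~~ e x y) ->
  S \subset A :|: B -> exists K, kernel (arcs A O) S K.
Proof.
move=> indA; have [n] := ubnP #|S|; elim: n => // n IH in S * => Sn SAB.
pose sink b := [forall y in S :&: A, ~~ arcs A O b y].
have [/existsP[b /and3P[bS bA /forall_inP sb]]|nsink] :=
    boolP [exists b, [&& b \in S, b \notin A & sink b]]; last first.
  exists (S :&: A); split; first exact: subsetIl.
    by move=> x y; rewrite !inE => /andP[_ xA] /andP[_ yA]; apply: indA.
  move=> x xS; rewrite inE xS /= => xA; have := existsPn nsink x.
  rewrite xS xA /= negb_forall_in => /exists_inP[y yS].
  by rewrite negbK => dxy; exists y.
pose S' := (S :\ b) :\: nb e b.
have S'S : S' \subset S by apply/subsetP => z; rewrite !inE => /and3P[].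
have [||K [KS' indK absK]] := IH S'.
- rewrite -ltnS; apply: leq_trans Sn; rewrite ltnS; apply: proper_card; apply/properP; split=> //.
  by exists b; rewrite // !inE eqxx andbF.
- exact: subset_trans S'S SAB.
exists (b |: K); split.
- by rewrite subUset sub1set bS (subset_trans KS').
- have bK z : z \in K -> ~~ e b z.
    by move/(subsetP KS'); rewrite !inE => /andP[].
  move=> x y; rewrite !inE => /orP[/eqP->|xK] /orP[/eqP->|yK].
  + by rewrite irr_e.
  + exact: bK.
  + by rewrite sym_e; exact: bK.
  + exact: indK.
move=> x xS; rewrite !inE negb_or => /andP[xb xK].
have [ebx|ebx] := boolP (e b x); last first.
  have [|y yK dxy] := absK x _ xK; first by rewrite !inE ebx xb xS.
  by exists y; rewrite // !inE yK orbT.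
exists b; first by rewrite !inE eqxx.
rewrite /arcs sym_e ebx /=; case: ifP => [xA|_]; last by rewrite (negPf bA).
have := sb x; rewrite inE xS xA => /(_ isT).
by rewrite /arcs ebx (negPf bA) xA /= negbK.
Qed.

End Kernels.

Section CrossEdges.
Variables (r : nat) (T : finType) (e : rel T).
Hypotheses (r0 : (0 < r)%N) (sym_e : symmetric e) (irr_e : irreflexive e).
Hypothesis crit_e : vcrit r e [set: T].

Definition demand (v : T) : int := #|nb e v|%:Z + 1 - r%:Z.

(* A minimal violating pair of sets satisfies Hall's condition for directing the cross edges so
   that each vertex [v] gets at least [demand v] incoming arcs; then the lists left by a colouring
   of the other vertices are longer than the outdegrees. *)
Lemma few_cross_edges (A B : {set T}) :
  (forall x y, x \in A -> y \in A -> ~~ e x y) -> [disjoint A & B] ->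
  A :|: B != set0 -> (eb e A B)%:Z < \sum_(v in A :|: B) demand v.
Proof.
move=> indA dAB AB0; rewrite ltNge; apply/negP => le.
pose P (U : {set T}) := [&& U != set0, U \subset A :|: B &
  \sum_(v in U) demand v <= (eb e (A :&: U) (B :&: U))%:Z].
have [|U /minsetP[/and3P[U0 UAB HU] Umin] _] := @minset_exists _ P (A :|: B).
  by rewrite /P AB0 subxx (setIidPl (subsetUl _ _)) (setIidPl (subsetUr _ _)).
pose E := [set p : T * T | [&& p.1 \in A :&: U, p.2 \in B :&: U & e p.1 p.2]].
pose s := enum E.
pose dem v := if v \in U then demand v else 0.
have Hall (S : {set T}) : \sum_(v in S) dem v <= (touching s S)%:Z.
  have -> : \sum_(v in S) dem v = \sum_(v in U) demand v - \sum_(v in U :\: S) demand v.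
    rewrite [\sum_(v in U) _](big_setID S) /= addrK /dem -big_mkcondr /=.
    by apply: eq_bigl => v; rewrite inE andbC.
  have sp : (touching s S + eb e (A :&: (U :\: S)) (B :&: (U :\: S)) =
      eb e (A :&: U) (B :&: U))%N.
    rewrite !eb_card -/E (cardE E) -/s -(count_predC (fun p => (p.1 \in S) || (p.2 \in S))).
    congr (_ + _)%N; rewrite -size_filter -(card_uniqP (filter_uniq _ (enum_uniq _))).
    apply: eq_card => -[x y]; rewrite mem_filter mem_enum !inE /= negb_or.
    by case: (x \in S); case: (y \in S); rewrite ?andbF.
  have [Z0|Z0] := eqVneq (U :\: S) set0.
    by move: sp HU; rewrite Z0 big_set0 !setI0 eb0l; lia.
  have [ZU|ZU] := eqVneq (U :\: S) U; first by rewrite ZU subrr.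
  have lt : (eb e (A :&: (U :\: S)) (B :&: (U :\: S)))%:Z < \sum_(v in U :\: S) demand v.
    rewrite ltNge; apply/negP => le'; case/eqP: ZU; apply: Umin; last exact: subsetDl.
    by rewrite /P Z0 le' (subset_trans (subsetDl _ _)).
  by move: sp HU lt; lia.
have [s1 [s2 [ps Hs]]] := orientation Hall.
have us : uniq (s1 ++ s2) by rewrite -(perm_uniq ps) enum_uniq.
have ms p : (p \in E) = (p \in s1) || (p \in s2).
  by rewrite -mem_cat -(perm_mem ps) mem_enum.
have dis p : p \in s1 -> p \notin s2.
  by move: us; rewrite cat_uniq => /and3P[_ /hasPn h _] p1; apply/negP => /h; rewrite p1.
pose O := [set p in s2].
have /vcritP[nT Tm] := crit_e.
have UT : ~: U != setT by apply: contraNneq U0 => UT; rewrite -(setCK U) UT setCT.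
have /colorable_onP[c Hc] : colorable_on r e (~: U) by apply: Tm; rewrite properT.
pose L v := ~: (c @: (nb e v :\: U)).
have cardL v : (r - #|nb e v :\: U| <= #|L v|)%N.
  by rewrite /L; have := cardsC (c @: (nb e v :\: U)); rewrite card_ord;
    have := leq_imset_card c (nb e v :\: U); lia.
have [S' S'U|v vU|c' Hc' c'L] := @kernel_list_color r T e r0 (arcs e A O) U L.
- by apply: (arcs_kernel sym_e irr_e O indA); apply: subset_trans S'U UAB.
- apply: leq_trans (cardL v); rewrite ltn_subRL.
  have dv : #|nb e v| = (#|nb e v :&: U| + #|nb e v :\: U|)%N by rewrite cardsID.
  have sub : nb (arcs e A O) v :&: U \subset nb e v :&: U.
    by apply: setSI; apply/subsetP => z; rewrite !in_nb => /andP[].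
  have : demand v <= (#|nb e v :&: U| - #|nb (arcs e A O) v :&: U|)%N%:Z.
    have := Hs v; rewrite /dem vU => /le_trans; apply.
    rewrite -(setIidPr sub) -cardsD -!size_filter -size_cat lez_nat.
    pose g (p : T * T) := if p.1 == v then p.2 else p.1.
    set t := _ ++ _.
    have tE p : p \in t -> [/\ p \in E & (p \in s1) && (p.1 == v) || (p \in s2) && (p.2 == v)].
      by rewrite /t mem_cat !mem_filter ms => /orP[]/andP[/eqP-> ->]; rewrite eqxx ?orbT.
    have AB x : x \in A -> x \in B -> False by move=> xA; rewrite (disjointFr dAB xA).
    have ginj : {in t &, injective g}.
      move=> [x y] [x' y'] /tE[]; rewrite !inE /= => /and3P[/andP[xA xU] /andP[yB yU] _] h1.
      case/tE; rewrite !inE /= => /and3P[/andP[xA' xU'] /andP[yB' yU'] _] h2; rewrite /g /=.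
      case/orP: h1 => /andP[_ /eqP E1]; case/orP: h2 => /andP[_ /eqP E2].
      + by rewrite E1 E2 !eqxx => ->.
      + by case: (AB v); [rewrite -E1|rewrite -E2].
      + by case: (AB v); [rewrite -E2|rewrite -E1].
      + have xv : (x == v) = false by apply/eqP => xv; apply: (AB x) => //; rewrite xv -E1.
        have xv' : (x' == v) = false by apply/eqP => xv'; apply: (AB x') => //; rewrite xv' -E2.
        by rewrite xv xv' E1 E2 => ->.
    have ut : uniq (map g t).
      rewrite map_inj_in_uniq //; move: us; rewrite !cat_uniq => /and3P[u1 h u2].
      rewrite !filter_uniq // andbT /=; apply: contra h => /hasP[p].
      by rewrite !mem_filter => /andP[_ p2] /andP[_ p1]; apply/hasP; exists p.
    rewrite -(size_map g) -(card_uniqP ut); apply/subset_leq_card/subsetP => z /mapP[p pt ->].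
    have [pE hp] := tE _ pt; move: pE; rewrite !inE.
    case: p pt hp => x y pt; rewrite /g /= => hp /and3P[/andP[xA xU] /andP[yB yU] exy].
    case/orP: hp => /andP[h /eqP E1].
      rewrite E1 eqxx yU -E1 exy /= !andbT /arcs exy xA /= inE; exact: dis.
    have -> : (x == v) = false by apply/eqP => xv; apply: (AB x) => //; rewrite xv -E1.
    rewrite xU -E1 sym_e exy /= !andbT /arcs sym_e exy xA /=.
    by rewrite ifN ?inE ?h //; apply/negP => /AB; apply.
  by rewrite /demand; have := subset_leq_card sub; move: dv; lia.
case/negP: nT; apply/colorable_onP; exists (fun x => if x \in U then c' x else c x) => x y _ _ exy.
have cross u w : u \in U -> w \notin U -> e u w -> c' u <> c w.
  move=> uU wU euw E0; have := c'L u uU; rewrite inE E0 => /negP; apply.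
  by apply: imset_f; rewrite inE wU in_nb.
case: ifP => xU; case: ifP => yU.
- exact: Hc'.
- by apply: cross; rewrite ?yU.
- by move/esym; apply: cross; rewrite ?xU // sym_e.
- by apply: Hc; rewrite // inE ?xU ?yU.
Qed.

End CrossEdges.

(** * Cliques on [r] vertices and clusters *)

Section Structure.
Variables (r : nat) (T : finType) (e : rel T).
Hypothesis G : ky_counter r e.
Let r3 := kc_r3 G.
Let sym_e := kc_sym G.
Let irr_e := kc_irr G.
Let big_e := kc_big G.
Implicit Types (C : {set T}) (x y z v : T).

Definition low : {set T} := [set x | #|nb e x| == r].
Definition rclique C : bool :=
  (#|C| == r) && [forall x in C, forall y in C, (x != y) ==> e x y].

Lemma rcliqueP C : reflect (#|C| = r /\ clique e C) (rclique C).
Proof.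
apply: (iffP andP) => [[/eqP-> /forall_inP H]|[-> H]]; split=> //.
  by move=> x y xC yC xy; move/forall_inP: (H x xC) => /(_ y yC); rewrite xy.
apply/forall_inP => x xC; apply/forall_inP => y yC; apply/implyP; exact: H.
Qed.

Lemma cluster_refl x : x \in cluster e x.
Proof. by rewrite in_cluster. Qed.

Lemma cluster_eq x z : z \in cluster e x -> cluster e z = cluster e x.
Proof. by rewrite in_cluster => /eqP xz; apply/setP => y; rewrite !in_cluster xz. Qed.

Lemma low_clo x z : clo e x = clo e z -> (z \in low) = (x \in low).
Proof.
move=> xz; have : #|nb e z|.+1 = #|nb e x|.+1 by rewrite -!(card_clo irr_e) xz.
by case=> E; rewrite !inE E.
Qed.

Lemma cluster_low x z : z \in cluster e x -> (z \in low) = (x \in low).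
Proof. by rewrite in_cluster => /eqP; exact: low_clo. Qed.

Lemma in_clo x z : (z \in clo e x) = (z == x) || e x z.
Proof. by rewrite !inE. Qed.

Lemma cluster_adj x y z : e x y -> z \in cluster e x -> (z == y) || e z y.
Proof. by move=> exy; rewrite in_cluster => /eqP xz; rewrite eq_sym -in_clo -xz in_clo exy orbT. Qed.

Lemma rclique_cluster C x z : rclique C -> x \in C -> x \in low ->
  (z \in cluster e x) = (z \in C) && (z \in low).
Proof.
move=> /rcliqueP[Cr cC] xC xL; have dx : #|nb e x| = r by apply/eqP; move: xL; rewrite inE.
have [y yC Ey] := clique_outer G cC Cr xC dx.
apply/idP/andP => [zx|[zC]]; last first.
  by rewrite inE => /eqP dz; rewrite in_cluster (clique_low_twins G cC Cr xC zC dx dz).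
split; last by rewrite (cluster_low zx).
move: (zx); rewrite in_cluster => /eqP xz.
have : z \in clo e x by rewrite xz in_clo eqxx.
rewrite Ey in_setU1 => /orP[/eqP zy|//].
have := clique_nb G cC Cr yC; rewrite (setIidPr _) ?Cr; first by move: r3; lia.
apply/subsetP => w wC; have : w \in clo e y by rewrite -zy -xz Ey !inE wC orbT.
by rewrite in_clo in_nb => /orP[/eqP wy|//]; rewrite -wy wC in yC.
Qed.

Lemma rclique_nb C y : rclique C -> y \notin C -> (2 * #|nb e y :&: C| <= r)%N.
Proof. by case/rcliqueP => Cr cC; exact: (clique_nb G cC Cr). Qed.

Lemma rclique_outer C x : rclique C -> x \in C -> x \in low ->
  exists2 y, y \notin C & clo e x = y |: C.
Proof. by case/rcliqueP => Cr cC xC; rewrite inE => /eqP; apply: (clique_outer G). Qed.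

Lemma rclique_cluster_card C x : rclique C -> x \in C -> x \in low ->
  (2 * #|cluster e x| <= r)%N.
Proof.
move=> rC xC xL; have [y yC Ey] := rclique_outer rC xC xL.
apply: leq_trans (rclique_nb rC yC); rewrite leq_mul2l /=.
apply/subset_leq_card/subsetP => z zx.
have zC : z \in C by move: zx; rewrite (rclique_cluster z rC xC xL) => /andP[].
have exy : e x y.
  have : y \in clo e x by rewrite Ey setU11.
  by rewrite in_clo => /orP[/eqP yx|//]; rewrite yx xC in yC.
have := cluster_adj exy zx; rewrite inE zC andbT in_nb sym_e.
by case/orP => // /eqP zy; rewrite -zy zC in yC.
Qed.

Lemma low_replace_rclique x v : x \in low -> e x v -> clo e x <> clo e v ->
  (#|nb e v| < r + #|cluster e x|)%N ->
  (v \in low -> #|cluster e v| <= #|cluster e x|)%N -> rclique (clo e x :\ v).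
Proof.
rewrite !inE => /eqP dx exv xv dv tv; apply/rcliqueP; split.
  by have := card_clo irr_e x; rewrite (cardsD1 v) in_clo exv orbT dx add1n => -[].
by apply: (low_replace G dx exv xv dv) => dvr; apply: tv; rewrite dvr.
Qed.

Lemma rclique_deg C x v : rclique C -> x \in C -> x \in low -> v \in C -> v \notin low ->
  (r + #|cluster e x| <= #|nb e v|)%N.
Proof.
move=> rC xC xL vC vL; rewrite leqNgt; apply/negP => lt.
have xv : clo e x <> clo e v by move/low_clo; rewrite xL (negPf vL).
have [y yC Ey] := rclique_outer rC xC xL.
have /rcliqueP[Cr cC] := rC.
have exv : e x v.
  apply: cC => //; by apply/eqP => E; apply: xv; rewrite E.
have /rcliqueP[_ cC'] : rclique (clo e x :\ v).
  by apply: low_replace_rclique => //; rewrite (negPf vL).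
have := rclique_nb rC yC.
have yv : y != v by apply: contraNneq yC => ->.
have : (#|C :\ v| <= #|nb e y :&: C|)%N.
  apply/subset_leq_card/subsetP => z; rewrite !inE => /andP[zv zC]; rewrite zC andbT.
  apply: cC'.
  - by rewrite in_setD1 yv Ey setU11.
  - by rewrite in_setD1 zv Ey in_setU zC orbT.
  - by apply: contraNneq yC => ->.
by have := cardsD1 v C; rewrite vC Cr; move: r3; lia.
Qed.

Lemma rclique_meet C C' : rclique C -> rclique C' -> C != C' -> (#|C :&: C'| <= 1)%N.
Proof.
move=> /rcliqueP[Cr cC] /rcliqueP[Cr' cC'] CC; rewrite leqNgt; apply/negP.
set q := #|C :&: C'| => q2.
have qr : (q < r)%N.
  have : (q <= r)%N by rewrite -Cr; apply/subset_leq_card/subsetIl.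
  rewrite leq_eqVlt => /orP[/eqP Eq|//]; case/eqP: CC; apply/eqP.
  have E1 : C :&: C' = C by apply/eqP; rewrite eqEcard subsetIl Cr -/q Eq /=.
  have E2 : C :&: C' = C' by apply/eqP; rewrite eqEcard subsetIr Cr' -/q Eq /=.
  by rewrite -{1}E1 E2.
pose D := C' :\: C; have CD : [disjoint C & D].
  by rewrite disjoint_sym disjoints_subset; apply/subsetP => z; rewrite !inE => /andP[].
have cD : (#|D| + q = r)%N by rewrite -Cr' /q -(cardsID C C') addnC setIC.
have UE : C :|: C' = C :|: D.
  by apply/setP => z; rewrite !inE; case: (z \in C).
have cU : #|C :|: C'| = (r + #|D|)%N.
  by rewrite UE cardsU (_ : C :&: D = set0) ?cards0 ?subn0 ?Cr //; apply/eqP; rewrite setI_eq0.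
have ebU := eb_UU sym_e CD; rewrite -UE in ebU.
have ebC := clique_eb irr_e cC; have ebC' := clique_eb irr_e cC'.
have qC : clique e (C :&: C').
  by move=> x y; rewrite !inE => /andP[xC _] /andP[yC _]; apply: cC.
have ebq := clique_eb irr_e qC; rewrite -/q in ebq.
have DI : [disjoint C :&: C' & D].
  by apply: disjointWl CD; exact: subsetIl.
have C'E : C' = (C :&: C') :|: D by rewrite /D setIC setID.
have := eb_UU sym_e DI; rewrite -C'E => ebC'E.
have eD : eb e C D = (eb e (C :&: C') D + eb e (C :\: C') D)%N by exact: eb_splitl.
rewrite Cr in ebC; rewrite Cr' in ebC'; rewrite expnS expn1 in ebC ebC' ebq.
have rhoU : rho r e (C :|: C') = 4 * r%:Z * (r%:Z - 1) - rho_clique r q -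
    2 * r%:Z * (eb e (C :\: C') D)%:Z.
  have h1 : (r * eb e C C + r * r = r * (r * r))%N by rewrite -mulnDr ebC.
  have h2 : (r * eb e C' C' + r * r = r * (r * r))%N by rewrite -mulnDr ebC'.
  have h3 : (r * eb e (C :&: C') (C :&: C') + r * q = r * (q * q))%N by rewrite -mulnDr ebq.
  have h4 := congr1 (muln r) ebC'E; rewrite !mulnDr in h4.
  rewrite /rho cU ebU eD /rho_clique.
  have cD' : #|D|%:Z = r%:Z - q%:Z by lia.
  rewrite PoszD cD'; move: h1 h2 h3 h4; clear; move: (eb e C C) (eb e C' C').
  move: (eb e (C :&: C') (C :&: C')) (eb e (C :&: C') D) (eb e (C :\: C') D) (eb e D D).
  move=> a b c d f g; lia.
have hq := rho_clique_ge r3 q2 (ltnW qr).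
have [UT|UT] := eqVneq (C :|: C') setT; last first.
  have [||cr _] := rho_le_clique G _ UT; [by rewrite cU; lia | | by rewrite cU in cr; lia].
  rewrite rhoU; have : 0 <= 2 * r%:Z * (eb e (C :\: C') D)%:Z by rewrite mulr_ge0.
  lia.
have eb1 : (#|C :\: C'| <= eb e (C :\: C') D)%N.
  rewrite eb_sum -sum1_card; apply: leq_sum => x; rewrite inE => /andP[xC' xC].
  have nx : nb e x = (C :\ x) :|: (nb e x :&: D).
    apply/setP => z; rewrite !inE; have := in_setT z; rewrite -UT inE.
    have [->|zx] := eqVneq z x; first by rewrite irr_e.
    case zC: (z \in C) => /= zC'; last by rewrite zC' !andbT.
    by rewrite cC // eq_sym.
  have := deg_ge G x; rewrite {1}nx => /leq_trans/(_ (leq_card_setU _ _)).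
  by have := cardsD1 x C; rewrite xC Cr; lia.
have cDC : (#|C :\: C'| + q = r)%N by rewrite -Cr /q -(cardsID C' C) addnC.
have : r%:Z * (r%:Z - q%:Z) <= r%:Z * (eb e (C :\: C') D)%:Z by apply: ler_wpM2l; lia.
have : 0 <= (r%:Z - 1 - q%:Z) *
    (q%:Z * q%:Z + (q%:Z - 1) * (r%:Z - 1 - q%:Z) + 1).
  apply: mulr_ge0; first lia.
  have : 0 <= (q%:Z - 1) * (r%:Z - 1 - q%:Z) by apply: mulr_ge0; lia.
  have : 0 <= q%:Z * q%:Z by apply: mulr_ge0.
  lia.
move: big_e; rewrite -UT rhoU /rho_clique /ky_bound; clear; lia.
Qed.
End Structure.

Section Clusters.
Variables (r : nat) (T : finType) (e : rel T).
Hypothesis G : ky_counter r e.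
Let r3 := kc_r3 G.
Let sym_e := kc_sym G.
Let irr_e := kc_irr G.
Let crit_e := kc_crit G.
Implicit Types (C : {set T}) (x y z v : T).
Notation low := (low r e).
Notation rclique := (rclique r e).
Notation cl := (cluster e).

Lemma rclique_eq C C' x : rclique C -> rclique C' -> x \in C -> x \in C' ->
  x \in low -> C = C'.
Proof.
move=> rC rC' xC xC' xL; apply/eqP; apply/negPn/negP => CC.
have := rclique_meet G rC rC' CC.
have [y yC Ey] := rclique_outer G rC xC xL; have [y' yC' Ey'] := rclique_outer G rC' xC' xL.
have /rcliqueP[Cr _] := rC.
have : (#|C :\ y'| <= #|C :&: C'|)%N.
  apply/subset_leq_card/subsetP => z; rewrite !inE => /andP[zy zC]; rewrite zC.
  by have : z \in clo e x; [rewrite Ey !inE zC orbT | rewrite Ey' !inE (negPf zy)].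
by have := cardsD1 y' C; rewrite Cr; case: (y' \in C); move: r3; lia.
Qed.

Lemma adj_low x y : x \in low -> y \in low -> e x y -> clo e x != clo e y ->
  (#|cl y| <= #|cl x|)%N -> rclique (clo e x :\ y) /\ #|cl y| = 1%N.
Proof.
move=> xL yL exy /eqP xy tyx.
have dy : (#|nb e y| < r + #|cl x|)%N.
  move: yL; rewrite inE => /eqP->; rewrite -[X in (X < _)%N]addn0 ltn_add2l card_gt0.
  by apply/set0Pn; exists x; exact: cluster_refl.
have rC := low_replace_rclique G xL exy xy dy (fun _ => tyx); split=> //.
apply/eqP/cards1P; exists y; apply/setP => z; rewrite inE.
apply/idP/eqP => [zy|->]; last exact: cluster_refl.
apply/eqP/negPn/negP => zny; apply: xy.
have zL : z \in low by rewrite (cluster_low G zy).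
have exz : z \in clo e x.
  have eyx : e y x by rewrite sym_e.
  by rewrite in_clo (sym_e x z); exact: cluster_adj eyx zy.
have xC : x \in clo e x :\ y.
  by rewrite in_setD1 in_clo eqxx andbT; apply: contraTneq exy => ->; rewrite irr_e.
have : z \in cl x by rewrite (rclique_cluster G z rC xC xL) in_setD1 zny exz.
by move: zy; rewrite !in_cluster => /eqP-> /eqP->.
Qed.

Definition clq x : {set T} := odflt set0 [pick C : {set T} | rclique C && (x \in C)].

Lemma clqP x C : x \in low -> rclique C -> x \in C -> clq x = C.
Proof.
move=> xL rC xC; rewrite /clq; case: pickP => [C' /andP[rC' xC']|/(_ C)] /=.
  exact: (rclique_eq rC' rC xC' xC xL).
by rewrite rC xC.
Qed.

Lemma clq_neq0 x : clq x != set0 -> rclique (clq x) /\ x \in clq x.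
Proof. by rewrite /clq; case: pickP => [C /andP[]|] //=; rewrite eqxx. Qed.

Lemma mem_clq x v : v \in clq x -> rclique (clq x) /\ x \in clq x.
Proof. by move=> vx; apply: clq_neq0; apply/set0Pn; exists v. Qed.

Definition small : {set T} := [set x in low | #|cl x| == 1%N].

Lemma small_low x : x \in small -> x \in low.
Proof. by rewrite inE => /andP[]. Qed.

Lemma small_cl x : x \in small -> cl x = [set x].
Proof.
rewrite inE => /andP[_ /cards1P[y Ey]]; have := cluster_refl e x.
by rewrite Ey inE => /eqP->.
Qed.

Lemma big_cl x : x \in low -> x \notin small -> (2 <= #|cl x|)%N.
Proof.
move=> xL; rewrite inE xL /=; have : (0 < #|cl x|)%N.
  by apply/card_gt0P; exists x; exact: cluster_refl.
by lia.
Qed.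

Lemma small_clo x y : x \in small -> e x y -> clo e x != clo e y.
Proof.
move=> xS exy; apply/eqP => xy; have : y \in cl x by rewrite in_cluster xy.
by rewrite small_cl // inE => /eqP yx; rewrite yx irr_e in exy.
Qed.

Lemma small_adj_small x y : x \in small -> y \in small -> e x y -> clq x = clo e x :\ y.
Proof.
move=> xS yS exy; have [] := adj_low (small_low xS) (small_low yS) exy (small_clo xS exy).
  by rewrite !small_cl // !cards1.
move=> rC _; apply: clqP => //; first exact: small_low.
by rewrite in_setD1 in_clo eqxx andbT; apply: contraTneq exy => ->; rewrite irr_e.
Qed.

Lemma small_clq_low x z : x \in small -> z \in clq x -> z \in low -> z = x.
Proof.
move=> xS zC zL; have [rC xC] := mem_clq zC.
have : z \in cl x by rewrite (rclique_cluster G z rC xC (small_low xS)) zC.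
by rewrite small_cl // inE => /eqP.
Qed.

Lemma small_adj_uniq x y z : x \in small -> y \in small -> e x y -> z \in low -> e x z -> z = y.
Proof.
move=> xS yS exy zL exz; apply/eqP/negPn/negP => zy.
have zC : z \in clq x by rewrite (small_adj_small xS yS exy) in_setD1 zy in_clo exz orbT.
by have zx := small_clq_low xS zC zL; rewrite zx irr_e in exz.
Qed.

Lemma big_adj x y : x \in low -> x \notin small -> y \in low -> e x y -> clo e x != clo e y ->
  [/\ y \in small, clq x = clo e x :\ y & clq y = set0].
Proof.
move=> xL xB yL exy xy; have t2 := big_cl xL xB.
have tyx : (#|cl y| <= #|cl x|)%N.
  rewrite leqNgt; apply/negP => lt.
  have [] := @adj_low y x yL xL; rewrite ?(sym_e y) // 1?eq_sym // ?(ltnW lt) //.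
  by move=> _ t1; rewrite t1 in t2.
have [rC ty] := adj_low xL yL exy xy tyx.
have xC : x \in clo e x :\ y.
  by rewrite in_setD1 in_clo eqxx andbT; apply: contraTneq exy => ->; rewrite irr_e.
split; [by rewrite inE yL ty | exact: clqP | apply/eqP/negPn/negP => D0].
have [rD yD] := clq_neq0 D0; have [w wD Ew] := rclique_outer G rD yD yL.
have /card_gt1P[x1 [x2 [x1x x2x x12]]] := t2.
have [x' x'x x'w] : exists2 x', x' \in cl x & x' != w.
  by have [E|] := eqVneq x1 w; [exists x2; rewrite // -E eq_sym | exists x1].
have x'y : x' \in clo e y.
  by rewrite in_clo (sym_e y x'); exact: cluster_adj exy x'x.
have x'D : x' \in clq y by move: x'y; rewrite Ew in_setU1 (negPf x'w).
have x'L : x' \in low by rewrite (cluster_low G x'x).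
have : x' \in cl y by rewrite (rclique_cluster G _ rD yD yL) x'D.
by rewrite in_cluster; move: x'x; rewrite in_cluster => /eqP <-; rewrite eq_sym (negPf xy).
Qed.

Lemma big_unclq x v : x \in low -> x \notin small -> clq x = set0 ->
  e x v -> v \notin cl x -> (r + #|cl x| <= #|nb e v|)%N.
Proof.
move=> xL xB x0 exv; rewrite in_cluster => xv.
have nC C : rclique C -> x \notin C.
  by move=> rC; apply/negP => xC; have := in_set0 x; rewrite -x0 (clqP xL rC xC) xC.
have [vL|vL] := boolP (v \in low).
  have [_ E _] := big_adj xL xB vL exv xv.
  have := in_set0 x; rewrite -x0 E in_setD1 in_clo eqxx andbT => /eqP xv'.
  by rewrite xv' irr_e in exv.
rewrite leqNgt; apply/negP => lt.
have := nC _ (low_replace_rclique G xL exv (elimN eqP xv) lt _).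
rewrite (negPf vL) => /(_ (fun h => False_ind _ (notF h))).
by rewrite in_setD1 in_clo eqxx andbT negbK => /eqP xv'; rewrite xv' irr_e in exv.
Qed.

Lemma big_unclq_card x : x \in low -> clq x = set0 -> (#|cl x| + 2 <= r)%N.
Proof.
move=> xL x0; rewrite leqNgt; apply/negP => lt.
have dx : #|nb e x| = r by apply/eqP; move: xL; rewrite inE.
have sub : cl x \subset clo e x.
  apply/subsetP => z; rewrite in_cluster => /eqP->; by rewrite in_clo eqxx.
have cX : (#|clo e x :\: cl x| <= 2)%N.
  by rewrite cardsD (setIidPr sub) card_clo // dx; move: lt; lia.
have [u ux Hu] : exists2 u, u \in nb e x & (#|clo e x :\: cl x :\ u| <= 1)%N.
  have [E0|/set0Pn[u uX]] := eqVneq (clo e x :\: cl x) set0.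
    have /card_gt0P[u uN] : (0 < #|nb e x|)%N by rewrite dx; move: r3; lia.
    by exists u => //; rewrite E0 set0D cards0.
  exists u; last by move: cX; rewrite (cardsD1 u) uX.
  move: uX; rewrite in_setD in_clo in_nb => /andP[uX /orP[/eqP ux|//]].
  by rewrite ux cluster_refl in uX.
have exu : e x u by rewrite -in_nb.
have rC : rclique (clo e x :\ u).
  apply/rcliqueP; split.
    by have := card_clo irr_e x; rewrite (cardsD1 u) in_clo exu orbT dx add1n => -[].
  move=> a b; rewrite !in_setD1 => /andP[au ax] /andP[bu bx] ab.
  have cl_all c d : c \in cl x -> d \in clo e x -> c != d -> e c d.
    by rewrite in_cluster => /eqP->; rewrite in_clo eq_sym => /orP[->|].
  have [aT|aT] := boolP (a \in cl x); first exact: cl_all.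
  have [bT|bT] := boolP (b \in cl x); first by rewrite sym_e; apply: cl_all; rewrite // eq_sym.
  have : (#|[set a; b]| <= 1)%N.
    apply: leq_trans Hu; apply/subset_leq_card/subsetP => c.
    by rewrite in_set2 => /orP[/eqP->|/eqP->]; rewrite in_setD1 in_setD ?au ?bu ?aT ?bT ?ax ?bx.
  by rewrite cards2 ab.
have xC : x \in clo e x :\ u.
  by rewrite in_setD1 in_clo eqxx andbT; apply: contraTneq exu => ->; rewrite irr_e.
by have := in_set0 x; rewrite -x0 (clqP xL rC xC) xC.
Qed.

Lemma clq_deg x v : x \in low -> v \in clq x -> v \notin cl x -> (r + #|cl x| <= #|nb e v|)%N.
Proof.
move=> xL vC vx; have [rC xC] := mem_clq vC.
apply: (rclique_deg G rC xC xL vC); apply: contra vx => vL.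
by rewrite (rclique_cluster G v rC xC xL) vC.
Qed.

Definition paired : {set T} := [set x in small | [exists y in small, e x y]].
Definition single : {set T} := small :\: paired.

Lemma pairedP x : reflect (x \in small /\ exists2 y, y \in small & e x y) (x \in paired).
Proof.
rewrite [x \in paired]in_set; apply: (iffP andP) => -[xS H]; split=> //; first exact/exists_inP.
by apply/exists_inP.
Qed.

Lemma paired_nb x : x \in paired ->
  [/\ rclique (clq x), x \in clq x & forall v, v \notin low -> e x v -> v \in clq x].
Proof.
case/pairedP => xS [y yS exy].
have E := small_adj_small xS yS exy.
have xC : x \in clq x.
  by rewrite E in_setD1 in_clo eqxx andbT; apply: contraTneq exy => ->; rewrite irr_e.
have [rC _] := mem_clq xC; split=> // v vL exv.
rewrite E in_setD1 in_clo exv orbT andbT; apply: contraNneq vL => ->; exact: small_low.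
Qed.

Definition mid : {set T} := [set v | #|nb e v| == r.+1].

Lemma mid_low v : v \in mid -> v \notin low.
Proof. by rewrite !inE => /eqP->; lia. Qed.

Lemma mid_two_paired v x x' : v \in mid -> x \in paired -> x' \in paired ->
  e v x -> e v x' -> x != x' -> (#|nb e v :&: small| <= 2)%N.
Proof.
move=> vM xP xP' evx evx' xx; have vL := mid_low vM.
have [rC xC HC] := paired_nb xP; have [rC' xC' HC'] := paired_nb xP'.
have /pairedP[xS _] := xP; have /pairedP[xS' _] := xP'.
have vC : v \in clq x by apply: HC; rewrite // sym_e.
have vC' : v \in clq x' by apply: HC'; rewrite // sym_e.
have CC : clq x != clq x'.
  apply: contra xx => /eqP E; rewrite eq_sym; apply/eqP.
  by apply: (small_clq_low xS); rewrite ?E ?small_low.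
have meet := rclique_meet G rC rC' CC.
have /rcliqueP[Cr cC] := rC; have /rcliqueP[Cr' cC'] := rC'.
have dis : [disjoint clq x :\ v & clq x' :\ v].
  rewrite -setI_eq0; apply/eqP/setP => z; rewrite !inE; apply/negP => /andP[/andP[zv zC] /andP[_ zC']].
  have : (#|[set z; v]| <= 1)%N.
    apply: leq_trans meet; apply/subset_leq_card/subsetP => w.
    by rewrite !inE => /orP[/eqP->|/eqP->]; rewrite ?zC ?zC' ?vC ?vC'.
  by rewrite cards2 zv.
have sub : (clq x :\ v) :|: (clq x' :\ v) \subset nb e v.
  apply/subsetP => z; rewrite in_setU !in_setD1 in_nb => /orP[]/andP[zv zC].
    by apply: cC; rewrite // eq_sym.
  by apply: cC'; rewrite // eq_sym.
have dv : #|nb e v| = r.+1 by apply/eqP; move: vM; rewrite inE.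
have cU : #|(clq x :\ v) :|: (clq x' :\ v)| = (r.-1 + r.-1)%N.
  rewrite cardsU (_ : _ :&: _ = set0) ?cards0 ?subn0; last by apply/eqP; rewrite setI_eq0.
  move: (cardsD1 v (clq x)) (cardsD1 v (clq x')); rewrite vC vC' Cr Cr' !add1n.
  by move=> -> /eqP; rewrite eqSS => /eqP->.
have E : (clq x :\ v) :|: (clq x' :\ v) = nb e v.
  by apply/eqP; rewrite eqEcard sub cU dv; move: r3; clear; lia.
apply: (@leq_trans #|[set x; x']|); last by rewrite cards2; case: (_ != _).
apply/subset_leq_card/subsetP => z; rewrite -E in_setI in_setU !in_setD1 => /andP[+ zS].
case/orP => /andP[_ zC]; rewrite !inE.
  by rewrite (small_clq_low xS zC (small_low zS)) eqxx.
by rewrite (small_clq_low xS' zC (small_low zS)) eqxx orbT.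
Qed.

Definition first_half : {set T} :=
  [set x in paired | [exists y in small, e x y && (enum_rank x < enum_rank y)%N]].
Definition second_half : {set T} := paired :\: first_half.

Lemma single_indep x y : x \in single -> y \in small -> ~~ e x y.
Proof.
rewrite inE => /andP[+ xS] yS; apply: contra => exy.
by apply/pairedP; split=> //; exists y.
Qed.

Lemma first_indep x y : x \in single :|: first_half -> y \in single :|: first_half -> ~~ e x y.
Proof.
have sub z : z \in single :|: first_half -> z \in small.
  by rewrite !inE => /orP[/andP[]//|/andP[/andP[]]].
move=> xX yX; have [xS yS] := (sub x xX, sub y yX).
move: xX; rewrite in_setU => /orP[/single_indep->//|xF].
move: yX; rewrite in_setU => /orP[/single_indep h|yF]; first by rewrite sym_e h.
apply/negP => exy; move: xF yF; rewrite !inE -/small.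
case/andP => _ /exists_inP[y' yS' /andP[exy' lt]] /andP[_ /exists_inP[x' xS' /andP[eyx' lt']]].
have E := small_adj_uniq xS yS exy (small_low yS') exy'; subst y'.
rewrite sym_e in exy; have E := small_adj_uniq yS xS exy (small_low xS') eyx'; subst x'.
by have := ltn_trans lt lt'; rewrite ltnn.
Qed.

Lemma second_indep x y : x \in single :|: second_half -> y \in single :|: second_half -> ~~ e x y.
Proof.
have sub z : z \in single :|: second_half -> z \in small.
  by rewrite !inE => /orP[/andP[]//|/andP[_ /andP[]]].
move=> xX yX; have [xS yS] := (sub x xX, sub y yX).
move: xX; rewrite in_setU => /orP[/single_indep->//|xF].
move: yX; rewrite in_setU => /orP[/single_indep h|yF]; first by rewrite sym_e h.
apply/negP => exy; move: xF yF; rewrite !in_setD => /andP[xF xP] /andP[yF yP].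
case: (ltngtP (enum_rank x) (enum_rank y)) => [lt|lt|E].
- case/negP: xF; rewrite inE xP; apply/exists_inP; exists y; rewrite // exy lt //.
- case/negP: yF; rewrite inE yP; apply/exists_inP; exists x; rewrite // sym_e exy lt //.
- by move: exy; rewrite (enum_rank_inj (val_inj E)) irr_e.
Qed.

Lemma few_cross_mid (A B : {set T}) : (forall x y, x \in A -> y \in A -> ~~ e x y) ->
  A \subset low -> B \subset mid -> (eb e A B <= #|A| + 2 * #|B|)%N.
Proof.
move=> indA AL BM; have dAB : [disjoint A & B].
  rewrite disjoint_sym disjoints_subset; apply/subsetP => v /(subsetP BM)/mid_low.
  by rewrite in_setC; apply: contra; exact: (subsetP AL).
have [E0|AB0] := eqVneq (A :|: B) set0.
  have -> : A = set0 by apply/eqP; rewrite -subset0 -E0 subsetUl.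
  by rewrite eb0l.
have := few_cross_edges (r_gt0 G) sym_e irr_e crit_e indA dAB AB0.
have -> : \sum_(v in A :|: B) demand r e v = (#|A| + 2 * #|B|)%N%:Z.
  rewrite (big_setID A) /= setUK setDUl setDv set0U (setDidPl _); last by rewrite disjoint_sym.
  rewrite (eq_bigr (fun=> 1)); last first.
    by move=> v /(subsetP AL); rewrite inE /demand => /eqP->; lia.
  rewrite [X in _ + X](eq_bigr (fun=> 2)); last first.
    by move=> v /(subsetP BM); rewrite inE /demand => /eqP->; lia.
  by rewrite !sumr_const; lia.
lia.
Qed.

(* A middle vertex with at most two small neighbours can be dropped; any other one does not see
   both halves of the paired vertices. *)
Lemma small_mid_edges :
  (eb e small mid <= 2 * #|single| + #|paired| + 2 * #|mid|)%N.
Proof.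
pose M := [set v in mid | (2 < #|nb e v :&: small|)%N].
pose M1 := [set v in M | nb e v :&: first_half != set0].
have sP : paired \subset small by apply/subsetP => x; rewrite inE => /andP[].
have sF : first_half \subset paired by apply/subsetP => x; rewrite inE => /andP[].
have sMM : M \subset mid by apply/subsetP => v; rewrite inE => /andP[].
have sM1 : M1 \subset M by apply/subsetP => v; rewrite inE => /andP[].
have sL : small \subset low by apply/subsetP => x /small_low.
have splitS (B : {set T}) : eb e small B =
    (eb e single B + eb e first_half B + eb e second_half B)%N.
  rewrite (eb_splitl e paired) (setIidPr sP) (eb_splitl e first_half paired) (setIidPr sF).
  by rewrite -/single -/second_half; lia.
have disS (X : {set T}) : X \subset paired -> [disjoint single & X].
  move=> sX; apply: disjointWr sX _; rewrite disjoint_sym disjoints_subset.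
  by apply/subsetP => x xP; rewrite in_setC in_setD xP.
have H0 : (eb e small (mid :\: M) <= 2 * #|mid :\: M|)%N.
  rewrite ebC // eb_sum -sum1_card big_distrr /=; apply: leq_sum => v.
  by rewrite in_setD => /andP[+ vM]; rewrite in_set vM /= -leqNgt.
have H1 := few_cross_mid first_indep _ (subset_trans sM1 sMM).
have H2 := few_cross_mid second_indep _ (subset_trans (subsetDl M M1) sMM).
have s1 : single :|: first_half \subset low.
  by rewrite subUset (subset_trans (subsetDl _ _) sL) (subset_trans sF (subset_trans sP sL)).
have s2 : single :|: second_half \subset low.
  by rewrite subUset !(subset_trans (subsetDl _ _)) ?(subset_trans sP).
move: (H1 s1) (H2 s2); rewrite !eb_Ul ?disS ?subsetDl //.
have cU (X : {set T}) : X \subset paired -> #|single :|: X| = (#|single| + #|X|)%N.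
  by move=> sX; rewrite cardsU (_ : _ :&: _ = set0) ?cards0 ?subn0 //; apply/eqP; rewrite setI_eq0 disS.
rewrite !cU ?subsetDl //.
have Z1 : eb e second_half M1 = 0%N.
  rewrite ebC // eb_sum big1 // => v; rewrite in_set => /andP[vM /set0Pn[x]].
  rewrite in_setI in_nb => /andP[evx xF]; apply/eqP; rewrite cards_eq0; apply/negPn/negP.
  case/set0Pn => x'; rewrite in_setI in_nb in_setD => /andP[evx' /andP[xF' xP']].
  move: vM; rewrite in_set => /andP[vM]; rewrite ltnNge => /negP; apply.
  apply: (mid_two_paired vM (subsetP sF _ xF) xP' evx evx').
  by apply: contraNneq xF' => <-.
have Z2 : eb e first_half (M :\: M1) = 0%N.
  rewrite ebC // eb_sum big1 // => v; rewrite in_setD => /andP[+ vM].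
  by rewrite in_set vM negbK => /eqP->; rewrite cards0.
have := splitS M1; have := splitS (M :\: M1).
have := eb_splitr e M small mid; have := eb_splitr e M1 small M.
rewrite (setIidPr sMM) (setIidPr sM1) Z1 Z2.
have := cardsID M mid; have := cardsID M1 M; have := cardsID first_half paired.
rewrite (setIidPr sMM) (setIidPr sM1) (setIidPr sF) -/second_half.
move: H0; clear; lia.
Qed.

End Clusters.

(** * Discharging *)

Lemma unclq_share (r t d : nat) : (2 <= t)%N -> (t + 2 <= r)%N -> (r + t <= d)%N ->
  (r%:R - 2) / (r%:R + 1 - t%:R) <= (r%:R * (d%:R - r%:R - 1) + 2) / d%:R :> rat.
Proof.
move=> t2 tr td.
have hd : 0 < d%:R :> rat by rewrite ltr0n; lia.
have ht : 0 < r%:R + 1 - t%:R :> rat by rewrite subr_gt0 natr1 ltr_nat; lia.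
rewrite ler_pdivrMr // mulrAC ler_pdivlMr //.
clear hd ht; have [j ->] : exists j, d = (r + t + j)%N by exists (d - (r + t))%N; lia.
have [i ->] : exists i, r = (t + 2 + i)%N by exists (r - (t + 2))%N; lia.
have [u ->] : exists u, t = (u + 2)%N by exists (t - 2)%N; lia.
have : ((u + 2 + i) * (2 * u + 6 + i + j) <= ((u + 4 + i) * (u + 1 + j) + 2) * (i + 3))%N.
  nia.
by rewrite -(ler_nat rat) !(natrM, natrD); nra.
Qed.

Section Discharging.
Variables (r : nat) (T : finType) (e : rel T).
Hypothesis G : ky_counter r e.
Let r3 := kc_r3 G.
Let sym_e := kc_sym G.
Let irr_e := kc_irr G.
Implicit Types (C : {set T}) (x y z v : T).
Notation low := (low r e).
Notation rclique := (rclique r e).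
Notation small := (small r e).
Notation mid := (mid r e).
Notation single := (single r e).
Notation paired := (paired r e).
Notation clq := (clq r e).
Notation cl := (cluster e).
Notation rq := (r%:R : rat).
Notation t x := (#|cl x|%:R : rat).

Definition high : {set T} := [set v | (r.+1 < #|nb e v|)%N].

Definition to_small_unclq x : rat :=
  if x \in small then 1 else if clq x == set0 then (rq - 2) / (rq + 1 - t x) else 0.
Definition to_clq v x : rat :=
  if (x \notin small) && (v \in clq x) then (rq - 1) / t x else 0.
(* The charge that the high vertex [v] sends to the low vertex [x]. *)
Definition charge v x : rat := (e v x)%:R * (to_small_unclq x + to_clq v x).

Lemma t_gt0 x : 0 < t x.
Proof. by rewrite ltr0n; apply/card_gt0P; exists x; exact: cluster_refl. Qed.

Lemma r_ge3 : 3 <= rq. Proof. by rewrite ler_nat. Qed.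

Lemma high_low v : v \in high -> v \notin low.
Proof. by rewrite !inE; lia. Qed.

Lemma to_small_unclq_ge0 x : x \in low -> 0 <= to_small_unclq x.
Proof.
move=> xL; rewrite /to_small_unclq; case: ifP => // _; case: eqP => // x0.
have := big_unclq_card G xL x0; rewrite -(ler_nat rat) natrD => h.
by apply: divr_ge0; have := r_ge3; move: h; lra.
Qed.

Lemma share_ge1 v : v \in high -> 1 <= (rq * (#|nb e v|%:R - rq - 1) + 2) / #|nb e v|%:R.
Proof.
rewrite inE => dv; have hd : 0 < #|nb e v|%:R :> rat by rewrite ltr0n; lia.
rewrite ler_pdivlMr // mul1r.
have h2 : rq + 2 <= #|nb e v|%:R by rewrite -natrD ler_nat; lia.
have := r_ge3; move: h2; set d := #|nb e v|%:R => h2 h3.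
have : 0 <= (rq - 1) * (d - rq - 2) by apply: mulr_ge0; lra.
lra.
Qed.

Lemma charge_le v : v \in high ->
  \sum_(x in low) charge v x <= rq * (#|nb e v|%:R - rq - 1) + 2.
Proof.
move=> vH; have vL := high_low vH; set d := #|nb e v|%:R; set sg := rq * _ + 2.
have d0 : 0 < d by move: vH; rewrite inE ltr0n; lia.
pose h u := (u \in low)%:R * to_small_unclq u +
  \sum_(x in low) (if [&& x \notin small, v \in clq x & u \in clq x] then (t x)^-1 else 0).
have hle u : u \in nb e v -> h u <= sg / d.
  rewrite in_nb /h => evu.
  have [/existsP[x0 /and4P[x0L x0S vx0 ux0]]|nx] := boolP [exists x0, [&& x0 \in low,
      x0 \notin small, v \in clq x0 & u \in clq x0]].
    apply: le_trans (share_ge1 vH).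
    have [rC0 xC0] := mem_clq vx0.
    have vu : v != u by apply: contraTneq evu => ->; rewrite irr_e.
    have same x : x \in low -> v \in clq x -> u \in clq x -> x \in cl x0.
      move=> xL vx ux; have [rC xC] := mem_clq vx.
      rewrite (rclique_cluster G x rC0 xC0 x0L) xL andbT.
      suff -> : clq x0 = clq x by [].
      apply/eqP/negPn/negP => CC; have := rclique_meet G rC0 rC CC.
      suff: (#|[set v; u]| <= #|clq x0 :&: clq x|)%N by rewrite cards2 vu => h1 /(leq_trans h1).
      apply/subset_leq_card/subsetP => w; rewrite in_set2 => /orP[]/eqP->;
        by rewrite inE ?vx ?vx0 ?ux ?ux0.
    have -> : (u \in low)%:R * to_small_unclq u = 0.
      case uL: (u \in low); last by rewrite mul0r.
      have ucl : u \in cl x0 by rewrite (rclique_cluster G u rC0 xC0 x0L) ux0 uL.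
      have cu := cluster_eq ucl.
      rewrite mul1r /to_small_unclq ifN; last first.
        apply/negP => uS; have := big_cl G x0L x0S.
        by rewrite -cu (small_cl uS) cards1.
      rewrite (clqP G uL rC0 ux0) ifN //; apply/set0Pn; by exists x0.
    rewrite add0r; apply: (@le_trans _ _ (\sum_(x in cl x0) (t x0)^-1)); last first.
      by rewrite sumr_const -[X in X <= _]mulr_natr mulVf // gt_eqF ?t_gt0.
    rewrite big_mkcond [leRHS]big_mkcond; apply: ler_sum => x _.
    case: ifP => xL; last by case: ifP => // _; rewrite invr_ge0 ltW ?t_gt0.
    case: ifP => [/and3P[_ vx ux]|_]; last by case: ifP => // _; rewrite invr_ge0 ltW ?t_gt0.
    by have xx := same x xL vx ux; rewrite xx (cluster_eq xx).
  rewrite big1 ?addr0; last first.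
    move=> x xL; case: ifP => // /and3P[xS vx ux]; case/negP: nx; apply/existsP.
    by exists x; rewrite xL xS vx.
  case uL: (u \in low); last by rewrite mul0r; apply: le_trans (share_ge1 vH).
  rewrite mul1r /to_small_unclq; case: ifP => [_|uS]; first exact: share_ge1.
  case: eqP => [u0|_]; last by apply: le_trans (share_ge1 vH).
  have vu : v \notin cl u by apply: contra vL => vu; rewrite (cluster_low G vu).
  apply: unclq_share; first exact: (big_cl G uL (negbT uS)).
  - exact: (big_unclq_card G uL u0).
  - by apply: (big_unclq G uL (negbT uS) u0); rewrite // sym_e.
have : \sum_(u in nb e v) h u <= sg.
  apply: le_trans (ler_sum _ hle) _.
  by rewrite sumr_const -mulr_natr -/d divfK // gt_eqF.
apply: le_trans; rewrite big_split /= exchange_big /=.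
under eq_bigr => x _ do rewrite /charge mulrDr.
rewrite big_split /=; apply: lerD.
  rewrite big_mkcond [leRHS]big_mkcond; apply: ler_sum => x _.
  rewrite in_nb; case: ifP => xL; case: (e v x); rewrite ?mul1r ?mul0r //.
apply: ler_sum => x xL; rewrite /to_clq.
case xS: (x \notin small) => /=; last by rewrite mulr0 sumr_ge0.
case vx: (v \in clq x) => /=; last by rewrite mulr0 sumr_ge0.
apply: (@le_trans _ _ ((rq - 1) / t x)).
  have h0 : 0 <= (rq - 1) / t x by rewrite divr_ge0 ?ltW ?t_gt0 //; have := r_ge3; lra.
  by case: (e v x); rewrite ?mul1r ?mul0r.
rewrite -big_mkcondr sumr_const -[X in _ <= X]mulr_natl; apply: ler_wpM2r.
  by rewrite invr_ge0 ltW ?t_gt0.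
have [/rcliqueP[Cr cC] _] := mem_clq vx.
have -> : rq - 1 = (#|clq x :\ v|)%:R.
  by have := cardsD1 v (clq x); rewrite vx Cr add1n => Er; rewrite [in LHS]Er -natr1 addrK.
rewrite ler_nat; apply/subset_leq_card/subsetP => u; rewrite in_setD1 => /andP[uv uC].
by rewrite unfold_in /= in_nb uC andbT; apply: cC; rewrite // eq_sym.
Qed.

Lemma sum_edge (x : T) (c : rat) (B : {set T}) :
  \sum_(v in B) (e v x)%:R * c = #|nb e x :&: B|%:R * c.
Proof.
rewrite -mulr_suml -sum_eE natr_sum; congr (_ * _).
by apply: eq_bigr => v _; rewrite sym_e.
Qed.

Lemma charge_small x : x \in small -> \sum_(v in high) charge v x = #|nb e x :&: high|%:R.
Proof.
move=> xS; rewrite -[RHS]mulr1 -sum_edge; apply: eq_bigr => v _.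
by rewrite /charge /to_small_unclq /to_clq xS /= addr0.
Qed.

Lemma charge_unclq x : x \in low -> x \notin small -> clq x = set0 ->
  rq - 2 <= \sum_(v in high) charge v x.
Proof.
move=> xL xS x0.
have -> : \sum_(v in high) charge v x =
    #|nb e x :&: high|%:R * ((rq - 2) / (rq + 1 - t x)).
  rewrite -sum_edge; apply: eq_bigr => v _.
  by rewrite /charge /to_small_unclq /to_clq (negPf xS) x0 eqxx in_set0 addr0.
have t2 := big_cl G xL xS; have tr := big_unclq_card G xL x0.
have sub : clo e x :\: cl x \subset nb e x :&: high.
  apply/subsetP => v; rewrite in_setD in_clo => /andP[vx /orP[/eqP E|exv]].
    by rewrite E cluster_refl in vx.
  rewrite in_setI in_nb exv; have := big_unclq G xL xS x0 exv vx.
  by rewrite inE; move: t2; clear; lia.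
have cX : #|clo e x :\: cl x|%:R = rq + 1 - t x.
  rewrite cardsD (setIidPr _); last first.
    by apply/subsetP => z; rewrite in_cluster => /eqP->; rewrite in_clo eqxx.
  have dx : #|nb e x| = r by apply/eqP; move: xL; rewrite inE.
  by rewrite card_clo // dx natrB ?natrS; [ring | move: tr; clear; lia].
have h := subset_leq_card sub; rewrite -(ler_nat rat) cX in h.
have tr' : t x + 2 <= rq by rewrite -natrD ler_nat.
have h0 : 0 < rq + 1 - t x by move: tr'; lra.
rewrite mulrA ler_pdivlMr // mulrC; apply: ler_wpM2r => //.
by have := r_ge3; lra.
Qed.

Lemma charge_clq x : x \in low -> x \notin small -> clq x != set0 ->
  rq - 1 <= \sum_(v in high) charge v x.
Proof.
move=> xL xS x0; have [rC xC] := clq_neq0 x0; have /rcliqueP[Cr cC] := rC.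
have t2 := big_cl G xL xS; have tr := rclique_cluster_card G rC xC xL.
have tr' : 2 * t x <= rq by rewrite -natrM ler_nat.
have sub : clq x :\: cl x \subset high.
  apply/subsetP => v; rewrite in_setD => /andP[vx vC].
  by rewrite inE; have := clq_deg G xL vC vx; move: t2; clear; lia.
have c0 v : 0 <= charge v x.
  apply: mulr_ge0 => //; apply: addr_ge0; first exact: to_small_unclq_ge0.
  rewrite /to_clq; case: ifP => // _; apply: divr_ge0; last by rewrite ltW ?t_gt0.
  by have := r_ge3; lra.
rewrite (big_setID (clq x :\: cl x)) /= (setIidPr sub).
apply: ler_wpDr; first exact: sumr_ge0.
have -> : \sum_(v in clq x :\: cl x) charge v x =
    \sum_(v in clq x :\: cl x) ((rq - 1) / t x).
  apply: eq_bigr => v; rewrite in_setD => /andP[vx vC].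
  rewrite /charge /to_small_unclq /to_clq (negPf xS) (negPf x0) vC /= add0r.
  rewrite cC ?mul1r //; apply: contraNneq vx => ->; exact: cluster_refl.
rewrite sumr_const -[X in _ <= X]mulr_natl.
have -> : #|clq x :\: cl x|%:R = rq - t x.
  rewrite cardsD (setIidPr _) ?Cr.
    by rewrite natrB //; move: tr; clear; lia.
  by apply/subsetP => z; rewrite (rclique_cluster G z rC xC xL) => /andP[].
rewrite mulrA ler_pdivlMr ?t_gt0 // mulrC; apply: ler_wpM2r; first by have := r_ge3; lra.
by move: tr'; lra.
Qed.

Definition clustered : {set T} := [set x in low :\: small | clq x != set0].

Lemma single_low_edges : (eb e single low <= #|clustered|)%N.
Proof.
rewrite ebC // (eb_splitl e clustered) -[leqRHS]addn0; apply: leq_add.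
  rewrite eb_sum -sum1_card; have -> : low :&: clustered = clustered.
    by apply/setIidPr/subsetP => x; rewrite !in_set => /andP[/andP[]].
  apply: leq_sum => z; rewrite in_set in_setD => /andP[/andP[zS zL] z0].
  rewrite leqNgt; apply/negP => /card_gt1P[a [b [+ + ab]]].
  rewrite !in_setI !in_nb => /andP[eza aS] /andP[ezb bS].
  have sS y : y \in single -> y \in small by rewrite in_setD => /andP[].
  have nclo y : e z y -> y \in single -> clo e z != clo e y.
    by move=> ezy yS; rewrite eq_sym; apply: (small_clo G (sS _ yS)); rewrite sym_e.
  have [_ Ea _] := big_adj G zL zS (small_low (sS _ aS)) eza (nclo _ eza aS).
  have [_ Eb _] := big_adj G zL zS (small_low (sS _ bS)) ezb (nclo _ ezb bS).
  have : a \in clq z by rewrite Eb in_setD1 ab in_clo eza orbT.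
  by rewrite Ea setD11.
rewrite leqn0 eb_sum sum_nat_eq0; apply/forall_inP => z; rewrite in_setD => /andP[zC zL].
rewrite cards_eq0; apply/negPn/negP => /set0Pn[a]; rewrite in_setI in_nb => /andP[eza aS].
have [zS|zS] := boolP (z \in small).
  by have := single_indep aS zS; rewrite sym_e eza.
have aS' : a \in small by move: aS; rewrite in_setD => /andP[].
have nclo : clo e z != clo e a.
  by rewrite eq_sym; apply: (small_clo G aS'); rewrite sym_e.
have [_ Ea _] := big_adj G zL zS (small_low aS') eza nclo.
case/negP: zC; rewrite in_set in_setD zS zL /=; apply/set0Pn; exists z.
by rewrite Ea in_setD1 in_clo eqxx andbT; apply: contraTneq eza => ->; rewrite irr_e.
Qed.

Lemma paired_low_edges : (eb e paired low <= #|paired|)%N.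
Proof.
rewrite eb_sum -sum1_card; apply: leq_sum => x /pairedP[xS [y yS exy]].
rewrite -(cards1 y); apply/subset_leq_card/subsetP => z; rewrite in_setI in_nb => /andP[exz zL].
by rewrite inE (small_adj_uniq G xS yS exy zL exz).
Qed.

Lemma no_ky_counter : False.
Proof.
have sL : small \subset low by apply/subsetP => x /small_low.
have main : (r%:R - 2) * #|low|%:R - 2 * #|mid|%:R <=
    \sum_(v in high) (rq * (#|nb e v|%:R - rq - 1) + 2).
  apply: le_trans (ler_sum _ charge_le); rewrite exchange_big /=.
  rewrite (big_setID small) /= (setIidPr sL) [X in _ <= _ + X](big_setID clustered) /=.
  have -> : (low :\: small) :&: clustered = clustered.
    by apply/setIidPr/subsetP => x; rewrite in_set => /andP[].
  have h1 : (rq - 1) * #|clustered|%:R <=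
      \sum_(x in clustered) \sum_(v in high) charge v x.
    rewrite mulrC mulr_natl -sumr_const; apply: ler_sum => x.
    by rewrite in_set in_setD => /andP[/andP[xS xL] x0]; apply: charge_clq.
  have h2 : (rq - 2) * #|(low :\: small) :\: clustered|%:R <=
      \sum_(x in (low :\: small) :\: clustered) \sum_(v in high) charge v x.
    rewrite mulrC mulr_natl -sumr_const; apply: ler_sum => x.
    rewrite in_setD => /andP[xC xLS]; move: (xLS); rewrite in_setD => /andP[xS xL].
    by apply: charge_unclq => //; apply/eqP; move: xC; rewrite in_set xLS negbK.
  have h3 : (eb e small high)%:R = \sum_(x in small) \sum_(v in high) charge v x.
    by rewrite eb_sum natr_sum; apply: eq_bigr => x xS; rewrite charge_small.
  have h4 : (eb e small low + eb e small mid + eb e small high = #|small| * r)%N.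
    have -> : (#|small| * r = eb e small setT)%N.
      rewrite -sum_nat_const eb_sum; apply: eq_bigr => x /small_low.
      by rewrite inE setIT => /eqP->.
    rewrite (eb_splitr e low small setT) setTI -addnA; congr (_ + _)%N.
    rewrite (eb_splitr e mid small (_ :\: _)); congr (_ + _)%N; congr eb; apply/setP => v; rewrite !inE;
      have := deg_ge G v; clear; lia.
  have sP : paired \subset small by apply/subsetP => x; rewrite in_set => /andP[].
  have h5 : (eb e small low <= #|clustered| + #|paired|)%N.
    rewrite (eb_splitl e paired) (setIidPr sP) addnC.
    exact: leq_add single_low_edges paired_low_edges.
  have h6 := small_mid_edges G.
  have h7 : (#|paired| + #|single| = #|small|)%N by rewrite -(cardsID paired small) (setIidPr sP).
  have h8 : (#|small| + (#|clustered| + #|(low :\: small) :\: clustered|) = #|low|)%N.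
    rewrite -(cardsID small low) (setIidPr sL); congr (_ + _)%N.
    rewrite -[RHS](cardsID clustered); congr (_ + _)%N; congr #|pred_of_set _|; symmetry.
    by apply/setIidPr/subsetP => x; rewrite in_set => /andP[].
  have h9 : (#|small| * r <= #|clustered| + #|paired| +
      (2 * #|single| + #|paired| + 2 * #|mid|) + eb e small high)%N.
    by rewrite -h4; move: h5 h6; clear; lia.
  rewrite -(ler_nat rat) !(natrD, natrM) h3 in h9.
  rewrite -h8 -h7 !natrD; rewrite -h7 natrD in h9.
  move: h1 h2 h9.
  set s1 := \sum_(x in small) _; set s2 := \sum_(x in clustered) _.
  set s3 := \sum_(x in _) _; set a := #|clustered|%:R; set b := #|_|%:R.
  set c := #|single|%:R; set d := #|paired|%:R; set m := #|mid|%:R.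
  move=> h1 h2 h9; clear -h1 h2 h9; nra.
pose s v : int := r%:Z * #|nb e v|%:Z - (r%:Z * r%:Z + r%:Z - 2).
have tot : \sum_(v in [set: T]) s v = - rho r e setT.
  rewrite sumrB sumr_const -mulr_sumr -mulr_natr /rho eb_sum.
  rewrite (eq_bigr (fun v => #|nb e v|%:Z)) //.
  rewrite (_ : \sum_(x in [set: T]) #|nb e x :&: [set: T]| = \sum_(x in [set: T]) #|nb e x|)%N.
    by rewrite -(big_morph Posz PoszD (erefl 0%:Z)); lia.
  by apply: eq_bigr => x _; rewrite setIT.
have sum_low : \sum_(v in low) s v = - (r%:Z - 2) * #|low|%:Z.
  rewrite (eq_bigr (fun=> - (r%:Z - 2))); first by rewrite sumr_const -[LHS]mulr_natr; congr (_ * _); rewrite natz.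
  by move=> v; rewrite /s inE => /eqP->; lia.
have sum_mid : \sum_(v in mid) s v = 2 * #|mid|%:Z.
  rewrite (eq_bigr (fun=> 2)); first by rewrite sumr_const -[LHS]mulr_natr; congr (_ * _); rewrite natz.
  by move=> v; rewrite /s inE => /eqP->; lia.
have sum_high : (r%:Z - 2) * #|low|%:Z - 2 * #|mid|%:Z <= \sum_(v in high) s v.
  rewrite -(ler_int rat) rmorph_sum /=.
  rewrite (eq_bigr (fun v => rq * (#|nb e v|%:R - rq - 1) + 2)); last first.
    by move=> v _; rewrite /s !(rmorphB, rmorphD, rmorphM) /=; ring.
  by apply: le_trans main; rewrite !(rmorphB, rmorphD, rmorphM) /=.
have sets : \sum_(v in [set: T]) s v =
    \sum_(v in low) s v + \sum_(v in mid) s v + \sum_(v in high) s v.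
  rewrite (big_setID low) /= setTI -addrA [X in _ + X = _](big_setID mid) /=; congr (_ + (_ + _));
    apply: eq_bigl => v; rewrite !inE; have := deg_ge G v; clear; lia.
have := kc_big G; have : 3%:Z * r%:Z <= r%:Z * r%:Z by apply: ler_wpM2r; lia.
move: sum_high tot; rewrite sets sum_low sum_mid /ky_bound.
move: (\sum_(v in high) s v) (rho r e setT) r3 => X Y; clear.
move: #|low| #|mid| => a b; lia.
Qed.

End Discharging.

Definition ky_measure (T : finType) (e : rel T) : nat :=
  eb e setT setT * (#|T| * #|T|).+1 + (#|T| * #|T| - eb (twin_rel e) setT setT).

Lemma eb_le_mul (T : finType) (e : rel T) (A B : {set T}) : (eb e A B <= #|A| * #|B|)%N.
Proof.
rewrite eb_sum -sum_nat_const; apply: leq_sum => x _; exact/subset_leq_card/subsetIr.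
Qed.

Theorem kostochka_yancey (r : nat) (T : finType) (e : rel T) : (3 <= r)%N -> ky_holds r e.
Proof.
move=> r3; have [n] := ubnP #|T|; elim: n => // n IHn in T e *; rewrite ltnS => Tn.
have [m] := ubnP (ky_measure e); elim: m => // m IHm in e *; rewrite ltnS => em.
move=> sym_e irr_e crit_e; rewrite leNgt; apply/negP => big_e.
apply: (@no_ky_counter r T e); split=> // [T' e' lt|e' tie].
  by apply: IHn; apply: leq_trans lt Tn.
apply: IHm; apply: leq_trans em; rewrite /ky_measure.
have := eb_le_mul (twin_rel e') setT setT; rewrite cardsT.
set N := (_ * _)%N; set a' := eb (twin_rel e') _ _.
set a := eb (twin_rel e) _ _ in tie *.
set b' := eb e' _ _ in tie *; set b := eb e _ _ in tie *.
case: tie => [lt|[-> lt]] le; last first.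
  by move: lt le; clear; lia.
have : (b'.+1 * N.+1 <= b * N.+1)%N by rewrite leq_mul2r lt orbT.
rewrite mulSn; move: le; clear; lia.
Qed.

(** * Sparse critical graphs *)

Local Open Scope nat_scope.

Lemma vcrit_vertex (r : nat) (T : finType) (e : rel T) :
  ~~ colorable_on r e setT -> (forall z, colorable_on r e [set~ z]) -> vcrit r e setT.
Proof.
move=> nT Hz; apply/vcritP; split=> // S /properP[_ [z _ zS]].
apply: colorable_onS (Hz z); apply/subsetP => x xS; rewrite !inE.
by apply: contraNneq zS => <-.
Qed.

Lemma ebTE (T : finType) (e : rel T) : eb e setT setT = \sum_x \sum_y e x y.
Proof.
rewrite /eb; apply: eq_big => [x|x _]; first by rewrite inE.
by apply: eq_bigl => y; rewrite inE.
Qed.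

Definition vertex_critical_size (r n m : nat) : Prop :=
  exists (T : finType) (e : rel T),
    [/\ symmetric e, irreflexive e, vcrit r e setT, #|T| = n & eb e setT setT <= 2 * m].

Definition del_edge (T : finType) (e : rel T) (a b : T) : rel T :=
  fun x y => e x y && ([set x; y] != [set a; b]).

Definition edge_critical_size (r n m : nat) : Prop :=
  exists (T : finType) (e : rel T),
    [/\ symmetric e, irreflexive e, vcrit r e setT, #|T| = n /\ eb e setT setT <= 2 * m &
        forall a b, e a b -> colorable_on r (del_edge e a b) setT].

Lemma del_edge_sym (T : finType) (e : rel T) a b : symmetric e -> symmetric (del_edge e a b).
Proof. by move=> sym_e x y; rewrite /del_edge sym_e setUC. Qed.

Lemma edge_critical (r n m : nat) : vertex_critical_size r n m -> edge_critical_size r n m.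
Proof.
case=> T [e [+ + + Tn em]].
have [k] := ubnP (eb e setT setT); elim: k => // k IH in e em *; rewrite ltnS => ek.
move=> sym_e irr_e cr; have [/forallP h|] := boolP [forall a, forall b,
    e a b ==> colorable_on r (del_edge e a b) setT].
  by exists T, e; split=> // a b eab; have /forallP/(_ b)/implyP := h a; exact.
rewrite negb_forall => /existsP[a]; rewrite negb_forall => /existsP[b].
rewrite negb_imply => /andP[eab nc].
have sub (x y : T) : del_edge e a b x y <= e x y by rewrite /del_edge; case: (e x y); case: (_ != _).
have lt : eb (del_edge e a b) setT setT < eb e setT setT.
  rewrite !ebTE (bigD1 a) //= [ltnRHS](bigD1 a) //= -addSn; apply: leq_add; last first.
    by apply: leq_sum => x _; apply: leq_sum.
  rewrite (bigD1 b) //= [ltnRHS](bigD1 b) //= -addSn; apply: leq_add; last by apply: leq_sum.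
  by rewrite /del_edge eqxx andbF eab.
apply: (IH (del_edge e a b)).
- exact: leq_trans (ltnW lt) em.
- exact: leq_trans lt ek.
- exact: del_edge_sym.
- by move=> x; rewrite /del_edge irr_e.
apply/vcritP; split=> // S SP; have /vcritP[_ /(_ S SP)/colorable_onP[c Hc]] := cr.
by apply/colorable_onP; exists c => x y xS yS /andP[exy _]; apply: Hc.
Qed.

Lemma sum_neq_ord q : \sum_(i < q) \sum_(j < q) (i != j) = q * q.-1.
Proof.
rewrite (eq_bigr (fun=> q.-1)) ?sum_nat_const ?card_ord // => i _.
have := cardsC1 i; rewrite card_ord => <-; rewrite -sum1_card [RHS]big_mkcond.
by apply: eq_bigr => j _; rewrite !inE eq_sym; case: (_ == _).
Qed.

Lemma complete_critical r : 0 < r -> vertex_critical_size r r.+1 ((r.+1 * r) %/ 2).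
Proof.
move=> r0.
exists 'I_r.+1, (fun i j => i != j); split.
- by move=> i j; rewrite eq_sym.
- by move=> i; rewrite eqxx.
- apply: vcrit_vertex.
    apply/negP => /colorable_onP[c Hc]; have : injective c.
      by move=> x y cxy; apply/eqP/negPn/negP => /(Hc x y (in_setT _) (in_setT _)).
    by move/leq_card; rewrite !card_ord ltnn.
  move=> z; apply/colorable_onP; case: r r0 z => // r _ z.
  exists (fun x => odflt ord0 (unlift z x)) => x y; rewrite !inE.
  case: unliftP => [i ->|->]; rewrite ?eqxx // => _.
  case: unliftP => [j ->|->]; rewrite ?eqxx //= => _.
  by rewrite (inj_eq lift_inj) => /eqP.
- by rewrite card_ord.
- rewrite ebTE sum_neq_ord /= [leqRHS]mulnC.
  by rewrite divnK // dvdn2 oddM /=; case: (odd r).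
Qed.

Section Cone.
Variables (T : finType) (e : rel T).

Definition cone : rel (T + 'I_1) := fun x y =>
  match x, y with
  | inl u, inl v => e u v
  | inr _, inr _ => false
  | _, _ => true
  end.

End Cone.

Lemma cone_critical r n m : 0 < n -> vertex_critical_size r n m ->
  vertex_critical_size r.+1 n.+1 (m + n).
Proof.
move=> n0 [T [e [sym_e irr_e cr Tn em]]]; exists (T + 'I_1)%type, (cone e).
have /vcritP[nc Hp] := cr; split.
- by move=> [x|i] [y|j] //=.
- by move=> [x|i] //=.
- apply: vcrit_vertex.
    apply: contra nc => /colorable_onP[c Hc]; apply/colorable_onP.
    have r0 : 0 < r.
      have /card_gt0P[x _] : 0 < #|T| by rewrite Tn.
      have := Hc (inl x) (inr ord0) (in_setT _) (in_setT _) isT.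
      case: (r) c {Hc} => // c; by rewrite (ord1 (c (inl x))) (ord1 (c (inr ord0))).
    pose a := c (inr ord0).
    exists (fun x => odflt (Ordinal r0) (unlift a (c (inl x)))) => x y _ _ exy.
    have := Hc (inl x) (inr ord0) (in_setT _) (in_setT _) isT; rewrite -/a.
    have := Hc (inl y) (inr ord0) (in_setT _) (in_setT _) isT; rewrite -/a.
    have := Hc (inl x) (inl y) (in_setT _) (in_setT _) exy.
    case: unliftP => [i ->|->//]; case: unliftP => [j ->|->//] /=.
    by move=> h _ _ ij; apply: h; rewrite ij.
  move=> [x|i].
    have /Hp/colorable_onP[c Hc] : [set~ x] \proper setT by rewrite properT; apply/eqP => E; have := in_setT x; rewrite -E !inE eqxx.
    apply/colorable_onP; exists (fun z => if z is inl y then lift ord_max (c y) else ord_max).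
    move=> [y|j] [z|k] //=; rewrite !inE //= => yx zx.
    + by move=> eyz /lift_inj; apply: Hc; rewrite ?inE.
    + by move=> _ /esym/eqP; rewrite (negPf (neq_lift _ _)).
    + by move=> _ /eqP; rewrite (negPf (neq_lift _ _)).
  have /card_gt0P[x _] : 0 < #|T| by rewrite Tn.
  have /Hp/colorable_onP[c Hc] : [set~ x] \proper setT by rewrite properT; apply/eqP => E; have := in_setT x; rewrite -E !inE eqxx.
  apply/colorable_onP; exists (fun z => if z is inl y then (if y == x then ord_max else lift ord_max (c y)) else ord_max).
  move=> [y|j] [z|k] //=; rewrite !inE ?(ord1 i) ?(ord1 j) ?(ord1 k) ?eqxx // => _ _ eyz.
  case: eqP => [yx|/eqP yx]; case: eqP => [zx|/eqP zx].
  + by move: eyz; rewrite yx zx irr_e.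
  + by move=> /eqP; rewrite (negPf (neq_lift _ _)).
  + by move=> /esym/eqP; rewrite (negPf (neq_lift _ _)).
  + by move/lift_inj; apply: Hc; rewrite ?inE.
- by rewrite card_sum card_ord Tn addn1.
- rewrite ebTE big_sumType /= big_ord1 big_sumType big_ord1 /= addn0.
  under eq_bigr => x _ do rewrite big_sumType big_ord1 /=.
  rewrite big_split /= -ebTE !sum_nat_const !muln1.
  have -> : #|(predT : pred T)| = n by rewrite -Tn; apply: eq_card.
  by lia.
Qed.

Lemma set2_eqE (T : finType) (a b x y : T) : a != b ->
  ([set x; y] == [set a; b]) = (x == a) && (y == b) || (x == b) && (y == a).
Proof.
move=> ab; apply/eqP/orP => [E|[]/andP[/eqP-> /eqP->] //]; last by rewrite setUC.
have : x \in [set a; b] by rewrite -E !inE eqxx.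
have : y \in [set a; b] by rewrite -E !inE eqxx orbT.
have : a \in [set x; y] by rewrite E !inE eqxx.
have : b \in [set x; y] by rewrite E !inE eqxx orbT.
rewrite !inE ![a == _]eq_sym ![b == _]eq_sym.
have [->|xa] := eqVneq x a; have [->|ya] := eqVneq y a; rewrite ?eqxx ?(negPf ab) /=; auto.
Qed.

Lemma sum_set2 (T : finType) (a b : T) : a != b ->
  \sum_x \sum_y ([set x; y] == [set a; b]) = 2.
Proof.
move=> ab; have one (c : T) : \sum_x (x == c : nat) = 1.
  by rewrite (bigD1 c) //= eqxx big1 // => x /negPf->.
rewrite (eq_bigr (fun x => (x == a) + (x == b))); first by rewrite big_split /= !one.
move=> x _; rewrite (eq_bigr (fun y => (x == a) * (y == b) + (x == b) * (y == a))).
  by rewrite big_split /= -!big_distrr /= !one !muln1.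
move=> y _; rewrite set2_eqE //; have [->|xa] := eqVneq x a; first by rewrite (negPf ab); case: (y == b).
by case: (x == b); case: (y == a).
Qed.

Section Hajos.
Variables (q : nat) (T : finType) (e : rel T) (a b : T).

(* The Hajos join of [e] along [ab] and a complete graph on [q + 2] vertices: the vertex [a], the
   clique ['I_q] and a last vertex, which is joined to [b]. *)
Definition hajos : rel (T + ('I_q + 'I_1)) := fun x y =>
  match x, y with
  | inl u, inl v => del_edge e a b u v
  | inl u, inr (inl _) | inr (inl _), inl u => u == a
  | inl u, inr (inr _) | inr (inr _), inl u => u == b
  | inr (inl i), inr (inl j) => i != j
  | inr (inr _), inr (inr _) => false
  | _, _ => true
  end.

Hypotheses (sym_e : symmetric e) (irr_e : irreflexive e) (eab : e a b) (q0 : 0 < q).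

Lemma hajos_sym : symmetric hajos.
Proof. by move=> [x|[i|i]] [y|[j|j]] //=; [exact: del_edge_sym | rewrite eq_sym]. Qed.

Lemma hajos_irr : irreflexive hajos.
Proof. by move=> [x|[i|i]] //=; rewrite ?eqxx // /del_edge irr_e. Qed.

Lemma hajos_ncol : ~~ colorable_on q.+1 e setT -> ~~ colorable_on q.+1 hajos setT.
Proof.
apply: contra => /colorable_onP[c Hc]; apply/colorable_onP.
have {}Hc x y : hajos x y -> c x <> c y by apply: Hc.
have last_a : c (inr (inr ord0)) = c (inl a).
  apply/eqP/negPn/negP => ne.
  pose g (i : 'I_q) := c (inr (inl i)).
  have ginj : injective g.
    by move=> i j gij; apply/eqP/negPn/negP => ij; apply: (Hc (inr (inl i)) (inr (inl j))).
  have : #|c (inr (inr ord0)) |: (c (inl a) |: g @: setT)| <= #|'I_q.+1| by exact: max_card.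
  rewrite !cardsU1 card_imset // cardsT !card_ord !inE (negPf ne) /=.
  have -> : (c (inl a) \in g @: setT) = false.
    by apply/imsetP => -[i _ gi]; apply: (Hc (inl a) (inr (inl i))); rewrite //= ?eqxx.
  have -> : (c (inr (inr ord0)) \in g @: setT) = false.
    by apply/imsetP => -[i _ gi]; apply: (Hc (inr (inr ord0)) (inr (inl i))).
  by rewrite /=; lia.
have cb : c (inl a) <> c (inl b).
  by rewrite -last_a; apply: Hc; rewrite /= eqxx.
exists (c \o inl) => x y _ _ exy /=.
have [E|ne] := eqVneq [set x; y] [set a; b]; last by apply: Hc; rewrite /= /del_edge exy.
have xs : x \in [set a; b] by rewrite -E !inE eqxx.
have ys : y \in [set a; b] by rewrite -E !inE eqxx orbT.
move: xs ys; rewrite !inE => /orP[]/eqP xE /orP[]/eqP yE; move: exy; rewrite xE yE ?irr_e // => _.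
by apply/nesym.
Qed.

Lemma hajos_extend (S : {set T + ('I_q + 'I_1)}) (c : T -> 'I_q.+1) (g : 'I_q.+1) :
  (forall x y, inl x \in S -> inl y \in S -> del_edge e a b x y -> c x <> c y) ->
  (inl a \in S -> forall i, inr (inl i) \in S -> c a <> lift g i) ->
  (inl b \in S -> inr (inr ord0) \in S -> c b <> g) ->
  colorable_on q.+1 hajos S.
Proof.
move=> Hc Ha Hb; apply/colorable_onP; exists (fun z => match z with
  | inl x => c x | inr (inl i) => lift g i | inr (inr _) => g end).
move=> [x|[i|i]] [y|[j|j]] //= xS yS.
- exact: Hc.
- by move/eqP => xa; subst x; apply: Ha.
- by rewrite (ord1 j) in yS; move/eqP => xb; subst x; apply: Hb.
- by move/eqP => ya; subst y; apply/nesym/Ha.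
- by move=> ij /lift_inj E; rewrite E eqxx in ij.
- by move=> _ /esym/eqP; rewrite (negPf (neq_lift _ _)).
- by rewrite (ord1 i) in xS; move/eqP => yb; subst y; apply/nesym/Hb.
- by move=> _ /eqP; rewrite (negPf (neq_lift _ _)).
Qed.

Lemma hajos_crit : vcrit q.+1 e setT -> colorable_on q.+1 (del_edge e a b) setT ->
  vcrit q.+1 hajos setT.
Proof.
move=> /vcritP[nc Hp] /colorable_onP[d Hd]; apply: vcrit_vertex; first exact: hajos_ncol.
have neqS (x : T) : [set~ x] \proper setT.
  by rewrite properT; apply/eqP => E; have := in_setT x; rewrite -E !inE eqxx.
have dab : d a = d b.
  apply/eqP/negPn/negP => ne; case/negP: nc; apply/colorable_onP; exists d => x y _ _ exy.
  have [E|nE] := eqVneq [set x; y] [set a; b]; last by apply: Hd; rewrite // /del_edge exy.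
  have xs : x \in [set a; b] by rewrite -E !inE eqxx.
  have ys : y \in [set a; b] by rewrite -E !inE eqxx orbT.
  move: xs ys; rewrite !inE => /orP[]/eqP xE /orP[]/eqP yE; move: exy; rewrite xE yE ?irr_e // => _.
    by apply/eqP.
  by apply/nesym/eqP.
have liftN (g : 'I_q.+1) i : g <> lift g i by move=> /eqP; rewrite (negPf (neq_lift _ _)).
have ab : a != b by apply: contraTneq eab => ->; rewrite irr_e.
move=> [z|[i|i]].
- have /colorable_onP[c Hc] := Hp _ (neqS z).
  have Hc' x y : inl x \in [set~ inl z : T + ('I_q + 'I_1)] -> inl y \in [set~ inl z : T + ('I_q + 'I_1)] ->
      del_edge e a b x y -> c x <> c y.
    by rewrite !inE => xz yz /andP[exy _]; apply: Hc; rewrite ?inE.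
  have [za|za] := eqVneq z a.
    apply: (@hajos_extend _ c (lift (c b) (Ordinal q0)) Hc'); first by rewrite !inE za eqxx.
    by move=> _ _; exact: liftN.
  apply: (@hajos_extend _ c (c a) Hc') => [_ i _|bS _]; first exact: liftN.
  have bz : b != z by move: bS; rewrite !inE.
  by apply/nesym; apply: Hc; rewrite ?inE // eq_sym.
- apply/colorable_onP; exists (fun z => match z with
    | inl x => d x | inr (inl j) => lift (d a) j | inr (inr _) => lift (d a) i end).
  move=> [x|[k|k]] [y|[j|j]] //=; rewrite !inE.
  + by move=> _ _; apply: Hd.
  + by move=> _ _ /eqP->; exact: liftN.
  + by move=> _ _ /eqP->; rewrite -dab; exact: liftN.
  + by move=> _ _ /eqP->; apply/nesym; exact: liftN.
  + by move=> _ _ kj /lift_inj E; rewrite E eqxx in kj.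
  + by move=> ki _ _ /lift_inj E; rewrite E eqxx in ki.
  + by move=> _ _ /eqP->; rewrite -dab; apply/nesym; exact: liftN.
  + by move=> _ ji _ /lift_inj E; rewrite E eqxx in ji.
- apply: (@hajos_extend _ d (d a)).
  + by move=> x y _ _; apply: Hd.
  + by move=> _ j _; exact: liftN.
  + by move=> _; rewrite !inE (ord1 i) eqxx.
Qed.

Lemma hajos_eb : eb hajos setT setT = eb e setT setT + q * (q + 3).
Proof.
have E1 : eb (del_edge e a b) setT setT + 2 = eb e setT setT.
  rewrite !ebTE; have ab : a != b by apply: contraTneq eab => ->; rewrite irr_e.
  rewrite -(sum_set2 ab) -big_split; apply: eq_bigr => x _.
  rewrite -big_split; apply: eq_bigr => y _ /=; rewrite /del_edge set2_eqE //.
  have [xy|] := boolP (_ || _); last by rewrite andbT addn0.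
  by case/orP: xy => /andP[/eqP-> /eqP->]; rewrite ?eab // sym_e eab.
have one (c : T) : \sum_x (x == c : nat) = 1.
  by rewrite (bigD1 c) //= eqxx big1 // => x /negPf->.
rewrite -E1 ebTE big_sumType /=.
under eq_bigr => x _ do rewrite !big_sumType /= big_ord1 sum_nat_const card_ord.
rewrite !big_split /= -ebTE -big_distrr /= !one.
rewrite big_sumType /= big_ord1 !big_sumType /= big_ord1 one !sum_nat_const !card_ord.
under eq_bigr => i _ do rewrite !big_sumType /= big_ord1 one.
rewrite !big_split /= sum_neq_ord !sum_nat_const !card_ord.
by case: (q) => [|q'] /=; lia.
Qed.

End Hajos.

Lemma hajos_critical r n m : 2 <= r -> 2 <= n -> vertex_critical_size r n m ->
  vertex_critical_size r (n + r) (m + (r.-1 * (r + 2)) %/ 2).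
Proof.
move=> r2 n2 /edge_critical[T [e [sym_e irr_e cr [Tn em] ecr]]].
case: r r2 => // q q1 in cr ecr *.
have [a [b eab]] : exists a b, e a b.
  have /card_gt0P[a _] : 0 < #|T| by rewrite Tn; lia.
  have := vcrit_deg sym_e irr_e cr (in_setT a); rewrite setIT => da.
  have /card_gt0P[b] : 0 < #|nb e a| by lia.
  by rewrite in_nb => eab; exists a, b.
exists (T + ('I_q + 'I_1))%type, (hajos e a b); split.
- exact: hajos_sym.
- exact: hajos_irr.
- by apply: hajos_crit => //; exact: ecr.
- by rewrite !card_sum !card_ord Tn; lia.
- rewrite hajos_eb // [leqRHS]mulnDr; apply: leq_add => //=.
  rewrite [leqRHS]mulnC divnK; first by rewrite addSnnS.
  by rewrite dvdn2 oddM !oddD /=; case: (odd q).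
Qed.

Section TripleJoin.
Variable q : nat.
Hypothesis q2 : 2 <= q.
Notation vertex := (('I_q + 'I_3) + 'I_q.+1)%type.

(* A [q]-clique is joined to three independent vertices, which are therefore coloured alike in every
   colouring with [q + 1] colours; each vertex of a [q + 1]-clique sees one of the three. *)
Definition triple_join : rel vertex := fun x y =>
  match x, y with
  | inl (inl i), inl (inl j) => i != j
  | inl (inl _), inl (inr _) | inl (inr _), inl (inl _) => true
  | inl (inr s), inr i | inr i, inl (inr s) => val s == minn i 2
  | inr i, inr j => i != j
  | _, _ => false
  end.

Lemma triple_join_sym : symmetric triple_join.
Proof. by move=> [[i|s]|i] [[j|u]|j] //=; rewrite eq_sym. Qed.

Lemma triple_join_irr : irreflexive triple_join.
Proof. by move=> [[i|s]|i] //=; rewrite eqxx. Qed.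

Definition spoke (i : 'I_q.+1) : 'I_3 := inord (minn i 2).

Lemma spokeE i : val (spoke i) = minn i 2.
Proof. by rewrite /= inordK // ltnS geq_minr. Qed.

Lemma triple_join_ncol : ~~ colorable_on q.+1 triple_join setT.
Proof.
apply/negP => /colorable_onP[c Hc].
have {}Hc x y : triple_join x y -> c x <> c y by apply: Hc.
pose g (i : 'I_q) := c (inl (inl i)).
have ginj : injective g.
  by move=> i j gij; apply/eqP/negPn/negP => ij; apply: (Hc (inl (inl i)) (inl (inl j))).
have sN s : c (inl (inr s)) \notin g @: setT.
  by apply/imsetP => -[i _ gi]; apply: (Hc (inl (inr s)) (inl (inl i))).
have sE s u : c (inl (inr s)) = c (inl (inr u)).
  apply/eqP/negPn/negP => ne.
  have : #|c (inl (inr s)) |: (c (inl (inr u)) |: g @: setT)| <= #|'I_q.+1| by exact: max_card.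
  by rewrite !cardsU1 card_imset // cardsT !card_ord !inE (negPf ne) /= (negPf (sN s)) (negPf (sN u)) ltnn.
pose h (i : 'I_q.+1) := c (inr i).
have hinj : injective h.
  by move=> i j hij; apply/eqP/negPn/negP => ij; apply: (Hc (inr i) (inr j)).
have [h' h'K h'K'] := injF_bij hinj.
pose i := h' (c (inl (inr ord0))).
apply: (Hc (inl (inr (spoke i))) (inr i)); first by rewrite [triple_join _ _]/= -/(val (spoke i)) spokeE.
rewrite (sE (spoke i) ord0); exact: esym (h'K' _).
Qed.

Lemma triple_join_extend (S : {set vertex}) (cM : 'I_q -> 'I_q.+1) cS cQ :
  (forall i j, inl (inl i) \in S -> inl (inl j) \in S -> i != j -> cM i <> cM j) ->
  (forall i s, inl (inl i) \in S -> inl (inr s) \in S -> cM i <> cS s) ->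
  injective cQ ->
  (forall i, inl (inr (spoke i)) \in S -> inr i \in S -> cS (spoke i) <> cQ i) ->
  colorable_on q.+1 triple_join S.
Proof.
move=> HM HS HQ HSQ; apply/colorable_onP; exists (fun z => match z with
  | inl (inl i) => cM i | inl (inr s) => cS s | inr i => cQ i end).
have E (s : 'I_3) (i : 'I_q.+1) : val s == minn i 2 -> s = spoke i.
  by move=> /eqP E; apply: val_inj; rewrite spokeE.
move=> [[i|s]|i] [[j|u]|j] //= xS yS.
- exact: HM.
- by move=> _; apply: HS.
- by move=> _; apply/nesym; apply: HS.
- by move=> /E Es; subst s; apply: HSQ.
- by move=> /E Es; subst u; apply/nesym; apply: HSQ.
- by move=> ij /HQ E'; rewrite E' eqxx in ij.
Qed.

Lemma triple_join_crit : vcrit q.+1 triple_join setT.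
Proof.
apply: vcrit_vertex; first exact: triple_join_ncol.
have liftN (g : 'I_q.+1) i : lift g i <> g by move=> /esym/eqP; rewrite (negPf (neq_lift _ _)).
have liftI (g : 'I_q.+1) (i j : 'I_q) : i != j -> lift g i <> lift g j.
  by move=> ij /lift_inj E; rewrite E eqxx in ij.
pose o (i : nat) (Hi : i < 3) : 'I_q.+1 := Ordinal (leq_trans Hi (q2 : 2 < q.+1)).
pose o1 := o 1 isT.
have spo (s : 'I_3) : exists i, spoke i = s.
  exists (o s (ltn_ord s)); apply: val_inj; rewrite spokeE /=; have := ltn_ord s; lia.
move=> [[m|s]|i].
- pose d : 'I_q.+1 := lift ord0 m.
  have d0 : d != ord0 by rewrite eq_sym neq_lift.
  pose p : {perm 'I_q.+1} := (tperm ord0 o1 * tperm o1 d)%g.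
  have p0 : p ord0 = d by rewrite permM tpermL tpermL.
  have p1 : p o1 = ord0 by rewrite permM tpermR tpermD // eq_sym.
  apply: (@triple_join_extend _ (lift ord0) (fun s => if s == ord0 then ord0 else d) p).
  + by move=> i j _ _; exact: liftI.
  + move=> i s; rewrite !inE => im _; case: eqP => _; first exact: liftN.
    by apply: liftI; apply: contraNneq im => ->.
  + exact: perm_inj.
  + move=> i _ _; case: eqP => [si|si].
      move=> Ei; have : i = ord0.
        apply: val_inj; have := congr1 val si; rewrite spokeE /=; lia.
      by move=> i0; move: Ei; rewrite i0 p0 => /esym/eqP; rewrite (negPf d0).
    rewrite -p0 => /perm_inj Ei; apply: si; apply: val_inj; rewrite spokeE -Ei //.
- have [i0 Ei0] := spo s.
  apply: (@triple_join_extend _ (lift ord0) (fun=> ord0) (tperm i0 ord0)).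
  + by move=> i j _ _; exact: liftI.
  + by move=> i u _ _; exact: liftN.
  + exact: perm_inj.
  + move=> i iS _ E; have : i = i0.
      by apply: (@perm_inj _ (tperm i0 ord0)); rewrite tpermL -E.
    by move=> Ei; move: iS; rewrite Ei Ei0 !inE eqxx.
- apply: (@triple_join_extend _ (lift ord0) (fun=> ord0) (tperm i ord0)).
  + by move=> j l _ _; exact: liftI.
  + by move=> j u _ _; exact: liftN.
  + exact: perm_inj.
  + move=> j _ jS E; have : j = i.
      by apply: (@perm_inj _ (tperm i ord0)); rewrite tpermL -E.
    by move=> Ej; move: jS; rewrite Ej !inE eqxx.
Qed.

Lemma triple_join_eb : eb triple_join setT setT = 2 * (q * q + 4 * q + 1).
Proof.
have onespoke : \sum_(i < q.+1) \sum_(s < 3) (val s == minn i 2) = q.+1.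
  rewrite (eq_bigr (fun=> 1)) ?sum_nat_const ?card_ord ?muln1 // => i _.
  rewrite (bigD1 (spoke i)) //= -/(val (spoke i)) spokeE eqxx big1 // => s.
  move=> si; apply/eqP; rewrite eqb0; apply: contra si => /eqP E.
  by apply/eqP/val_inj; rewrite spokeE.
have onespoke' : \sum_(s < 3) \sum_(i < q.+1) (val s == minn i 2) = q.+1.
  by rewrite exchange_big.
rewrite ebTE !big_sumType /=.
under eq_bigr => i _ do rewrite !big_sumType /= ?big1_eq ?sum_nat_const ?card_ord.
under [X in _ + X + _]eq_bigr => i _ do rewrite !big_sumType /= ?big1_eq ?sum_nat_const ?card_ord.
under [X in _ + X]eq_bigr => i _ do rewrite !big_sumType /= ?big1_eq ?sum_nat_const ?card_ord.
rewrite !big_split /= !sum_neq_ord !big1_eq ?sum_nat_const !card_ord onespoke onespoke'.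
by case: (q) q2 => // q' _ /=; lia.
Qed.

End TripleJoin.

Lemma triple_join_critical r : 3 <= r ->
  vertex_critical_size r (2 * r.+1) (r.+1 * r.+1 - 3).
Proof.
case: r => // q q2; exists (('I_q + 'I_3) + 'I_q.+1)%type, (@triple_join q); split.
- exact: triple_join_sym.
- exact: triple_join_irr.
- exact: triple_join_crit.
- by rewrite !card_sum !card_ord; lia.
- by rewrite triple_join_eb; lia.
Qed.

Lemma cones_critical j r n m : 0 < n -> vertex_critical_size r n m ->
  vertex_critical_size (r + j) (n + j) (m + (n * j + (j * j.-1) %/ 2)).
Proof.
move=> n0 cr; elim: j => [|j IH]; first by rewrite mul0n div0n muln0 !addn0.
have := cone_critical (ltn_addr j n0) IH; rewrite !addnS; congr vertex_critical_size.
have E : (j.+1 * j.+1.-1) %/ 2 = (j * j.-1) %/ 2 + j.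
  rewrite /= -[X in _ + X](@mulnK j 2) // -divnDr ?dvdn_mull //; congr (_ %/ _).
  by case: (j) => // j'; rewrite /=; lia.
by rewrite E; lia.
Qed.

Lemma short_range_critical r p : 2 <= p -> p <= r ->
  exists2 m, vertex_critical_size r (r.+1 + p) m &
    2 * m + 2 = (r.+1 + p) * r + p * (r.+1 - p).
Proof.
move=> p2 pr; have p0 : 0 < p by lia.
have := hajos_critical p2 _ (complete_critical p0) => /(_ ltac:(lia)) h.
have := @cones_critical (r - p) _ _ _ _ h => /(_ ltac:(lia)).
rewrite subnKC //; set m := (X in vertex_critical_size _ _ X) => cr.
exists m; first by move: cr; congr vertex_critical_size; lia.
have e1 : 2 * ((p.+1 * p) %/ 2) = p.+1 * p.
  by rewrite mulnC divnK // dvdn2 oddM /=; case: (odd p).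
have e2 : 2 * ((p.-1 * (p + 2)) %/ 2) = p.-1 * (p + 2).
  rewrite mulnC divnK // dvdn2; case: (p) p0 => // p' _.
  by rewrite /= oddM !oddD /=; case: (odd p').
have e3 : 2 * (((r - p) * (r - p).-1) %/ 2) = (r - p) * (r - p).-1.
  rewrite mulnC divnK // dvdn2; case: (r - p) => // j.
  by rewrite /= oddM /=; case: (odd j).
move: e1 e2 e3; rewrite /m; move: (_ %/ 2) (_ %/ 2) (_ %/ 2) => d1 d2 d3; clear -p2 pr.
have [j ->] : exists j, r = p + j by exists (r - p); lia.
have [u ->] : exists u, p = u.+2 by exists (p - 2); lia.
rewrite addKn /=; have -> : (u.+2 + j).+1 - u.+2 = j.+1 by lia.
by case: j => [|j] /=; lia.
Qed.

Local Open Scope ring_scope.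

Definition ky_num (r n : nat) : int :=
  (r%:Z + 2) * (r%:Z - 1) * n%:Z - (r%:Z + 1) * (r%:Z - 2).

Definition near_ky (r n m : nat) : Prop := forall F : int,
  ky_num r n <= 2 * r%:Z * F -> 8 * (m%:Z - F) <= r%:Z * (r%:Z + 1) - 8.

Lemma near_ky_scaled r n m : (0 < r)%N ->
  8 * r%:Z * m%:Z - 4 * ky_num r n <= r%:Z * (r%:Z * (r%:Z + 1) - 8) -> near_ky r n m.
Proof.
move=> r0 h F hF; have r0' : 0 < r%:Z by lia.
by rewrite -(ler_pM2l r0'); lia.
Qed.

Lemma near_ky_critical r n : (3 <= r)%N -> (r.+1 + 2 <= n)%N ->
  exists2 m, vertex_critical_size r n m & near_ky r n m.
Proof.
move=> r3; have [N] := ubnP n; elim: N => // N IH in n *; rewrite ltnS => nN nr.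
have [big|small] := ltnP (2 * r.+1) n.
  have [||m cr near] := IH (n - r)%N; [lia|lia|].
  exists (m + (r.-1 * (r + 2)) %/ 2)%N.
    have := hajos_critical _ _ cr; rewrite subnK; last by lia.
    by apply; lia.
  move=> F hF; pose g := ((r.-1 * (r + 2)) %/ 2)%N.
  have eg : (2 * g = r.-1 * (r + 2))%N.
    rewrite /g mulnC divnK // dvdn2; case: (r) r3 => // r' _.
    by rewrite /= oddM !oddD /=; case: (odd r').
  have := near (F - g%:Z); rewrite -/g PoszD => h.
  suff: 8 * (m%:Z - (F - g%:Z)) <= r%:Z * (r%:Z + 1) - 8 by lia.
  apply: h; move: hF; rewrite /ky_num.
  have -> : (n - r)%N%:Z = n%:Z - r%:Z by lia.
  have eg' : 2 * g%:Z = (r%:Z - 1) * (r%:Z + 2) by lia.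
  have -> : 2 * r%:Z * (F - g%:Z) = 2 * r%:Z * F - r%:Z * (2 * g%:Z) by lia.
  by rewrite eg'; lia.
have [En|nE] := eqVneq n (2 * r.+1)%N.
  exists (r.+1 * r.+1 - 3)%N; first by rewrite En; exact: triple_join_critical.
  apply: near_ky_scaled; first lia.
  have -> : (r.+1 * r.+1 - 3)%N%:Z = (r%:Z + 1) * (r%:Z + 1) - 3 by lia.
  rewrite /ky_num; have -> : n%:Z = 2 * r%:Z + 2 by lia.
  have : 0 <= (r%:Z - 3) * (r%:Z * r%:Z) by apply: mulr_ge0; lia.
  lia.
have [p Ep] : exists p, n = (r.+1 + p)%N by exists (n - r.+1)%N; lia.
have [||m cr Em] := @short_range_critical r p; [lia | lia |].
exists m; first by rewrite Ep.
have [r3'|r4] := leqP r 3.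
  have Er : r = 3%N by lia.
  have hp : p = 2%N \/ p = 3%N by lia.
  by move=> F; rewrite /ky_num; case: hp Em Ep => ->; rewrite Er /= => Em ->; lia.
apply: near_ky_scaled; first lia.
have Em' : 2 * m%:Z = (r%:Z + 1 + p%:Z) * r%:Z + p%:Z * (r%:Z + 1 - p%:Z) - 2.
  have := congr1 Posz Em; rewrite !PoszD !PoszM; have -> : (r.+1 - p)%N%:Z = r%:Z + 1 - p%:Z by lia.
  by lia.
have -> : 8 * r%:Z * m%:Z = 4 * r%:Z * (2 * m%:Z) by lia.
rewrite Em' Ep /ky_num.
suff : 0 <= r%:Z * ((r%:Z - 2 * p%:Z) * (r%:Z - 2 * p%:Z)) + r%:Z * r%:Z - 8 * p%:Z by lia.
have [r8|r8] := leqP 8 r.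
  have : 0 <= r%:Z * ((r%:Z - 2 * p%:Z) * (r%:Z - 2 * p%:Z)).
    by apply: mulr_ge0 => //; rewrite -expr2 sqr_ge0.
  have : 8 * r%:Z <= r%:Z * r%:Z by apply: ler_wpM2r; lia.
  lia.
have : [|| r == 4, r == 5, r == 6 | r == 7]%N by lia.
have : [|| p == 2, p == 3, p == 4, p == 5, p == 6 | p == 7]%N by lia.
clear; case/or4P => [|||/or3P[]] /eqP-> /or4P[] /eqP->; lia.
Qed.

(** * The minimum number of edges *)

Local Open Scope nat_scope.

Definition adj (T : finType) (G : graph T) : rel T := fun x y => [set x; y] \in edges G.

Section Bridge.
Variable T : finType.
Implicit Types (G H : graph T) (S : {set T}).

Lemma adj_sym G : symmetric (adj G).
Proof. by move=> x y; rewrite /adj setUC. Qed.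

Lemma adj_irr G : irreflexive (adj G).
Proof. by move=> x; apply/negP => /(@edgesP _ G)[_]; rewrite setUid cards1. Qed.

Lemma adj_vertices G x y : adj G x y -> (x \in vertices G) && (y \in vertices G).
Proof. by case/(@edgesP _ G) => /subsetP s _; rewrite !s // !inE eqxx ?orbT. Qed.

Lemma eb_adj G : eb (adj G) (vertices G) (vertices G) = 2 * #|edges G|.
Proof.
have -> : eb (adj G) (vertices G) (vertices G) = \sum_x \sum_y adj G x y.
  rewrite /eb [LHS]big_mkcond; apply: eq_bigr => x _; case: ifP => xG; last first.
    rewrite big1 // => y _; apply/eqP; rewrite eqb0; apply/negP => /adj_vertices.
    by rewrite xG.
  rewrite big_mkcond; apply: eq_bigr => y _; case: ifP => // yG.
  by case h: (adj G x y) => //; move: h => /adj_vertices; rewrite yG andbF.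
have -> : \sum_x \sum_y adj G x y = \sum_(E in edges G) \sum_x \sum_y ([set x; y] == E).
  rewrite [RHS]exchange_big; apply: eq_bigr => x _.
  rewrite [RHS]exchange_big; apply: eq_bigr => y _ /=.
  rewrite /adj; case xyG: (_ \in _); last first.
    by rewrite big1 // => E EG; case: eqP => // xyE; rewrite xyE EG in xyG.
  by rewrite (bigD1 [set x; y]) //= eqxx big1 // => E /andP[_]; rewrite eq_sym => /negPf->.
rewrite mulnC -sum_nat_const; apply: eq_bigr => E EG.
by have [_ /eqP/cards2P[a [b [ab ->]]]] := edgesP EG; exact: sum_set2.
Qed.

Lemma colorableE (r : nat) G : 0 < r ->
  colorable r G <-> colorable_on r (adj G) (vertices G).
Proof.
move=> r0; split=> [[c [cr cG]]|/colorable_onP[c Hc]].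
  apply/colorable_onP; exists (fun x => insubd (Ordinal r0) (c x)) => x y xG yG exy.
  by move/(congr1 val); rewrite !insubdK ?unfold_in ?cr //; apply: cG.
exists (fun x => val (c x)); split=> [x _|x y xyG /val_inj]; first exact: ltn_ord.
move: (xyG).
by case/(@adj_vertices G)/andP => xG yG; apply: Hc.
Qed.

Lemma induced_edgesP G S E : E \in [set E in edges G | E \subset S] ->
  E \subset S /\ #|E| = 2.
Proof. by rewrite inE => /andP[/edgesP[_ E2] ES]. Qed.

Definition induced G S : graph T := Graph (@induced_edgesP G S).

Lemma critical_vcrit (r : nat) G : 0 < r -> critical r.+1 G -> vcrit r (adj G) (vertices G).
Proof.
move=> r0 [/= nc Hp]; apply/vcritP; split; first by apply/negP => /(colorableE _ r0).
move=> S /properP[SG [z zG zS]].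
have /(colorableE _ r0) : colorable r (induced G S).
  apply: Hp; split=> //=.
    by apply/subsetP => E; rewrite inE => /andP[].
  by case=> E _; rewrite E zG in zS.
apply: (colorable_on_hom (h := id)) => //= x y xS yS exy.
by rewrite /adj inE -/(adj G x y) exy subUset !sub1set xS.
Qed.

Definition graph_edges (e : rel T) : {set {set T}} :=
  [set [set p.1; p.2] | p : T * T in [set p | e p.1 p.2]].

Lemma graph_edgesP (e : rel T) : irreflexive e -> forall E, E \in graph_edges e ->
  E \subset [set: T] /\ #|E| = 2.
Proof.
move=> irr_e E /imsetP[[x y]]; rewrite inE /= => exy ->; rewrite subsetT cards2.
by split=> //; case: eqP exy => [->|//]; rewrite irr_e.
Qed.

Lemma mem_graph_edges (e : rel T) x y : symmetric e ->
  ([set x; y] \in graph_edges e) = e x y.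
Proof.
move=> sym_e; apply/imsetP/idP => [[[a b]]|exy]; last by exists (x, y); rewrite ?inE.
rewrite inE /= => eab E; have [ab|ab] := eqVneq a b.
  have : x \in [set a; b] by rewrite -E !inE eqxx.
  have : y \in [set a; b] by rewrite -E !inE eqxx orbT.
  by rewrite ab !inE !orbb => /eqP-> /eqP->; rewrite -{1}ab.
move/eqP: E; rewrite set2_eqE // => /orP[]/andP[/eqP-> /eqP->] //.
by rewrite sym_e.
Qed.

End Bridge.

Lemma ky_lower (r n m : nat) : 3 <= r -> critical_size r.+1 n m ->
  (ky_num r n <= 2 * r%:Z * m%:Z)%R.
Proof.
move=> r3 [T [G [cG <- <-]]]; have r0 : 0 < r by lia.
have cr := critical_vcrit r0 cG.
have := ky_holds_sub r0 (adj_sym G) (@adj_irr _ G) cr (fun T' e' _ => kostochka_yancey r3).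
rewrite /rho /ky_bound /ky_num eb_adj; lia.
Qed.

Lemma vertex_critical_graph (r n m : nat) : 0 < r -> vertex_critical_size r n m ->
  exists2 m', m' <= m & critical_size r.+1 n m'.
Proof.
move=> r0 /edge_critical[T [e [sym_e irr_e /vcritP[nc Hp] [Tn em] ecr]]].
pose G := Graph (graph_edgesP irr_e).
have adjE x y : adj G x y = e x y by exact: mem_graph_edges.
have vG : vertices G = [set: T] by [].
exists #|edges G|.
  rewrite -(leq_pmul2l (isT : 0 < 2)) -eb_adj; apply: leq_trans em.
  by apply: leq_sum => x _; apply: leq_sum => y _; rewrite adjE.
exists T, G; split=> //; last by rewrite vG cardsT.
split=> [|H [sV sE ne]] /=.
  apply: contraNnot nc => /(colorableE _ r0); apply: (colorable_on_hom (h := id)) => //= x y _ _.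
  by rewrite adjE.
apply/(colorableE _ r0).
have sub x y : adj H x y -> e x y by rewrite -adjE; exact: (subsetP sE).
have [VT|VT] := eqVneq (vertices H) [set: T]; last first.
  have := Hp (vertices H); rewrite properT => /(_ VT).
  by apply: (colorable_on_hom (h := id)) => //= x y _ _; exact: sub.
have /subsetPn[E EG EH] : ~~ (edges G \subset edges H).
  by apply/negP => GH; apply: ne; split; [rewrite VT | apply/eqP; rewrite eqEsubset sE].
move: (EG) => /imsetP[[a b]]; rewrite inE /= => eab Eab.
apply: (colorable_on_hom (h := id)) (ecr _ _ eab) => //= x y _ _ xyH.
by rewrite /del_edge sub //=; apply: contraNneq EH => xyE; rewrite Eab -xyE.
Qed.

From mathcomp Require Import all_classical all_reals all_analysis.
Import numFieldNormedType.Exports.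

Local Open Scope ring_scope.
Local Open Scope classical_set_scope.

Lemma f_min (k n m : nat) : critical_size k n m ->
  critical_size k n (f k n) /\ (f k n <= m)%N.
Proof.
move=> cm; rewrite /f; case: pselect => [ex|]; last first.
  by case; exists m; apply/asboolP.
by case: ex_minnP => i /asboolP ci imin; split=> //; apply: imin; apply/asboolP.
Qed.

Lemma F_num (r n : nat) : F r.+1 n = Num.ceil ((ky_num r n)%:~R / (2 * r%:R) : rat).
Proof.
rewrite /F /ky_num !(rmorphB, rmorphD, rmorphM) /= -natr1; congr (Num.ceil (_ / _)); ring.
Qed.

Lemma F_le (r n : nat) (z : int) : (0 < r)%N ->
  (F r.+1 n <= z) = (ky_num r n <= 2 * r%:Z * z).
Proof.
move=> r0; have r0' : 0 < 2 * r%:R :> rat by rewrite mulr_gt0 // ltr0n.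
by rewrite F_num ceil_le_int ler_pdivrMr // mulrC -(ler_int rat) !rmorphM.
Qed.

Lemma f_bounds (r n : nat) : (3 <= r)%N -> (r.+1 + 2 <= n)%N ->
  [/\ F r.+1 n <= (f r.+1 n)%:Z,
      8 * ((f r.+1 n)%:Z - F r.+1 n) <= r%:Z * (r%:Z + 1) - 8 &
      2 * r%:Z * F r.+1 n < ky_num r n + 2 * r%:Z].
Proof.
move=> r3 nr; have r0 : (0 < r)%N by lia.
have [m cm near] := near_ky_critical r3 nr.
have [m' mm cm'] := vertex_critical_graph r0 cm.
have [cf fm] := f_min cm'.
have le_F (z : int) := F_le n z r0.
have hF : ky_num r n <= 2 * r%:Z * F r.+1 n by rewrite -le_F.
split.
- by rewrite le_F; exact: ky_lower.
- by have := near _ hF; lia.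
- have : ~~ (F r.+1 n <= F r.+1 n - 1) by rewrite -ltNge; lia.
  by rewrite le_F -ltNge; lia.
Qed.

Definition ky_density (R : realType) (r : nat) : R :=
  (r%:R + 2) * (r%:R - 1) / (2 * r%:R).

Lemma edge_density_near (R : realType) (r n : nat) : (3 <= r)%N -> (r.+1 + 2 <= n)%N ->
  ky_density R r - (r%:R * (r%:R + 1)) * n%:R^-1 <= edge_density R r.+1 n
    <= ky_density R r + (r%:R * (r%:R + 1)) * n%:R^-1.
Proof.
move=> r3 nr; set L := ky_density R r; have [h1 h2 h3] := f_bounds r3 nr.
have n0 : 0 < n%:R :> R by rewrite ltr0n; lia.
have r0 : 0 < r%:R :> R by rewrite ltr0n; lia.
have r0' : 0 < 2 * r%:R :> R by rewrite mulr_gt0.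
have r3' : 3 <= r%:R :> R by rewrite ler_nat.
have {}h1 : ky_num r n <= 2 * r%:Z * (f r.+1 n)%:Z by rewrite -F_le //; lia.
have {h2 h3}h4 : 2 * r%:Z * (f r.+1 n)%:Z <= ky_num r n + 2 * r%:Z + 2 * r%:Z * (r%:Z * (r%:Z + 1) - 8).
  have : 2 * r%:Z * ((f r.+1 n)%:Z - F r.+1 n) <= 2 * r%:Z * (r%:Z * (r%:Z + 1) - 8).
    apply: ler_wpM2l; first lia.
    have : 0 <= r%:Z * (r%:Z + 1) by apply: mulr_ge0; lia.
    lia.
  by lia.
move: h1 h4; rewrite -!(ler_int R) /ky_num !(rmorphB, rmorphD, rmorphM) /= => h1 h2.
have -> : L = (r%:R + 2) * (r%:R - 1) * n%:R / (2 * r%:R) / n%:R.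
  by rewrite /L /ky_density; field; rewrite !gt_eqF.
rewrite /edge_density -mulrBl -mulrDl !ler_pM2r ?invr_gt0 //.
have h3 : 0 <= r%:R * r%:R :> R by rewrite mulr_ge0 // ltW.
apply/andP; split.
  rewrite lerBlDr ler_pdivrMr //; move: h1; set N := n%:R; set fn := (f _ _)%:R; set q := r%:R.
  move=> h1; have : 0 <= q * q * (q - 3) by rewrite mulr_ge0 // subr_ge0.
  by nra.
rewrite -lerBlDr ler_pdivlMr //; move: h2; set N := n%:R; set fn := (f _ _)%:R; set q := r%:R.
by nra.
Qed.

Lemma edge_density_cvg (R : realType) (r : nat) : (3 <= r)%N ->
  edge_density R r.+1 n @[n --> \oo] --> ky_density R r.
Proof.
move=> r3; set L := ky_density R r.
have inv0 : (n%:R : R)^-1 @[n --> \oo] --> (0 : R).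
  by apply/gtr0_cvgV0; [near=> n; rewrite ltr0n; near: n; exact: nbhs_infty_gt | exact: cvgr_idn].
pose c : R := r%:R * (r%:R + 1).
have cinv : c * n%:R^-1 @[n --> \oo] --> (0 : R).
  by rewrite -[X in _ --> X](mulr0 c); apply: cvgM; [exact: cvg_cst | exact: inv0].
have lo : L - c * n%:R^-1 @[n --> \oo] --> L.
  by rewrite -[X in _ --> X]subr0; apply: cvgB; first exact: cvg_cst.
have hi : L + c * n%:R^-1 @[n --> \oo] --> L.
  by rewrite -[X in _ --> X]addr0; apply: cvgD; first exact: cvg_cst.
apply: (squeeze_cvgr _ lo hi).
by near=> n; apply: edge_density_near => //; near: n; exact: nbhs_infty_ge.
Unshelve. all: by end_near. Qed.

Theorem corollary6 (R : realType) (k : nat) (hk : (4 <= k)%N) :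
  (forall n : nat, (k + 2 <= n)%N ->
     0 <= (f k n)%:R - (F k n)%:~R :> R /\
     (f k n)%:R - (F k n)%:~R <= k%:R * (k%:R - 1) / 8 - 1 :> R) /\
  cvg (edge_density R k n @[n --> \oo]) /\
  phi R k = k%:R / 2 - 1 / (k%:R - 1).
Proof.
case: k hk => // r r3; split=> [n nr|].
  have [h1 h2 _] := f_bounds r3 nr; split.
    by rewrite subr_ge0 -[(f _ _)%:R]/((f _ _)%:Z%:~R) ler_int.
  rewrite lerBrDr -[(f _ _)%:R]/((f _ _)%:Z%:~R) -natr1.
  by move: h2; rewrite -(ler_int R) !(rmorphB, rmorphD, rmorphM) /=; lra.
have cv := @edge_density_cvg R r r3; split; first by apply/cvg_ex; eexists; exact: cv.
rewrite /phi (cvg_lim _ cv) // /ky_density -[r.+1%:R]natr1 addrK; field.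
by rewrite pnatr_eq0; lia.
Qed.
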